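(* Let $n\ge3$. If a domain $\Omega\subset\mathbb R^n$ is $q$-capacitory dense at a point $x\in\mathbb R^n$ for some $1\le q<\infty$, then $\Omega$ is also $q$-fat at $x$. On the other hand, for arbitrary $1<q\le n-1$, there exists a doubling cusp function $w$ so that the outward cusp domain $\Omega^n_w$ is $q$-fat but not $q$-capacitory dense at the origin.
   Context: $B(x,r)$ is the ball of center $x$ and radius $r$, and $A(x;s,t)=B(x,t)\setminus B(x,s)$ for $0<s<t$. $\mathcal H^n$ is $n$-dimensional Hausdorff measure. Variational capacity: for a domain $G\subset\mathbb R^n$, bounded sets $E,F\subset\overline G$ with $\operatorname{dist}(E,F)>0$, and $1\le q<\infty$, let $\mathcal W_q(E,F;G)=\{u\in W^{1,q}(G)\cap C(G\cup E\cup F): u\ge1\text{ on }E,\ u\le0\text{ on }F\}$ and $Cap_q(E,F;G)=\inf_{u\in\mathcal W_q(E,F;G)}\int_G|\nabla u(x)|^q\,dx$. For $1\le q<\infty$, a set $E\subset\mathbb R^n$ is $q$-capacitory dense at $z\in\mathbb R^n$ if $$\limsup_{r\to0^+}\frac{Cap_q\big(E\cap B(z,\frac r4),\,E\cap A(z;\frac r2,\frac{3r}4);\,B(z,r)\big)}{Cap_q\big(B(z,\frac r4),\,A(z;\frac r2,\frac{3r}4);\,B(z,r)\big)}>0 .$$ For $1<q<\infty$, a set $E$ is $q$-thin at $x$ if $$\int_0^1\left(\frac{Cap_q(E\cap B(x,t),A(x;2t,3t);B(x,4t))}{Cap_q(B(x,t),A(x;2t,3t);B(x,4t))}\right)^{\frac1{q-1}}\frac{dt}t<\infty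 ,$$ and $E$ is $1$-thin at $x$ if $\lim_{t\to0}t\,\dfrac{Cap_1(E\cap B(x,t),A(x;2t,3t);B(x,4t))}{\mathcal H^n(B(x,t))}=0$. $E$ is $q$-fat at $x$ if it is not $q$-thin at $x$. Doubling cusp function: $w:[0,\infty)\to[0,\infty)$ continuous, increasing and differentiable with $w(0)=0$, $w(1)=1$, $w(2t)\le Cw(t)$ for all $t>0$ (some constant $C$), $w'$ increasing on $(0,1)$ and $\lim_{t\to0^+}w'(t)=0$. The outward cusp domain is $$\Omega^n_w:=\{z=(t,x)\in\mathbb R\times\mathbb R^{n-1}:0<t\le1,\ |x|<w(t)\}\cup B^n((2,0),\sqrt2).$$ *)

(* Defs.v *)
From HB Require Import structures.
From mathcomp Require Import all_boot all_order all_algebra.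
From mathcomp Require Import all_classical all_reals all_analysis.

Set Implicit Arguments.
Unset Strict Implicit.
Unset Printing Implicit Defensive.

Import Order.TTheory GRing.Theory Num.Theory.
Import numFieldNormedType.Exports.

Local Open Scope classical_set_scope.
Local Open Scope ring_scope.

Definition rV_display : measure_display -> measure_display.
Proof. exact. Qed.

(* The sigma-algebra on 'rV[R]_n is generated by the coordinates: it is the
   Borel sigma-algebra of R^n. *)
Section measurable_rV.
Context {R : realType} {n : nat}.

Definition coord_rV (i : 'I_n) (x : 'rV[R]_n) : R := x ord0 i.

Let rV_set0 : g_sigma_preimage coord_rV set0.
Proof. exact: sigma_algebra0. Qed.

Let rV_setC A : g_sigma_preimage coord_rV A -> g_sigma_preimage coord_rV (~` A).
Proof. exact: sigma_algebraC. Qed.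

Let rV_bigcup (F : (set 'rV[R]_n)^nat) :
  (forall i, g_sigma_preimage coord_rV (F i)) ->
  g_sigma_preimage coord_rV (\bigcup_i (F i)).
Proof. exact: sigma_algebra_bigcup. Qed.

HB.instance Definition _ := @isMeasurable.Build
  (rV_display default_measure_display) 'rV[R]_n (g_sigma_preimage coord_rV)
  rV_set0 rV_setC rV_bigcup.

Lemma measurable_coord_rV i : measurable_fun setT (coord_rV i).
Proof.
move=> _ B mB; rewrite setTI; apply: sub_sigma_algebra.
rewrite -bigcup_seq/=; exists i => /=; first by rewrite mem_index_enum.
by exists B => //; rewrite setTI.
Qed.

Lemma measurable_fun_rV d (T : measurableType d) (f : T -> 'rV[R]_n) :
  (forall i, measurable_fun setT (coord_rV i \o f)) -> measurable_fun setT f.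
Proof.
move=> mf _ A mA; rewrite setTI.
suff : g_sigma_preimage (fun i => coord_rV i \o f) `<=` measurable.
  by apply; rewrite g_sigma_preimage_comp; exists A => //; rewrite setTI.
apply: smallest_sub; first exact: sigma_algebra_measurable.
rewrite -bigcup_seq; apply: bigcup_sub => i _ B [C mC <-].
exact: mf.
Qed.

End measurable_rV.

Section cons_rV.
Context {R : realType}.

Definition cons_rV n (t : R) (x : 'rV[R]_n) : 'rV[R]_n.+1 :=
  row_mx (const_mx t : 'rV[R]_1) x.

Definition consp_rV n (p : measurableTypeR R * 'rV[R]_n) := cons_rV p.1 p.2.

Definition uncons_rV n (x : 'rV[R]_n.+1) : measurableTypeR R * 'rV[R]_n :=
  (x ord0 ord0, \row_i x ord0 (lift ord0 i)).

Lemma consp_rVK n : cancel (@consp_rV n) (@uncons_rV n).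
Proof.
move=> [t x]; rewrite /uncons_rV /consp_rV /cons_rV/=; congr pair.
  by rewrite mxE; case: splitP => // j _; rewrite mxE.
apply/rowP => i; rewrite !mxE; case: splitP => [[[|//]]//|j].
by move=> /= ij; congr (x _ _); apply/val_inj => /=; case: ij.
Qed.

Lemma measurable_consp_rV n : measurable_fun setT (@consp_rV n).
Proof.
apply: measurable_fun_rV => i.
rewrite /comp /consp_rV /coord_rV /cons_rV.
case: (@splitP 1 n i) => j ij.
  rewrite (_ : (fun _ => _) = fst); first exact: measurable_fst.
  apply/funext => p; rewrite mxE.
  by case: splitP => k ik; [rewrite mxE|move: ij; rewrite ik; case: j => [[]]].
rewrite (_ : (fun _ => _) = coord_rV j \o snd); last first.
  apply/funext => p; rewrite mxE/=; case: splitP => k; rewrite ij.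
    by case: k => [[]].
  by move=> [jk]; congr (p.2 _ _); apply/val_inj.
by apply: measurableT_comp; [exact: measurable_coord_rV|exact: measurable_snd].
Qed.

Lemma measurable_uncons_rV n : measurable_fun setT (@uncons_rV n).
Proof.
apply: measurable_fun_pair => /=; first exact: (measurable_coord_rV ord0).
apply: measurable_fun_rV => i; rewrite /comp /coord_rV.
under eq_fun do rewrite mxE.
exact: (measurable_coord_rV (lift ord0 i)).
Qed.

End cons_rV.

Section lebesgue_rV_step.
Context {R : realType} {n : nat}.
Variable mu : {sigma_finite_measure set 'rV[R]_n -> \bar R}.

Definition lebesgue_rV_step : set 'rV[R]_n.+1 -> \bar R :=
  pushforward ((@lebesgue_measure R) \x mu)%E (@consp_rV R n).

Let step0 : lebesgue_rV_step set0 = 0%E.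
Proof. by rewrite /lebesgue_rV_step /pushforward preimage_set0 measure0. Qed.

Let step_ge0 A : (0 <= lebesgue_rV_step A)%E.
Proof. by rewrite /lebesgue_rV_step /pushforward measure_ge0. Qed.

Let step_sigma_additive : semi_sigma_additive lebesgue_rV_step.
Proof.
pose m := measure_function_pushforward__canonical__measure_function_Measure
  (product_measure1 (@lebesgue_measure R) mu) (@measurable_consp_rV R n).
exact: (@measure_semi_sigma_additive _ _ _ m).
Qed.

HB.instance Definition _ := isMeasure.Build _ _ _ lebesgue_rV_step
  step0 step_ge0 step_sigma_additive.

Let step_sigma_finite : sigma_finite setT lebesgue_rV_step.
Proof.
have /sigma_finiteP[F [FT ndF Foo]] := sigma_finiteT (@lebesgue_measure R).
have /sigma_finiteP[G [GT ndG Goo]] := sigma_finiteT mu.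
exists (fun k => @uncons_rV R n @^-1` (F k `*` G k)).
  rewrite -preimage_bigcup; apply/esym; rewrite -subTset => x _ /=.
  have [i _ Fi] : (\bigcup_k F k) (uncons_rV x).1 by rewrite -FT.
  have [j _ Gj] : (\bigcup_k G k) (uncons_rV x).2 by rewrite -GT.
  exists (maxn i j) => //; split => /=.
    by move: Fi; exact/subsetPset/ndF/leq_maxl.
  by move: Gj; exact/subsetPset/ndG/leq_maxr.
move=> k; have [mF Fkoo] := Foo k; have [mG Gkoo] := Goo k.
have mFG := measurableX mF mG; split.
  by rewrite -[X in measurable X]setTI; exact: measurable_uncons_rV.
rewrite /lebesgue_rV_step /pushforward -comp_preimage.
rewrite (_ : _ \o _ = id) ?preimage_id; last first.
  by apply/funext => p /=; rewrite consp_rVK.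
by rewrite product_measure1E// lte_mul_pinfty// ge0_fin_numE.
Qed.

HB.instance Definition _ := Measure_isSigmaFinite.Build _ _ _ lebesgue_rV_step
  step_sigma_finite.

End lebesgue_rV_step.

(* Lebesgue measure on R^n, as the n-fold product of the Lebesgue measure of R. *)
Fixpoint lebesgue_rV (R : realType) (n : nat) :
    {sigma_finite_measure set 'rV[R]_n -> \bar R} :=
  if n is m.+1 then lebesgue_rV_step (lebesgue_rV R m)
  else \d_(0 : 'rV[R]_0).

Section euclidean.
Context {R : realType} {n : nat}.
Implicit Types (x y : 'rV[R]_n) (A : set 'rV[R]_n).

(* The norm `| x | carried by 'rV[R]_n is the sup norm; it induces the same
   topology. *)
Definition enorm x : R := Num.sqrt (\sum_(i < n) x ord0 i ^+ 2).

Definition eball x (r : R) : set 'rV[R]_n := [set y | enorm (y - x) < r].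

Definition annulus x (s t : R) : set 'rV[R]_n := eball x t `\` eball x s.

Definition domain A := [/\ A !=set0, open A & connected A].

Definition ediam A : \bar R :=
  ereal_sup (0%E |` [set (enorm (p.1 - p.2))%:E | p in A `*` A]).

(* n-dimensional Hausdorff measure of R^n, for n > 0, normalized so that it
   agrees with Lebesgue measure. *)
Definition hausdorff_delta (delta : \bar R) A : \bar R :=
  ereal_inf [set (\sum_(0 <= k <oo)
      lebesgue_rV R n (eball 0 1) * (2^-1%:E * ediam (F k)) ^+ n)%E
    | F in [set F : (set 'rV[R]_n)^nat |
        A `<=` \bigcup_k F k /\ forall k, (ediam (F k) <= delta)%E]].

Definition hausdorff A : \bar R :=
  ereal_sup [set hausdorff_delta delta%:E A | delta in [set delta : R | 0 < delta]].

End euclidean.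

Section sobolev.
Context {R : realType} {n : nat}.
Implicit Types (G E F : set 'rV[R]_n) (u v : 'rV[R]_n -> R) (q : R).
Local Notation mu := (lebesgue_rV R n).

Definition partial (i : 'I_n) u : 'rV[R]_n -> R :=
  fun x => 'D_(delta_mx ord0 i) u x.

Definition smooth u := forall s : seq 'I_n,
  let v := foldr partial u s in
  continuous v /\ forall x i, derivable v x (delta_mx ord0 i).

Definition test_function G u :=
  [/\ smooth u, compact (closure [set x | u x != 0]) &
      closure [set x | u x != 0] `<=` G].

Definition in_Lq q G u :=
  measurable_fun G u /\ (\int[mu]_(x in G) (`|u x| `^ q)%:E < +oo)%E.

Definition weak_partial G (i : 'I_n) u v : Prop := forall phi, test_function G phi ->
  (\int[mu]_(x in G) (u x * partial i phi x)%:E =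
   - \int[mu]_(x in G) (v x * phi x)%:E)%E.

Definition weak_gradient q G u (g : 'rV[R]_n -> 'rV[R]_n) := forall i,
  in_Lq q G (fun x => g x ord0 i) /\ weak_partial G i u (fun x => g x ord0 i).

Definition sobolev q G u := in_Lq q G u /\ exists g, weak_gradient q G u g.

Definition cap_admissible q E F G u :=
  [/\ sobolev q G u, {within G `|` E `|` F, continuous u},
      (forall x, E x -> 1 <= u x) & (forall x, F x -> u x <= 0)].

(* The weak gradient g of u is unique up to a null set, so that the infimum
   over all pairs (u, g) is the infimum over all admissible u. *)
Definition Cap q E F G : \bar R :=
  ereal_inf [set c | exists u g, [/\ cap_admissible q E F G u,
    weak_gradient q G u g & c = (\int[mu]_(x in G) (enorm (g x) `^ q)%:E)%E]].

End sobolev.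

Section density.
Context {R : realType} {n : nat}.
Implicit Types (q r t : R) (E : set 'rV[R]_n) (x z : 'rV[R]_n).
Local Open Scope ereal_scope.

Definition capacitory_dense q E z : Prop :=
  0 < limf_esup (fun r : R =>
    Cap q (E `&` eball z (r / 4)) (E `&` annulus z (r / 2) (3 * r / 4))
          (eball z r) /
    Cap q (eball z (r / 4)) (annulus z (r / 2) (3 * r / 4)) (eball z r)) 0%R^'+.

Definition thin q E x : Prop :=
  if q == 1%R then
    (fun t : R => t%:E *
       (Cap 1 (E `&` eball x t) (annulus x (2 * t) (3 * t)) (eball x (4 * t)) /
        hausdorff (eball x t))) @ 0%R^'+ --> (0 : \bar R)
  else
    \int[@lebesgue_measure R]_(t in `]0%R, 1%R[)
      ((Cap q (E `&` eball x t) (annulus x (2 * t) (3 * t)) (eball x (4 * t)) /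
        Cap q (eball x t) (annulus x (2 * t) (3 * t)) (eball x (4 * t)))
         `^ (q - 1)^-1 * (t^-1)%:E) < +oo.

Definition fat q E x := ~ thin q E x.

End density.

(* Derivatives are only taken at t > 0; differentiability at 0 is one-sided. *)
Record doubling_cusp_function (R : realType) (w : R -> R) : Prop := {
  cusp_ge0 : forall t : R, 0 <= t -> 0 <= w t ;
  cusp_continuous : {within `[0, +oo[, continuous w} ;
  cusp_increasing : {in `[0, +oo[ &, {homo w : s t / (s < t)%R}} ;
  cusp_derivable : forall t : R, 0 < t -> derivable w t 1 ;
  cusp_derivable0 : cvg ((fun h : R => h^-1 * (w h - w 0)) @ 0^'+) ;
  cusp0 : w 0 = 0 ;
  cusp1 : w 1 = 1 ;
  cusp_doubling : exists C : R, forall t : R, 0 < t -> w (2 * t) <= C * w t ;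
  cusp_deriv_increasing : {in `]0, 1[ &, {homo derive1 w : s t / (s < t)%R}} ;
  cusp_deriv_cvg0 : derive1 w @ 0^'+ --> (0 : R) }.

(* The ambient dimension is m.+1. *)
Definition outward_cusp (R : realType) (m : nat) (w : R -> R) :
    set 'rV[R]_m.+1 :=
  [set z | exists (t : R) (x : 'rV[R]_m),
     [/\ z = cons_rV t x, 0 < t <= 1 & enorm x < w t]] `|`
  eball (cons_rV 2 0) (Num.sqrt 2).

Arguments outward_cusp {R} m w.

(* Main.v *)
(* Capacitory density implies fatness.  Suppose that a competitor for the pair
   E /\ B(x,t), A(x;2t,3t) has small energy for some t in [1.1 r, 1.2 r].
   Mollified, truncated to [0,1] and multiplied by a cutoff between B(x,r) and
   B(x,2r), it becomes a competitor for E /\ B(x,r), E /\ A(x;2r,3r); its energy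
   is still small by the Poincare inequality for functions that vanish on
   A(x;2t,3t).  Such t exist for all small r if E is q-thin at x and q > 1,
   since a bad r contributes at least a fixed amount to the integral over
   [1.1 r, 1.2 r] and infinitely many of them make it diverge.  For q = 1 one
   takes t = r: monotonicity of the capacity and H^n(B(x,t)) <= C t^n suffice.

   The cusp.  Take w(t) = t (1 - ln t)^(-gam) with gam = (q-1)/(n-1).  The part
   of the cusp in B(0,t) contains a tube of length and radius comparable to t
   and w(t), whose capacity is at least a multiple of w(t)^(n-1) t^(1-q); hence
   the integrand defining thinness is at least a multiple of 1/(t (1 - ln t)),
   and the integral diverges.  Since w(t)/t tends to 0 and q <= n-1, the
   function that is 1 near the axis of the cusp, decays logarithmically in the
   distance to the axis, and is cut off along the axis between heights where
   E /\ B(0,t) and E /\ A(0;2t,3t) lie, has energy o(t^(n-q)). *)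
Require Import Defs.
From mathcomp Require Import all_boot all_order all_algebra.
From mathcomp Require Import all_classical all_reals all_analysis.
From mathcomp Require Import measurable_realfun ring lra.

Set Implicit Arguments.
Unset Strict Implicit.
Unset Printing Implicit Defensive.

Import Order.TTheory GRing.Theory Num.Theory.
Import numFieldNormedType.Exports.

Local Open Scope classical_set_scope.
Local Open Scope ring_scope.

(** * Smooth functions of a real variable *)

(** Upper bounds on capacities only use $C^1$ competitors, whose weak gradient is the classical one.
    Lower bounds face an arbitrary weak gradient; it is paired with a single explicit test function,
    so that no restriction of a Sobolev function to lines is taken. In place of Hölder and Jensen
    stands the pointwise inequality x <= l + l^(1-q) x^q with a free level l. It costs constants,
    which is harmless because only the order t^(n-q) of the capacities matters, and it includes q =
    1. Thinness for q > 1 is an integral condition: it yields smallness at some radius near r, not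
    at r itself. Taking that radius t above r keeps B(x,r) inside B(x,t). For the cusp the critical
    case q = n-1 dictates the competitor: every dyadic shell around the axis then costs the same, so
    that one cutoff gains nothing, while averaging M of them multiplies the cost by M^(1-q). The
    capacity quotient is never shown to be measurable in t; its integral is only bounded below, by
    step functions. *)

Section smooth_real.
Context {R : realType}.
Implicit Types f g : R -> R.

(** Smoothness is cut into finite orders because the derivative of a product or a composite contains
    the functions themselves: an induction on [k] over all pairs of functions closes, since order
    [k.+1] implies order [k]. *)
Fixpoint differentiable_upto k f : Prop :=
  if k is m.+1 then (forall x, derivable f x 1) /\ differentiable_upto m (derive1 f)
  else True.

Definition smooth_real f := forall k, differentiable_upto k f.

Lemma differentiable_upto_pred k f :
  differentiable_upto k.+1 f -> differentiable_upto k f.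
Proof. by elim: k f => [//|k IH] f [df /IH]. Qed.

Lemma differentiable_upto_cst k (c : R) : differentiable_upto k (cst c).
Proof.
elim: k c => [//|k IH] c; split; first by move=> x; exact: derivable_cst.
suff -> : derive1 (cst c) = cst (0 : R) by [].
by apply/funext => x; rewrite derive1_cst.
Qed.

Lemma differentiable_uptoD k f g : differentiable_upto k f ->
  differentiable_upto k g -> differentiable_upto k (fun x => f x + g x).
Proof.
elim: k f g => [//|k IH] f g [df sf] [dg sg]; split.
  by move=> x; exact: derivableD.
suff -> : derive1 (fun x => f x + g x) = (fun x => derive1 f x + derive1 g x) by exact: IH.
by apply/funext => x; rewrite !derive1E -deriveD.
Qed.

Lemma differentiable_uptoM k f g : differentiable_upto k f ->
  differentiable_upto k g -> differentiable_upto k (fun x => f x * g x).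
Proof.
elim: k f g => [//|k IH] f g fk gk.
have [df sf] := fk; have [dg sg] := gk; split.
  by move=> x; exact: derivableM.
suff -> : derive1 (fun x => f x * g x) =
    (fun x => f x * derive1 g x + g x * derive1 f x).
  by apply: differentiable_uptoD; apply: IH => //;
    exact: differentiable_upto_pred.
by apply/funext => x; rewrite !derive1E -[LHS]/('D_1 (f * g) x) deriveM.
Qed.

Lemma differentiable_upto_comp k f g : differentiable_upto k f ->
  differentiable_upto k g -> differentiable_upto k (fun x => f (g x)).
Proof.
elim: k f g => [//|k IH] f g fk gk.
have [df sf] := fk; have [dg sg] := gk; split.
  move=> x; have /derivableP dgx := dg x; have /derivableP dfx := df (g x).
  by have [] := is_derive1_comp dfx dgx.
suff -> : derive1 (fun x => f (g x)) = (fun x => derive1 f (g x) * derive1 g x).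
  apply: differentiable_uptoM => //.
  by apply: IH => //; exact: differentiable_upto_pred.
by apply/funext => x; rewrite -[LHS]/(derive1 (f \o g) x) derive1_comp.
Qed.

Lemma smooth_real_cst (c : R) : smooth_real (cst c).
Proof. by move=> k; exact: differentiable_upto_cst. Qed.

Lemma smooth_realD f g :
  smooth_real f -> smooth_real g -> smooth_real (fun x => f x + g x).
Proof. by move=> sf sg k; exact: differentiable_uptoD. Qed.

Lemma smooth_realM f g :
  smooth_real f -> smooth_real g -> smooth_real (fun x => f x * g x).
Proof. by move=> sf sg k; exact: differentiable_uptoM. Qed.

Lemma smooth_real_comp f g :
  smooth_real f -> smooth_real g -> smooth_real (fun x => f (g x)).
Proof. by move=> sf sg k; exact: differentiable_upto_comp. Qed.

Lemma smooth_real_id : smooth_real (fun x => x).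
Proof.
case=> [//|k]; split=> [x|]; first exact: derivable_id.
suff -> : derive1 (fun x => x) = cst (1 : R) by exact: differentiable_upto_cst.
by apply/funext => x; rewrite derive1E derive_id.
Qed.

Lemma smooth_real_affine (a b : R) : smooth_real (fun x => a * x + b).
Proof.
apply: smooth_realD (smooth_real_cst b).
exact: smooth_realM (smooth_real_cst a) smooth_real_id.
Qed.

Lemma smooth_real_derivable f x : smooth_real f -> derivable f x 1.
Proof. by move=> /(_ 1%N) []. Qed.

Lemma smooth_real_derive1 f : smooth_real f -> smooth_real (derive1 f).
Proof. by move=> sf k; have [] := sf k.+1. Qed.

Lemma smooth_real_continuous f : smooth_real f -> continuous f.
Proof.
move=> sf x; apply: differentiable_continuous.
exact/derivable1_diffP/smooth_real_derivable.
Qed.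

End smooth_real.

(** * Flat functions, smooth steps and bumps *)

Section flat.
Context {R : realType}.

(* [flat m] is x^-m exp(-1/x), extended by 0 to x <= 0; derivatives of such
   functions are linear combinations of them. *)
Definition flat (m : nat) (x : R) : R :=
  if 0 < x then x^-1 ^+ m * expR (- x^-1) else 0.

Lemma flat_le0 m x : x <= 0 -> flat m x = 0.
Proof. by rewrite /flat leNgt => /negbTE ->. Qed.

Lemma flat_gt0 m x : 0 < x -> 0 < flat m x.
Proof.
by move=> x0; rewrite /flat x0 mulr_gt0// ?expR_gt0// exprn_gt0// invr_gt0.
Qed.

Lemma flat_ge0 m x : 0 <= flat m x.
Proof.
by have [/flat_gt0/ltW//|/flat_le0 ->] := ltP 0 x.
Qed.

(** Used twice at 0: [flat m h] is h^2 times [flat m.+2 h], so that a bound on [flat m.+2] makes the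
    difference quotient O(h). *)
Lemma flat_mul m x : flat m x = x * flat m.+1 x.
Proof.
rewrite /flat; case: ifPn => [x0|]; last by rewrite mulr0.
by rewrite exprS !mulrA divff ?mul1r// gt_eqF.
Qed.

(** With y = 1/x the claim is y^m <= (m+1)^m exp(y). Split exp(y) into m+1 factors exp(y/(m+1)),
    each at least y/(m+1) and at least 1. Taking m+1 factors instead of m keeps the case m = 0 free
    of a division by 0. *)
Lemma flat_le m x : flat m x <= m.+1%:R ^+ m.
Proof.
rewrite /flat; case: ifPn => [x0|_]; last by rewrite exprn_ge0.
set y := x^-1; have y0 : 0 < y by rewrite invr_gt0.
rewrite expRN ler_pdivrMr ?expR_gt0//.
have -> : y = m.+1%:R * (y / m.+1%:R) by rewrite mulrCA divff ?mulr1.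
rewrite expRM_natl.
have ym : 0 <= y / m.+1%:R by rewrite divr_ge0// ltW.
rewrite exprMn; apply: ler_pM => //; rewrite ?exprn_ge0//.
have le1 : 1 + y / m.+1%:R <= expR (y / m.+1%:R) by exact: expR_ge1Dx.
have /le_trans : (y / m.+1%:R) ^+ m <= expR (y / m.+1%:R) ^+ m.
  by rewrite lerXn2r ?nnegrE ?expR_ge0// (le_trans _ le1)// lerDr.
apply; rewrite exprS ler_peMl ?exprn_ge0 ?expR_ge0//.
by rewrite (le_trans _ le1)// lerDl.
Qed.

Lemma is_derive_flat m (x : R) :
  is_derive x 1 (flat m) (flat m.+2 x - m%:R * flat m.+1 x).
Proof.
have [x0|x0|->] := ltgtP x 0.
- rewrite !flat_le0 ?(ltW x0)// mulr0 subr0.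
  apply: (@near_eq_is_derive _ _ _ (cst 0)).
  near=> y; rewrite flat_le0//; apply/ltW; near: y; exact: lt_nbhsl.
- apply: (@near_eq_is_derive _ _ _
    (fun y : R => y^-1 ^+ m * expR (- y^-1))).
    near=> y; rewrite /flat ifT//; near: y; exact: lt_nbhsr.
  have x1 : x != 0 by rewrite gt_eqF.
  have dV : is_derive x 1 (fun y : R => y^-1) (- x ^- 2).
    apply: DeriveDef; first by apply: derivableV => //; exact: derivable_id.
    by rewrite deriveV// ?derive_id ?scaler1//; exact: derivable_id.
  have dX : is_derive x 1 (fun y : R => y^-1 ^+ m)
      ((m%:R * x^-1 ^+ m.-1) * (- x ^- 2)).
    rewrite (_ : (fun y : R => y^-1 ^+ m) = (fun y : R => y^-1) ^+ m).
      exact: is_deriveX.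
    by apply/funext => y; rewrite exprfctE.
  have dE : is_derive x 1 (fun y : R => expR (- y^-1))
      (expR (- x^-1) * (x ^- 2)).
    apply: (@is_derive1_comp _ expR (fun y => - y^-1)).
    by rewrite -[X in is_derive _ _ _ X]opprK; exact: is_deriveN.
  have H : is_derive x 1 (fun y : R => y^-1 ^+ m * expR (- y^-1)) _ :=
    is_deriveM dX dE.
  apply: (is_derive_eq H); rewrite /flat x0 !scalerA.
  rewrite /GRing.scale/= -!exprVn; case: m {dX H} => [|m] /=.
    by rewrite !expr0 !exprS !expr0; ring.
  by rewrite !exprS; ring.
- rewrite !flat_le0// mulr0 subr0.
  suff H : h^-1 *: ((flat m \o shift 0) (h *: 1) - flat m 0) @[h --> 0^'] --> (0:R).
    by apply: DeriveDef; [apply/cvg_ex; exists 0|exact/cvg_lim].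
  have C0 : 0 < m.+3%:R ^+ m.+2 :> R by rewrite exprn_gt0.
  apply/cvgr0Pnorm_le => e e0; near=> h.
  have h0 : h != 0 by near: h; exact: nbhs_dnbhs_neq.
  rewrite /= addr0 (flat_le0 _ (lexx 0)) subr0 /GRing.scale/= mulr1.
  rewrite flat_mul (flat_mul m.+1) mulKf// normrM (ger0_norm (flat_ge0 _ _)).
  apply: le_trans (ler_wpM2l (normr_ge0 h) (flat_le m.+2 h)) _.
  rewrite -ler_pdivlMr//; near: h; apply: dnbhs0_le; exact: divr_gt0.
Unshelve. all: by end_near. Qed.

Lemma smooth_flat m : smooth_real (flat m).
Proof.
move=> k; elim: k m => [//|k IH] m; split.
  by move=> x; have [] := is_derive_flat m x.
have -> : derive1 (flat m) = fun x => flat m.+2 x + (- m%:R) * flat m.+1 x.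
  by apply/funext => x; rewrite derive1E mulNr; have [_] := is_derive_flat m x.
apply: differentiable_uptoD => //.
by apply: differentiable_uptoM => //; exact: differentiable_upto_cst.
Qed.

(** A composition rather than the usual quotient f(x)/(f(x)+f(1-x)): for x <= 0 the inner [flat] has
    its maximal argument, for x >= 1 a nonpositive one, and the derivative is a single product of
    nonnegative factors whose sign and zeros are visible. *)
Definition smooth_step (x : R) : R :=
  1 - flat 0 (flat 0 1 - flat 0 x) / flat 0 (flat 0 1).

Lemma smooth_smooth_step : smooth_real smooth_step.
Proof.
have -> : smooth_step = fun x =>
    1 + (- (flat 0 (flat 0 1))^-1) * flat 0 (flat 0 1 + (-1) * flat 0 x).
  by apply/funext => x; rewrite /smooth_step mulN1r mulNr mulrC.
apply: smooth_realD (smooth_real_cst _) _.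
apply: smooth_realM (smooth_real_cst _) _.
apply: (smooth_real_comp (smooth_flat 0)).
apply: smooth_realD (smooth_real_cst _) _.
apply: smooth_realM (smooth_real_cst _) (smooth_flat 0).
Qed.

Lemma flat0_le x y : x <= y -> flat 0 x <= flat 0 y.
Proof.
move=> xy; have [x0|x0] := ltP 0 x; last by rewrite flat_le0// flat_ge0.
have y0 := lt_le_trans x0 xy.
by rewrite /flat x0 y0 !expr0 !mul1r ler_expR lerN2 lef_pV2.
Qed.

Lemma flat0_lt x y : 0 < y -> x < y -> flat 0 x < flat 0 y.
Proof.
move=> y0 xy; have [x0|x0] := ltP 0 x; last by rewrite flat_le0// flat_gt0.
by rewrite /flat x0 y0 !expr0 !mul1r ltr_expR ltrN2 ltf_pV2.
Qed.

Let flat11 : 0 < flat 0 (flat 0 1).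
Proof. by rewrite !flat_gt0. Qed.

Lemma smooth_step_le0 x : x <= 0 -> smooth_step x = 0.
Proof.
by move=> x0; rewrite /smooth_step (flat_le0 _ x0) subr0 divff ?subrr// gt_eqF.
Qed.

Lemma smooth_step_ge1 x : 1 <= x -> smooth_step x = 1.
Proof.
move=> x0; rewrite /smooth_step (@flat_le0 _ (_ - _)) ?mul0r ?subr0//.
by rewrite subr_le0 flat0_le.
Qed.

Lemma smooth_step_itv x : 0 <= smooth_step x <= 1.
Proof.
rewrite /smooth_step; apply/andP; split.
  rewrite subr_ge0 ler_pdivrMr// mul1r; apply: flat0_le.
  by rewrite gerBl flat_ge0.
by rewrite gerBl divr_ge0// flat_ge0.
Qed.

Lemma derive1_smooth_step x : derive1 smooth_step x =
  flat 2 (flat 0 1 - flat 0 x) * flat 2 x / flat 0 (flat 0 1).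
Proof.
rewrite derive1E.
have df (y : R) : is_derive y 1 (flat 0) (flat 2 y).
  by apply: is_derive_eq (is_derive_flat 0 y) _; rewrite mul0r subr0.
have dg : is_derive x 1 (fun x => flat 0 1 - flat 0 x) (0 - flat 2 x).
  exact: is_deriveB.
have dc : is_derive x 1 (fun x => flat 0 (flat 0 1 - flat 0 x)) _ :=
  is_derive1_comp (df _) dg.
have dm : is_derive x 1 (fun x => flat 0 (flat 0 1 - flat 0 x) * cst (flat 0 (flat 0 1))^-1 x) _ :=
  is_deriveM dc (is_derive_cst _ _ _).
have ds : is_derive x 1 smooth_step _ := is_deriveB (is_derive_cst _ _ _) dm.
have [_ ->] := ds; rewrite /GRing.scale/=; ring.
Qed.

Lemma derive1_smooth_step_ge0 x : 0 <= derive1 smooth_step x.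
Proof. by rewrite derive1_smooth_step divr_ge0 ?mulr_ge0 ?flat_ge0. Qed.

Lemma derive1_smooth_step_gt0 x : 0 < x < 1 -> 0 < derive1 smooth_step x.
Proof.
move=> /andP[x0 x1]; rewrite derive1_smooth_step divr_gt0// mulr_gt0// flat_gt0//.
by rewrite subr_gt0 flat0_lt.
Qed.

Lemma derive1_smooth_step_out x : (x <= 0) || (1 <= x) ->
  derive1 smooth_step x = 0.
Proof.
rewrite derive1_smooth_step => /orP[x0|x1].
  by rewrite (flat_le0 2 x0) mulr0 mul0r.
by rewrite (@flat_le0 2 (_ - _)) ?mul0r// subr_le0 flat0_le.
Qed.

Definition smooth_bump (x : R) : R := flat 0 (1 - x) * flat 0 (1 + x).

Lemma smooth_smooth_bump : smooth_real smooth_bump.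
Proof.
apply: smooth_realM; apply: (smooth_real_comp (smooth_flat 0)).
  have -> : (fun x : R => 1 - x) = fun x => -1 * x + 1.
    by apply/funext => x; rewrite mulN1r addrC.
  exact: smooth_real_affine.
exact: smooth_realD (smooth_real_cst 1) smooth_real_id.
Qed.

Lemma smooth_bump_ge0 x : 0 <= smooth_bump x.
Proof. by rewrite mulr_ge0 ?flat_ge0. Qed.

Lemma smooth_bump_gt0 x : `|x| < 1 -> 0 < smooth_bump x.
Proof.
by rewrite ltr_norml => /andP[? ?]; rewrite mulr_gt0// flat_gt0//; lra.
Qed.

Lemma smooth_bump_out x : 1 <= `|x| -> smooth_bump x = 0.
Proof.
rewrite ler_normr => /orP[x1|x1]; rewrite /smooth_bump.
  by rewrite flat_le0 ?mul0r// subr_le0.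
by rewrite (@flat_le0 _ (1 + x)) ?mulr0//; lra.
Qed.

Lemma smooth_bumpN x : smooth_bump (- x) = smooth_bump x.
Proof. by rewrite /smooth_bump opprK mulrC. Qed.

Lemma flat_le1 x : flat 0 x <= 1.
Proof. exact: flat_le. Qed.

Lemma smooth_bump_le1 x : smooth_bump x <= 1.
Proof. by rewrite mulr_ile1 ?flat_ge0 ?flat_le1. Qed.

End flat.

#[global] Opaque smooth_step smooth_bump flat.

(** * Lebesgue measure on R^n *)

Section borel_rV.
Context {R : realType} {n : nat}.
Implicit Types (x : 'rV[R]_n) (A : 'I_n -> set R).

Definition rbox A : set 'rV[R]_n := [set x | forall i, A i (x ord0 i)].

Lemma measurable_rbox A :
  (forall i, measurable (A i)) -> measurable (rbox A).
Proof.
move=> mA.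
have -> : rbox A = \bigcap_(i in [set: 'I_n]) (coord_rV i @^-1` A i).
  by apply/seteqP; split => [x Ax i _|x Ax i]; [exact: Ax|exact: Ax].
apply: fin_bigcap_measurable => // i _.
rewrite -[X in measurable X]setTI.
exact: measurable_coord_rV.
Qed.

(** The sigma-algebra is generated by coordinates, so an open set is written as a countable union of
    boxes with rational centre and radius 1/(k+1). Around a point whose ball of radius e lies in
    [U], a box of radius d < e/2 containing the point stays in [U]. *)
Lemma open_measurable_rV (U : set 'rV[R]_n) : open U -> measurable U.
Proof.
move=> oU.
pose b (p : 'rV[rat]_n * nat) : set 'rV[R]_n :=
  rbox (fun i => ball (ratr (p.1 ord0 i) : R) (p.2.+1%:R^-1)).
have -> : U = \bigcup_(p in [set p | b p `<=` U]) b p.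
  apply/seteqP; split => [x Ux|x [p /= bU /bU]//].
  have /nbhs_ballP[e /= e0 xeU] : nbhs x U by exact: open_nbhs_nbhs.
  have [k ke] : exists k : nat, k.+1%:R^-1 < e / 2.
    near \oo => k; exists k; near: k.
    by apply: near_infty_natSinv_lt (PosNum _); rewrite divr_gt0.
  set d : R := k.+1%:R^-1 in ke; have d0 : 0 < d by rewrite invr_gt0.
  have /choice[q qx] : forall i : 'I_n, exists q : rat, ball (x ord0 i) d (ratr q : R).
    move=> i; have : x ord0 i - d < x ord0 i + d by lra.
    move=> /rat_in_itvoo[q]; rewrite in_itv/= => /andP[q1 q2]; exists q.
    by rewrite /ball/= ltr_norml; apply/andP; split; lra.
  exists (\row_i q i, k); last first.
    by move=> i /=; rewrite mxE; exact/ball_sym/qx.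
  move=> y /= by'; apply: xeU; split => // i j; rewrite (ord1 i).
  have := by' j; rewrite /= mxE => yj.
  apply: (@le_ball _ _ _ (d + d)).
    by rewrite [leRHS]splitr lerD// ltW.
  exact: ball_triangle (qx j) yj.
have -> : \bigcup_(p in [set p | b p `<=` U]) b p =
    \bigcup_k (if unpickle k is Some p then
      (if `[< b p `<=` U >] then b p else set0) else set0).
  apply/seteqP; split => [x [p /= bU bx]|x [k _]].
    by exists (pickle p) => //; rewrite pickleK asboolT.
  by case: unpickle => // p; case: asboolP => // bU bx; exists p.
apply: bigcup_measurable => k _.
case: unpickle => // p; case: asboolP => // _.
by apply: measurable_rbox => i; rewrite ball_itv; exact: measurable_itv.
Unshelve. all: by end_near. Qed.

Lemma continuous_measurable_rV (f : 'rV[R]_n -> R) :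
  continuous f -> measurable_fun setT f.
Proof.
move=> cf; apply: (measurability _ (RGenOpens.measurableE R)).
move=> _ [_ [a [b ->] <-]]; rewrite setTI; apply: open_measurable_rV.
by move/continuousP : cf; apply; exact: interval_open.
Qed.

Lemma coord_rV_continuous i : continuous (@coord_rV R n i).
Proof. exact: coord_continuous. Qed.

Lemma enorm_continuous : continuous (@enorm R n).
Proof.
rewrite /enorm => x; apply: (continuous_comp _ (@sqrt_continuous R _)).
move: x; apply: (@continuous_big R 'I_n +%R 0 xpredT) => [|i _].
  by move=> -[a b]; apply: cvgD; [exact: cvg_fst|exact: cvg_snd].
under eq_fun do rewrite expr2.
by move=> x; apply: continuousM; exact: coord_rV_continuous.
Qed.

Lemma enorm_sub_continuous x : continuous (fun y : 'rV[R]_n => enorm (y - x)).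
Proof.
move=> y; apply: (@continuous_comp _ _ _ (fun y : 'rV[R]_n => y - x)).
  by apply: continuousB; [exact: cvg_id|exact: cst_continuous].
exact: enorm_continuous.
Qed.

Lemma eball_open x r : open (eball x r).
Proof.
by move/continuousP: (@enorm_sub_continuous x) => /(_ [set z | z < r]); apply;
  exact: open_lt.
Qed.

Lemma measurable_eball x r : measurable (eball x r).
Proof. by apply: open_measurable_rV; exact: eball_open. Qed.
End borel_rV.

Section lebesgue_rV_theory.
Context {R : realType}.

Lemma consp_rV_ord0 n (p : measurableTypeR R * 'rV[R]_n) :
  consp_rV p ord0 ord0 = p.1.
Proof. by rewrite -[in RHS](consp_rVK p). Qed.

Lemma consp_rV_lift n (p : measurableTypeR R * 'rV[R]_n) i :
  consp_rV p ord0 (lift ord0 i) = p.2 ord0 i.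
Proof. by rewrite -[in RHS](consp_rVK p) /uncons_rV /= mxE. Qed.

Lemma preimage_consp_rbox n (A : 'I_n.+1 -> set R) :
  @consp_rV R n @^-1` rbox A = A ord0 `*` rbox (fun i => A (lift ord0 i)).
Proof.
apply/seteqP; split => -[t x] /=.
  move=> Ax; split; first by have := Ax ord0; rewrite /= consp_rV_ord0.
  by move=> i; have := Ax (lift ord0 i); rewrite consp_rV_lift.
move=> [At Ax] i; have [j ->|->] := unliftP ord0 i.
  by rewrite consp_rV_lift; exact: Ax.
by rewrite consp_rV_ord0.
Qed.

Lemma lebesgue_rV_rbox n (A : 'I_n -> set R) : (forall i, measurable (A i)) ->
  lebesgue_rV R n (rbox A) = (\prod_i lebesgue_measure (A i))%E.
Proof.
elim: n A => [|n IH] A mA.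
  by rewrite big_ord0 /= diracE mem_set// => -[].
rewrite big_ord_recl -IH// /= /lebesgue_rV_step /pushforward preimage_consp_rbox.
rewrite product_measure1E//; first exact: mA.
by apply: measurable_rbox => i; exact: mA.
Qed.

Lemma lebesgue_measure_translation (v : R) (A : set (measurableTypeR R)) :
  measurable A ->
  lebesgue_measure ((fun x => x + v) @^-1` A) = lebesgue_measure A.
Proof.
move=> mA; have mv : measurable_fun setT
    ((fun x => x + v) : measurableTypeR R -> measurableTypeR R).
  by apply: measurable_funD => //; exact: measurable_id.
pose m := measure_function_pushforward__canonical__measure_function_Measure
  (@lebesgue_measure R) mv.
apply/esym; apply: (@lebesgue_measure_unique R m) => // _ [[a b]] _ <-.
rewrite /m /= /pushforward.
have -> : (fun x => x + v) @^-1` [set` Interval (BRight a) (BRight b)] =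
  [set` Interval (BRight (a - v)) (BRight (b - v))].
  by apply/seteqP; split => x /=; rewrite !in_itv/= ltrBlDr lerBrDr.
rewrite !lebesgue_measure_itv/= !lte_fin ltrD2r.
by case: ifP => // _; rewrite -!EFinB; congr EFin; ring.
Qed.

(** Induction on the dimension: through [consp_rV] the translation becomes a product of a
    translation of the line and one of the lower-dimensional space. The pushforward of the product
    measure under it has the right value on rectangles, and a product measure is determined by
    these. *)
Lemma lebesgue_rV_translation n (v : 'rV[R]_n) (A : set 'rV[R]_n) :
  measurable A -> lebesgue_rV R n ((fun x => x + v) @^-1` A) = lebesgue_rV R n A.
Proof.
elim: n v A => [|n IH] v A mA.
  congr (lebesgue_rV R 0 _); apply/seteqP; split => x /=;
    by rewrite (_ : x + v = x)//; apply/rowP => -[].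
rewrite /= /lebesgue_rV_step /pushforward.
set v0 := v ord0 ord0; set v' : 'rV[R]_n := \row_i v ord0 (lift ord0 i).
pose tr (p : measurableTypeR R * 'rV[R]_n) : measurableTypeR R * 'rV[R]_n :=
  (p.1 + v0, p.2 + v').
have mtr : measurable_fun setT tr.
  apply: measurable_fun_pair => /=.
    by apply: measurable_funD; [exact: measurable_fst|exact: measurable_cst].
  apply: measurable_fun_rV => i.
  rewrite (_ : _ \o _ = fun p => coord_rV i p.2 + v' ord0 i); last first.
    by apply/funext => p; rewrite /coord_rV /= mxE.
  apply: measurable_funD; last exact: measurable_cst.
  by apply: measurableT_comp; [exact: measurable_coord_rV|exact: measurable_snd].
have mX : measurable (@consp_rV R n @^-1` A).
  by rewrite -[X in measurable X]setTI; exact: measurable_consp_rV.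
pose m := measure_function_pushforward__canonical__measure_function_Measure
  ((@lebesgue_measure R) \x (lebesgue_rV R n))%E mtr.
have -> : @consp_rV R n @^-1` ((fun x => x + v) @^-1` A) =
    tr @^-1` (@consp_rV R n @^-1` A).
  have cE p : consp_rV (tr p) = consp_rV p + v.
    apply/rowP => i; rewrite [RHS]mxE; have [j ->|->] := unliftP ord0 i.
       by rewrite !consp_rV_lift !mxE.
    by rewrite !consp_rV_ord0.
  by apply/seteqP; split => p /=; rewrite cE.
apply/esym; apply: (product_measure_unique (m' := m)) => // B C mB mC.
rewrite /m /= /pushforward.
rewrite (_ : _ @^-1` _ = ((fun x => x + v0) @^-1` B) `*` ((fun x => x + v') @^-1` C))//.
rewrite product_measure1E.
- by congr (_ * _)%E; [exact: lebesgue_measure_translation|exact: IH].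
- rewrite -[X in measurable X]setTI.
  by apply: (measurable_funD (@measurable_id _ _ _)).
- rewrite -[X in measurable X]setTI.
  apply: (@measurable_fun_rV _ _ _ _ (fun x : 'rV[R]_n => x + v')) => // i.
  rewrite (_ : _ \o _ = fun x => coord_rV i x + v' ord0 i); last first.
    by apply/funext => p; rewrite /coord_rV /= mxE.
  by apply: measurable_funD; [exact: measurable_coord_rV|exact: measurable_cst].
Qed.

End lebesgue_rV_theory.

Section integral_translation.
Context {R : realType} {n : nat}.
Local Notation mu := (lebesgue_rV R n).
Local Open Scope ereal_scope.

Lemma measurable_translation (v : 'rV[R]_n) :
  measurable_fun setT (fun x : 'rV[R]_n => (x + v)%R).
Proof.
apply: measurable_fun_rV => i.
rewrite (_ : _ \o _ = fun x => (coord_rV i x + v ord0 i)%R); last first.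
  by apply/funext => p; rewrite /coord_rV /= mxE.
by apply: measurable_funD; [exact: measurable_coord_rV|exact: measurable_cst].
Qed.

Lemma ge0_integral_translation (v : 'rV[R]_n) (f : 'rV[R]_n -> \bar R) :
  measurable_fun setT f -> (forall x, 0 <= f x) ->
  \int[mu]_x f (x + v)%R = \int[mu]_x f x.
Proof.
move=> mf f0; have mv := measurable_translation v.
transitivity (\int[pushforward mu (fun x => (x + v)%R)]_x f x).
  rewrite (@ge0_integral_pushforward _ _ _ _ R _ mv mu setT f)//.
pose m := measure_function_pushforward__canonical__measure_function_Measure
  mu mv.
rewrite -[LHS]/(\int[m]_x f x).
by apply: eq_measure_integral => A mA _; exact: lebesgue_rV_translation.
Qed.

Lemma integral_translation (v : 'rV[R]_n) (f : 'rV[R]_n -> \bar R) :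
  measurable_fun setT f -> \int[mu]_x f (x + v)%R = \int[mu]_x f x.
Proof.
move=> mf; rewrite integralE [RHS]integralE; congr (_ - _).
  have mp : measurable_fun setT f^\+ by exact: measurable_funepos.
  rewrite -[RHS](ge0_integral_translation v mp (funepos_ge0 _)).
  by apply: eq_integral => x _; rewrite !funeposE.
have mp : measurable_fun setT f^\- by exact: measurable_funeneg.
rewrite -[RHS](ge0_integral_translation v mp (funeneg_ge0 _)).
by apply: eq_integral => x _; rewrite !funenegE.
Qed.

Lemma integral_supp (G : set 'rV[R]_n) (f : 'rV[R]_n -> \bar R) :
  (forall x, ~ G x -> f x = 0) -> \int[mu]_(x in G) f x = \int[mu]_x f x.
Proof.
move=> Gf; rewrite integral_mkcond; congr (integral _ _ _).
apply/funext => x; rewrite patchE; case: ifPn => // /negP xG.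
by rewrite Gf//; move: xG; rewrite in_setE.
Qed.

End integral_translation.

Section cube.
Context {R : realType} {n : nat}.
Local Notation mu := (lebesgue_rV R n).
Implicit Types (f : 'rV[R]_n -> R) (M : R).

(** Bounded sets and supports are controlled by these boxes throughout: the product structure gives
    both their compactness and their measure. *)
Definition cube M : set 'rV[R]_n := rbox (fun=> `[- M, M]%classic).

Lemma cubeP M x : cube M x <-> forall i, `|x ord0 i| <= M.
Proof.
split=> xM i; first by have := xM i; rewrite /= in_itv/= ler_norml.
by rewrite /= in_itv/= -ler_norml; exact: xM.
Qed.

Lemma measurable_cube M : measurable (cube M).
Proof. by apply: measurable_rbox => i; exact: measurable_itv. Qed.

Lemma compact_cube M : compact (cube M).
Proof. by apply: rV_compact => i; exact: segment_compact. Qed.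

Lemma lebesgue_cube M : 0 <= M -> mu (cube M) = ((2 * M) ^+ n)%:E.
Proof.
move=> M0; rewrite lebesgue_rV_rbox; last by move=> i; exact: measurable_itv.
rewrite (eq_bigr (fun=> (2 * M)%:E)) ?prodEFin ?big_const_ord ?iter_mulr_1//.
move=> i _; rewrite lebesgue_measure_itv/= lte_fin.
case: ifPn => [_|]; first by rewrite -EFinB opprK mulr_natl mulr2n.
rewrite -leNgt => M1; have -> : M = 0 by lra.
by rewrite mulr0.
Qed.

Lemma lebesgue_cube_lty M : (mu (cube M) < +oo)%E.
Proof.
apply: (@le_lt_trans _ _ (mu (cube `|M|))); last by rewrite lebesgue_cube// ltry.
apply: le_measure; rewrite ?inE; [exact: measurable_cube..|].
by move=> x /cubeP xM; apply/cubeP => i; apply: le_trans (xM i) (ler_norm _).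
Qed.

Lemma compact_sub_cube (K : set 'rV[R]_n) : compact K -> exists M, K `<=` cube M.
Proof.
move=> /compact_bounded[M [_ HM]]; exists (M + 1) => x Kx; apply/cubeP => i.
apply: le_trans (HM (M + 1) _ _ Kx); last by rewrite ltrDl.
rewrite [leRHS]/Num.norm/= mx_normrE; apply/bigmax_geP; right.
by exists (ord0, i).
Qed.

Definition supp_cube M f := forall x, ~ cube M x -> f x = 0.

Lemma continuous_cube_bounded f M : continuous f ->
  exists2 C, 0 <= C & forall x, cube M x -> `|f x| <= C.
Proof.
move=> cf.
have /compact_bounded[C [_ HC]] : compact (f @` cube M).
  by apply: continuous_compact; [exact: continuous_subspaceT|exact: compact_cube].
exists (`|C| + 1) => [|x Mx]; first by rewrite addr_ge0.
by apply: (HC (`|C| + 1)); [rewrite (le_lt_trans (ler_norm _))// ltrDl|exists x].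
Qed.

Lemma integrable_continuous_cube f M G : measurable G -> G `<=` cube M ->
  continuous f -> mu.-integrable G (EFin \o f).
Proof.
move=> mG GM cf; have [C C0 fC] := continuous_cube_bounded M cf.
apply: measurable_bounded_integrable => //.
- by apply: le_lt_trans (lebesgue_cube_lty M); apply: le_measure => //;
    rewrite inE//; exact: measurable_cube.
- by apply: measurable_funTS; exact: continuous_measurable_rV.
- exists C; split; first exact: num_real.
  by move=> D CD x Gx; apply: le_trans (ltW CD); exact/fC/GM.
Qed.

Lemma integrable_supp_cube f M : continuous f -> supp_cube M f ->
  mu.-integrable setT (EFin \o f).
Proof.
move=> cf sf.
have -> : (EFin \o f) = (EFin \o f) \_ (cube M).
  apply/funext => x; rewrite patchE; case: ifPn => //= /negP xM.
  by rewrite sf//; move: xM; rewrite in_setE.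
apply/(integrable_mkcond _ (measurable_cube M)).
exact: (integrable_continuous_cube (measurable_cube M) (fun x h => h) cf).
Qed.

End cube.

Section continuous_arith.
Context {R : realType} {T : topologicalType}.
Implicit Types f g : T -> R.

Lemma continuous_addr f g :
  continuous f -> continuous g -> continuous (fun x => f x + g x).
Proof. by move=> cf cg x; apply: continuousD; [exact: cf|exact: cg]. Qed.

Lemma continuous_mulr f g :
  continuous f -> continuous g -> continuous (fun x => f x * g x).
Proof. by move=> cf cg x; apply: continuousM; [exact: cf|exact: cg]. Qed.

Lemma continuous_comp_real (s : R -> R) f :
  continuous s -> continuous f -> continuous (fun x => s (f x)).
Proof.
by move=> cs cf x; apply: (@continuous_comp _ _ _ f s); [exact: cf|exact: cs].
Qed.

End continuous_arith.

(** * Functions with continuous partial derivatives *)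

Section continuously_differentiable.
Context {R : realType} {n : nat}.
Local Notation V := 'rV[R]_n.
Local Notation e i := (delta_mx ord0 i : 'rV[R]_n).
Implicit Types (u v : V -> R) (x : V) (i : 'I_n).

Definition continuously_differentiable u :=
  [/\ continuous u, forall x i, derivable u x (e i) &
      forall i, continuous (partial i u)].

Lemma smooth_continuously_differentiable u :
  smooth u -> continuously_differentiable u.
Proof.
by move=> su; split; [exact: (su [::]).1|exact: (su [::]).2|
  move=> i; exact: (su [:: i]).1].
Qed.

(** The bridge by which the chain rule and the mean value theorem of one variable reach partial
    derivatives; total differentiability is never invoked in ['rV[R]_n]. *)
Lemma is_derive_line u (d : V) x (t df : R) :
  is_derive t 1 (fun s : R => u (s *: d + x)) df <-> is_derive (t *: d + x) d u df.
Proof.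
have E : (fun h : R => h^-1 *: (((fun s : R => u (s *: d + x)) \o shift t) (h *: 1) -
      u (t *: d + x))) =
    (fun h => h^-1 *: ((u \o shift (t *: d + x)) (h *: d) - u (t *: d + x))).
  apply/funext => h /=; congr (_ *: (u _ - _)).
  by rewrite addrA -scalerDl [_%:A]mulr1.
by split => -[h1 h2]; apply: DeriveDef; move: h1 h2;
  rewrite /derivable /derive ?E// -?E.
Qed.

Lemma is_derive_line0 u (d : V) x (df : R) :
  is_derive (0 : R) 1 (fun s : R => u (s *: d + x)) df <-> is_derive x d u df.
Proof. by rewrite is_derive_line scale0r add0r. Qed.

Lemma is_partial u x i : derivable u x (e i) ->
  is_derive x (e i) u (partial i u x).
Proof. exact: derivableP. Qed.

Lemma partialD u v x i : derivable u x (e i) -> derivable v x (e i) ->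
  partial i (fun y => u y + v y) x = partial i u x + partial i v x.
Proof. exact: deriveD. Qed.

Lemma partialM u v x i : derivable u x (e i) -> derivable v x (e i) ->
  partial i (fun y => u y * v y) x = u x * partial i v x + v x * partial i u x.
Proof. exact: deriveM. Qed.

Lemma is_derive_comp_real (s : R -> R) u x (d : V) (ds du : R) :
  is_derive (u x) 1 s ds -> is_derive x d u du ->
  is_derive x d (fun y => s (u y)) (ds * du).
Proof.
move=> hs /is_derive_line0 hu; apply/is_derive_line0.
apply: (@is_derive1_comp _ s (fun t : R => u (t *: d + x))).
by rewrite scale0r add0r.
Qed.

Lemma partial_comp (s : R -> R) u x i : derivable s (u x) 1 ->
  derivable u x (e i) ->
  partial i (fun y => s (u y)) x = derive1 s (u x) * partial i u x.
Proof.
move=> /derivableP hs /is_partial hu.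
by rewrite derive1E; have [_] := is_derive_comp_real hs hu.
Qed.

Lemma near_eq_partial u v x i :
  (\near x, u x = v x) -> partial i u x = partial i v x.
Proof. exact: near_eq_derive. Qed.

Lemma continuously_differentiable_cst (c : R) :
  continuously_differentiable (cst c).
Proof.
split=> [|x i|i]; first exact: cst_continuous.
  exact: derivable_cst.
rewrite (_ : partial i (cst c) = cst 0); first exact: cst_continuous.
by apply/funext => x; rewrite /partial derive_cst.
Qed.

Lemma continuously_differentiableD u v : continuously_differentiable u ->
  continuously_differentiable v ->
  continuously_differentiable (fun x => u x + v x).
Proof.
move=> [cu du pu] [cv dv pv]; split=> [x|x i|i].
- by move: x; exact: continuous_addr.
- exact: derivableD.
rewrite (_ : partial i _ = fun x => partial i u x + partial i v x).
  by apply: continuous_addr; [exact: pu|exact: pv].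
by apply/funext => x; rewrite partialD.
Qed.

Lemma continuously_differentiableM u v : continuously_differentiable u ->
  continuously_differentiable v ->
  continuously_differentiable (fun x => u x * v x).
Proof.
move=> [cu du pu] [cv dv pv]; split=> [x|x i|i].
- by move: x; exact: continuous_mulr.
- exact: derivableM.
rewrite (_ : partial i _ =
    fun x => u x * partial i v x + v x * partial i u x).
  by apply: continuous_addr; apply: continuous_mulr.
by apply/funext => x; rewrite partialM.
Qed.

Lemma continuously_differentiable_comp (s : R -> R) u : smooth_real s ->
  continuously_differentiable u ->
  continuously_differentiable (fun x => s (u x)).
Proof.
move=> ss [cu du pu]; have cs := smooth_real_continuous ss.
split=> [x|x i|i].
- by move: x; exact: continuous_comp_real.
- have /derivableP hs := @smooth_real_derivable _ _ (u x) ss.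
  by have [] := is_derive_comp_real hs (is_partial (du x i)).
rewrite (_ : partial i _ = fun x => derive1 s (u x) * partial i u x).
  apply: continuous_mulr; last exact: pu.
  apply: continuous_comp_real => //.
  exact/smooth_real_continuous/smooth_real_derive1.
by apply/funext => x; rewrite partial_comp//; exact: smooth_real_derivable.
Qed.

Lemma is_derive_coord x i j : is_derive x (e i) (@coord_rV R n j) (i == j)%:R.
Proof.
apply/is_derive_line0; rewrite /coord_rV.
rewrite (_ : (fun s => _) = fun s : R => s * (i == j)%:R + x ord0 j).
  have H : is_derive (0 : R) 1 (fun s : R => s * cst (i == j)%:R s + x ord0 j)
      ((0 *: 0 + (i == j)%:R *: 1) + 0).
    by apply: is_deriveD; exact: is_deriveM.
  by apply: (is_derive_eq H); rewrite scale0r add0r addr0 [_%:A]mulr1.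
by apply/funext => s; rewrite !mxE eqxx /= eq_sym.
Qed.

Lemma partial_coord x i j : partial i (@coord_rV R n j) x = (i == j)%:R.
Proof. by have [_] := is_derive_coord x i j. Qed.

Lemma continuously_differentiable_coord j :
  continuously_differentiable (@coord_rV R n j).
Proof.
split=> [|x i|i]; first exact: coord_rV_continuous.
  by have [] := is_derive_coord x i j.
rewrite (_ : partial i _ = cst (i == j)%:R); first exact: cst_continuous.
by apply/funext => x; rewrite partial_coord.
Qed.

Lemma continuously_differentiable_sum (I : Type) (r : seq I) (P : pred I)
    (F : I -> V -> R) :
  (forall k, P k -> continuously_differentiable (F k)) ->
  continuously_differentiable (fun x => \sum_(k <- r | P k) F k x).
Proof.
move=> cF; elim: r => [|a r IH].
  under eq_fun do rewrite big_nil.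
  exact: continuously_differentiable_cst.
under eq_fun do rewrite big_cons.
case: (boolP (P a)) => Pa; last exact: IH.
exact: continuously_differentiableD (cF _ Pa) IH.
Qed.

Lemma partial_sum (I : Type) (r : seq I) (P : pred I) (F : I -> V -> R) x i :
  (forall k, P k -> continuously_differentiable (F k)) ->
  partial i (fun x => \sum_(k <- r | P k) F k x) x =
  \sum_(k <- r | P k) partial i (F k) x.
Proof.
move=> cF; elim: r => [|a r IH].
  by under [in LHS]eq_fun do rewrite big_nil; rewrite big_nil /partial derive_cst.
rewrite big_cons; under [in LHS]eq_fun do rewrite big_cons.
case: (boolP (P a)) => // Pa; rewrite partialD ?IH//; first by have [] := cF _ Pa.
by have [] := continuously_differentiable_sum r cF.
Qed.

Lemma partial_supp u (U : set V) x i : open U -> U x ->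
  (forall y, U y -> u y = 0) -> partial i u x = 0.
Proof.
move=> oU Ux u0; rewrite (@near_eq_partial _ (cst 0)).
  by rewrite /partial derive_cst.
near=> y; apply: u0; near: y; exact: open_nbhs_nbhs.
Unshelve. all: by end_near. Qed.

Lemma closed_cube M : closed (@cube R n M).
Proof. by apply: compact_closed (@compact_cube R n M); exact: norm_hausdorff.
Qed.

Lemma supp_cube_partial u M i : supp_cube M u -> supp_cube M (partial i u).
Proof.
move=> uM x xM; apply: (@partial_supp u (~` cube M)) => //.
exact/closed_openC/closed_cube.
Qed.

End continuously_differentiable.

(** * Integration by parts *)

Section integration_by_parts.
Context {R : realType} {n : nat}.
Local Notation mu := (lebesgue_rV R n).
Local Notation V := 'rV[R]_n.
Local Notation e i := (delta_mx ord0 i : 'rV[R]_n).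
Implicit Types (u v F phi : V -> R) (x : V) (i : 'I_n) (G : set V).

Lemma integrable_indic_lty (A : set V) : measurable A -> (mu A < +oo)%E ->
  mu.-integrable setT (fun x => (\1_A x)%:E).
Proof.
move=> mA Aoo; apply/integrableP; split; first exact/measurable_EFinP.
under eq_integral do rewrite gee0_abs ?lee_fin//.
by rewrite integral_indic// setIT.
Qed.

(** Mean value theorem on a segment. The bound is uniform in [h] and supplies the dominating
    function of the next proof. *)
Lemma growth_rate_le F x i (C h : R) : 0 < h ->
  (forall y, derivable F y (e i)) -> (forall y, `|partial i F y| <= C) ->
  `|h^-1 * (F (h *: e i + x) - F x)| <= C.
Proof.
move=> h0 dF FC; pose g (s : R) := F (s *: e i + x).
have dg (s : R) : is_derive s 1 g (partial i F (s *: e i + x)).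
  by apply/is_derive_line; exact: is_partial.
have [|c _] := @MVT R g (fun s => partial i F (s *: e i + x)) 0 h h0
    (fun s _ => dg s).
  apply: continuous_subspaceT => s; apply: differentiable_continuous.
  by apply/derivable1_diffP; have [] := dg s.
rewrite /g scale0r add0r => ->; rewrite subr0 mulrCA mulVf ?gt_eqF// mulr1.
exact: FC.
Qed.

Lemma cube_le M N : M <= N -> @cube R n M `<=` cube N.
Proof.
by move=> MN x /cubeP xM; apply/cubeP => j; exact: le_trans (xM j) MN.
Qed.

Lemma cube_shift M h i x : `|h| <= 1 -> cube M (h *: e i + x) -> cube (M + 1) x.
Proof.
move=> h1 /cubeP xM; apply/cubeP => j.
have := xM j; rewrite !mxE eqxx /= => H.
have H1 : `|h * (j == i)%:R| <= 1.
  by case: (j == i); rewrite ?mulr0 ?normr0// mulr1.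
have -> : x ord0 j = (h * (j == i)%:R + x ord0 j) - h * (j == i)%:R by ring.
by rewrite (le_trans (ler_normB _ _))// lerD.
Qed.

(** By translation invariance every difference quotient of [F] has integral 0; dominated convergence
    passes this to the derivative. Fubini's theorem and the fundamental theorem of calculus are
    bypassed. *)
Lemma integral_partial_eq0 F M i : continuously_differentiable F ->
  supp_cube M F -> (\int[mu]_x (partial i F x)%:E = 0)%E.
Proof.
move=> [cF dF pF] FM.
have pM : supp_cube (M + 1) (partial i F).
  move=> x xM; apply: (supp_cube_partial (M := M)) => // /(cube_le _) xM'.
  by apply: xM; apply: xM'; rewrite lerDl.
have [C C0 FC] : exists2 C, 0 <= C & forall x, `|partial i F x| <= C.
  have [C C0 HC] := continuous_cube_bounded (M + 1) (pF i).
  exists C => // x; have [/HC//|/pM ->] := pselect (cube (M + 1) x).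
  by rewrite normr0.
(* Increments at most 1 keep the supports of all translates in the cube of size M + 1, on which the
   constant [C] is integrable. *)
pose h (k : nat) : R := k.+1%:R^-1.
have h0 k : 0 < h k by rewrite invr_gt0.
have h1 k : h k <= 1 by rewrite invf_le1// ler1n.
have nh1 k : `|h k| <= 1 by rewrite ger0_norm// ltW.
pose q k x := (h k)^-1 * (F (h k *: e i + x) - F x).
have cq k : continuous (q k).
  apply: continuous_mulr; first exact: cst_continuous.
  apply: continuous_addr; last by move=> x; apply: continuousN; exact: cF.
  move=> x; apply: (@continuous_comp _ _ _ (fun x => h k *: e i + x) F).
    by apply: continuousD; [exact: cst_continuous|exact: cvg_id].
  exact: cF.
have iq k : (\int[mu]_x (q k x)%:E = 0)%E.
  have iF : mu.-integrable setT (EFin \o F) by exact: integrable_supp_cube FM.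
  have mF : measurable_fun setT (EFin \o F).
    by apply/measurable_EFinP; exact: continuous_measurable_rV.
  have HT := integral_translation (h k *: e i) mF.
  have iT : mu.-integrable setT (fun x => (F (h k *: e i + x))%:E).
    apply: (integrable_supp_cube (M := M + 1) (f := fun x => F (h k *: e i + x))).
      move=> x; apply: (@continuous_comp _ _ _ (fun x => h k *: e i + x) F).
        by apply: continuousD; [exact: cst_continuous|exact: cvg_id].
      exact: cF.
    by move=> x xM; apply: FM => /(cube_shift (nh1 k)).
  under eq_integral do rewrite EFinM EFinB.
  rewrite integralZl//=; last exact: (integrableB measurableT iT iF).
  rewrite (integralB measurableT iT iF).
  under eq_integral do rewrite addrC.
  rewrite HT subee ?mule0//; exact: integrable_fin_num.
have mq k : measurable_fun setT (EFin \o q k).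
  by apply/measurable_EFinP; exact: continuous_measurable_rV.
pose G (x : V) : \bar R := (C%:E * (\1_(cube (M + 1)) x)%:E)%E.
have iG : mu.-integrable setT G.
  apply: integrableZl => //; apply: integrable_indic_lty.
    exact: measurable_cube.
  exact: lebesgue_cube_lty.
have mpF : measurable_fun setT (EFin \o partial i F).
  by apply/measurable_EFinP; exact: continuous_measurable_rV.
have cvq x : (q k x)%:E @[k --> \oo] --> (partial i F x)%:E.
  apply/fine_cvgP; split; first exact: nearW.
  have /cvgr_dnbhsP := dF x i; apply; split => [k|]; first by rewrite gt_eqF.
  exact: cvg_harmonic.
have qG x k : (`|(q k x)%:E| <= G x)%E.
  rewrite /G abse_EFin -EFinM lee_fin indicE.
  have [xM|xM] := pselect (cube (M + 1) x).
    rewrite mem_set// mulr1; exact: growth_rate_le.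
  rewrite /q memNset// mulr0 normr_le0 (FM x) ?(FM (_ + _)) ?subrr ?mulr0//.
    by move/(cube_shift (nh1 k)).
  by move/(cube_le _) => H; apply: xM; apply: H; rewrite lerDl.
have [_ _] := @dominated_convergence _ _ _ mu setT measurableT
  (fun k x => (q k x)%:E) _ _ mq mpF (aeW _ (fun x _ => cvq x)) iG
  (aeW _ (fun x k _ => qG x k)).
rewrite [X in X @ _ --> _](_ : _ = cst 0%E); last exact/funext/iq.
by move=> H; apply/esym; apply: (cvg_unique _ _ H) => //; exact: cvg_cst.
Qed.

Lemma test_function_continuously_differentiable G phi :
  test_function G phi -> continuously_differentiable phi.
Proof. by case=> + _ _; exact: smooth_continuously_differentiable. Qed.

Lemma test_function_out G phi x : test_function G phi -> ~ G x -> phi x = 0.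
Proof.
move=> [_ _ sG] xG; apply: contrapT => /eqP px; apply: xG; apply: sG.
exact: subset_closure.
Qed.

Lemma test_function_partial_out G phi i x :
  test_function G phi -> ~ G x -> partial i phi x = 0.
Proof.
move=> [_ _ sG] xG.
apply: (@partial_supp _ _ _ (~` closure [set y | phi y != 0])).
- exact/closed_openC/closed_closure.
- by move=> /sG.
- by move=> y yG; apply: contrapT => /eqP py; apply: yG; exact: subset_closure.
Qed.

Lemma test_function_supp_cube G phi : test_function G phi ->
  exists M, supp_cube M phi.
Proof.
move=> [_ cG _]; have [M HM] := compact_sub_cube cG.
exists M => x xM; apply: contrapT => /eqP px; apply: xM; apply: HM.
exact: subset_closure.
Qed.

(** [integral_partial_eq0] for the product [v * phi]. A test function and its partial derivatives
    vanish off [G], so that integrals over [G] become integrals over the whole space. *)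
Lemma weak_partial_continuously_differentiable G i v :
  continuously_differentiable v -> weak_partial G i v (partial i v).
Proof.
move=> cv phi tphi; have cphi := test_function_continuously_differentiable tphi.
have [M sM] := test_function_supp_cube tphi.
rewrite [LHS]integral_supp => [|x xG]; last first.
  by rewrite (test_function_partial_out i tphi xG) mulr0.
rewrite [X in (- X)%E]integral_supp => [|x xG]; last first.
  by rewrite (test_function_out tphi xG) mulr0.
have [c1 d1 p1] := cv; have [c2 d2 p2] := cphi.
have i1 : mu.-integrable setT (EFin \o (fun x => v x * partial i phi x)).
  apply: (integrable_supp_cube (M := M)); first exact: continuous_mulr.
  by move=> x xM; rewrite (supp_cube_partial i sM xM) mulr0.
have i2 : mu.-integrable setT (EFin \o (fun x => partial i v x * phi x)).
  apply: (integrable_supp_cube (M := M)); first exact: continuous_mulr.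
  by move=> x xM; rewrite (sM _ xM) mulr0.
have : (\int[mu]_x ((v x * partial i phi x)%:E + (partial i v x * phi x)%:E) = 0)%E.
  rewrite -[RHS](@integral_partial_eq0 (fun x => v x * phi x) M i).
  - by apply: eq_integral => x _; rewrite partialM// -EFinD [phi x * _]mulrC.
  - exact: continuously_differentiableM.
  - by move=> x xM; rewrite (sM _ xM) mulr0.
rewrite (integralD measurableT i1 i2).
have := integrable_fin_num measurableT i1.
have := integrable_fin_num measurableT i2.
rewrite /comp; move: (integral _ _ _) => I1; move: (integral _ _ _) => I2.
move=> f1 f2; rewrite -(fineK f1) -(fineK f2) -EFinD -EFinN => -[H].
by congr EFin; lra.
Qed.

End integration_by_parts.

(** * Competitors and bounds for the capacity *)

Section real_power.
Context {R : realType}.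
Implicit Types (q x l : R).

(** If x > l then x = x^(1-q) x^q <= l^(1-q) x^q. Being linear in x^q, the inequality can be
    integrated, and choosing [l] afterwards plays the part of Hölder's inequality. *)
Lemma ler_add_powR q x l : 1 <= q -> 0 <= x -> 0 < l ->
  x <= l + l `^ (1 - q) * x `^ q.
Proof.
move=> q1 x0 l0; have [xl|lx] := leP x l.
  by rewrite (le_trans xl)// lerDl mulr_ge0// powR_ge0.
have x1 : 0 < x := lt_trans l0 lx.
apply: ler_wpDl; first exact: ltW.
rewrite -opprB powRN -(mulr_powRB1 x0) ?(lt_le_trans _ q1)// mulrCA.
rewrite ler_peMr// mulrC ler_pdivlMr ?powR_gt0// mul1r.
by rewrite ge0_ler_powR ?nnegrE ?subr_ge0// ltW.
Qed.

(** Each [a i] is at most the q-th root of the sum of the q-th powers; summing loses a factor [#|I|]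
    where convexity would lose less. *)
Lemma powR_sum_le q (I : finType) (a : I -> R) : 0 < q ->
  (forall i, 0 <= a i) ->
  (\sum_i a i) `^ q <= #|I|%:R `^ q * \sum_i a i `^ q.
Proof.
move=> q0 a0; have s0 : 0 <= \sum_i a i `^ q.
  by apply: sumr_ge0 => i _; exact: powR_ge0.
set s := \sum_i a i `^ q in s0 *.
have sqK : (s `^ q^-1) `^ q = s by rewrite -powRrM mulVf ?powRr1// gt_eqF.
rewrite -[X in _ * X]sqK -powRM ?powR_ge0//.
rewrite ge0_ler_powR ?nnegrE ?(ltW q0) ?sumr_ge0 ?mulr_ge0 ?powR_ge0//.
rewrite mulr_natl -sumr_const; apply: ler_sum => i _.
have -> : a i = (a i `^ q) `^ q^-1 by rewrite -powRrM divff ?powRr1// gt_eqF.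
rewrite ge0_ler_powR ?nnegrE ?invr_ge0 ?powR_ge0 ?(ltW q0)//.
by rewrite /s (bigD1 i)//= lerDl sumr_ge0// => j _; exact: powR_ge0.
Qed.

Lemma powR_add_le q (x y : R) : 0 < q -> 0 <= x -> 0 <= y ->
  (x + y) `^ q <= 2 `^ q * (x `^ q + y `^ q).
Proof.
move=> q0 x0 y0.
have a0 (b : bool) : 0 <= (if b then x else y) by case: b.
by have := powR_sum_le q0 a0; rewrite !big_bool card_bool.
Qed.

End real_power.

Section enorm.
Context {R : realType} {n : nat}.
Implicit Types x y : 'rV[R]_n.

Lemma enorm_ge0 x : 0 <= enorm x.
Proof. exact: sqrtr_ge0. Qed.

Lemma sqr_enorm x : enorm x ^+ 2 = \sum_(i < n) x ord0 i ^+ 2.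
Proof. by rewrite sqr_sqrtr// sumr_ge0// => i _; exact: sqr_ge0. Qed.

Lemma coord_le_enorm x i : `|x ord0 i| <= enorm x.
Proof.
rewrite -ler_sqr ?nnegrE ?enorm_ge0// real_normK ?num_real// sqr_enorm.
by rewrite (bigD1 i)//= lerDl sumr_ge0// => j _; exact: sqr_ge0.
Qed.

Lemma enorm_le_sum x : enorm x <= \sum_i `|x ord0 i|.
Proof.
rewrite -ler_sqr ?nnegrE ?enorm_ge0 ?sumr_ge0// sqr_enorm.
rewrite expr2 mulr_suml; apply: ler_sum => i _.
rewrite -real_normK ?num_real// expr2 ler_wpM2l//.
by rewrite (bigD1 i)//= lerDl sumr_ge0.
Qed.

Lemma measurable_enorm d (X : measurableType d) (D : set X) (g : X -> 'rV[R]_n) :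
  (forall i, measurable_fun D (fun z => g z ord0 i)) ->
  measurable_fun D (fun z => enorm (g z)).
Proof.
move=> mg; rewrite /enorm.
apply: (@measurableT_comp _ _ _ _ _ _ (@Num.sqrt R)).
  apply: continuous_measurable_fun; exact: sqrt_continuous.
apply: measurable_sum => i; exact: measurable_funX.
Qed.

End enorm.


Section capacity_upper_bound.
Context {R : realType} {n : nat}.
Local Notation mu := (lebesgue_rV R n).
Implicit Types (E F G : set 'rV[R]_n) (x : 'rV[R]_n) (v : 'rV[R]_n -> R).

Definition gradient v x : 'rV[R]_n := \row_i partial i v x.

Lemma enorm_powR_le q x : 0 < q ->
  enorm x `^ q <= n%:R `^ q * \sum_i `|x ord0 i| `^ q.
Proof.
move=> q0; have := @powR_sum_le R q 'I_n (fun i => `|x ord0 i|) q0.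
rewrite card_ord => H; apply: le_trans (H _) => // {H}.
rewrite ge0_ler_powR ?nnegrE ?(ltW q0) ?enorm_ge0 ?sumr_ge0//.
exact: enorm_le_sum.
Qed.

Lemma in_Lq_continuous q G M f : 0 <= q -> measurable G -> G `<=` cube M ->
  continuous f -> in_Lq q G f.
Proof.
move=> q0 mG GM cf; split.
  by apply: measurable_funTS; exact: continuous_measurable_rV.
have [C C0 fC] := continuous_cube_bounded M cf.
apply: (@le_lt_trans _ _ (\int[mu]_(x in G) (C `^ q)%:E)%E).
  apply: ge0_le_integral => //.
  - apply/measurable_EFinP; apply: measurable_funTS.
    apply: (@measurableT_comp _ _ _ _ _ _ (@powR R ^~ q)) => //.
    by apply: measurableT_comp => //; exact: continuous_measurable_rV.
  - move=> x Gx; rewrite lee_fin ge0_ler_powR ?nnegrE//; exact/fC/GM.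
rewrite integral_cst// lte_mul_pinfty ?lee_fin ?powR_ge0//.
apply: le_lt_trans (lebesgue_cube_lty M).
by apply: le_measure => //; rewrite inE//; exact: measurable_cube.
Qed.

Lemma Cap_le q E F G M v : 0 < q -> open G -> G `<=` cube M ->
  continuously_differentiable v ->
  (forall x, E x -> 1 <= v x) -> (forall x, F x -> v x <= 0) ->
  (Cap q E F G <=
   (n%:R `^ q)%:E * \sum_i \int[mu]_(x in G) (`|partial i v x| `^ q)%:E)%E.
Proof.
move=> q0 oG GM cv Ev Fv; have [c1 d1 p1] := cv.
have mG := open_measurable_rV oG.
have mp i : measurable_fun G (fun x => `|partial i v x| `^ q).
  apply: measurable_funTS.
  apply: (@measurableT_comp _ _ _ _ _ _ (@powR R ^~ q)) => //.
  by apply: measurableT_comp => //; exact: continuous_measurable_rV.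
apply: (@le_trans _ _ (\int[mu]_(x in G) (enorm (gradient v x) `^ q)%:E)%E).
  have wg : weak_gradient q G v (gradient v).
    move=> i; rewrite (_ : (fun x => _) = partial i v).
      split; last exact: weak_partial_continuously_differentiable.
      exact: (in_Lq_continuous (M := M) (ltW q0)).
    by apply/funext => x; rewrite mxE.
  apply: ereal_inf_lbound; exists v, (gradient v); split => //.
  split => //; last by apply: continuous_subspaceT.
  split; last by exists (gradient v).
  exact: (in_Lq_continuous (M := M) (ltW q0)).
rewrite -ge0_integral_sum//; last first.
  by move=> i; apply/measurable_EFinP; exact: mp.
rewrite -ge0_integralZl//; last 2 first.
- by apply: emeasurable_sum => i; apply/measurable_EFinP; exact: mp.
- by move=> x _; apply: sume_ge0 => i _; rewrite lee_fin powR_ge0.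
apply: ge0_le_integral => //.
- by move=> x _; rewrite lee_fin powR_ge0.
- apply/measurable_EFinP.
  apply: (@measurableT_comp _ _ _ _ _ _ (@powR R ^~ q)) => //.
  apply: measurable_enorm => i; apply: measurable_funTS.
  rewrite (_ : (fun x => _) = partial i v).
    exact: continuous_measurable_rV.
  by apply/funext => x; rewrite mxE.
- apply: measurable_funeM.
  by apply: emeasurable_sum => i; apply/measurable_EFinP; exact: mp.
move=> x _; rewrite sumEFin -EFinM lee_fin.
apply: le_trans (enorm_powR_le _ q0) _.
by rewrite ler_wpM2l ?powR_ge0//; apply: ler_sum => i _; rewrite mxE.
Qed.

End capacity_upper_bound.

(** * Test functions of product form *)

Section product_function.
Context {R : realType} {n : nat}.
Local Notation e i := (delta_mx ord0 i : 'rV[R]_n).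
Implicit Types (psi : 'I_n -> R -> R) (i : 'I_n) (x : 'rV[R]_n).

Definition prod_fun psi x : R := \prod_j psi j (x ord0 j).

Definition derive_factor i psi : 'I_n -> R -> R :=
  fun j => if j == i then derive1 (psi j) else psi j.

Lemma smooth_derive_factor i psi : (forall j, smooth_real (psi j)) ->
  forall j, smooth_real (derive_factor i psi j).
Proof.
move=> sp j; rewrite /derive_factor; case: ifPn => // _.
exact: smooth_real_derive1.
Qed.

Lemma is_derive_prod_fun i psi x : (forall j, smooth_real (psi j)) ->
  is_derive x (e i) (prod_fun psi) (prod_fun (derive_factor i psi) x).
Proof.
move=> sp; apply/is_derive_line0.
rewrite (_ : (fun s : R => _) = (fun s =>
    psi i (s + x ord0 i) * (\prod_(j < n | j != i) psi j (x ord0 j)))); last first.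
  apply/funext => s; rewrite /prod_fun (bigD1 i)//= !mxE !eqxx mulr1.
  congr (_ * _); apply: eq_bigr => j /negbTE ji.
  by rewrite !mxE ji andbF mulr0 add0r.
set c := \prod_(j < n | j != i) psi j (x ord0 j).
have -> : prod_fun (derive_factor i psi) x = derive1 (psi i) (x ord0 i) * c.
  rewrite /prod_fun (bigD1 i)//= /derive_factor eqxx; congr (_ * _).
  by apply: eq_bigr => j /negbTE ->.
have d1 : is_derive (0 : R) 1 (fun s : R => psi i (s + x ord0 i))
    (derive1 (psi i) (x ord0 i)).
  rewrite -[X in is_derive _ _ _ X]mulr1.
  apply: (@is_derive1_comp _ (psi i) (fun s => s + x ord0 i)).
    rewrite add0r derive1E; apply: derivableP.
    exact: smooth_real_derivable.
  exact: is_derive_shift.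
have d2 : is_derive (0 : R) 1 (fun s : R => psi i (s + x ord0 i) * cst c s) _ :=
  is_deriveM d1 (is_derive_cst _ _ _).
apply: (is_derive_eq d2).
by rewrite scaler0 add0r mulrC.
Qed.

Lemma continuous_prod_fun psi : (forall j, continuous (psi j)) ->
  continuous (prod_fun psi).
Proof.
move=> cp; apply: (@continuous_big R 'I_n *%R 1 xpredT) => [|i _].
  by move=> -[a b]; apply: cvgM; [exact: cvg_fst|exact: cvg_snd].
by apply: continuous_comp_real (cp i) _; exact: coord_rV_continuous.
Qed.

Lemma partial_prod_fun i psi : (forall j, smooth_real (psi j)) ->
  partial i (prod_fun psi) = prod_fun (derive_factor i psi).
Proof.
by move=> sp; apply/funext => x; have [_] := is_derive_prod_fun i x sp.
Qed.

(** Products of one-variable functions are stable under partial derivatives ([derive_factor]), so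
    every iterated partial derivative is again such a product. *)
Lemma smooth_prod_fun psi : (forall j, smooth_real (psi j)) ->
  smooth (prod_fun psi).
Proof.
move=> sp s.
have [psi' sp' ->] : exists2 psi', (forall j, smooth_real (psi' j)) &
    foldr (@partial R n) (prod_fun psi) s = prod_fun psi'.
  elim: s => [|i s [psi' sp' IH]]; first by exists psi.
  exists (derive_factor i psi'); first exact: smooth_derive_factor.
  by rewrite /= IH partial_prod_fun.
split=> [|x i]; first by apply: continuous_prod_fun => j; exact: smooth_real_continuous.
by have [] := is_derive_prod_fun i x sp'.
Qed.

Lemma prod_fun_test_function G (a b : 'I_n -> R) psi :
  (forall j, smooth_real (psi j)) ->
  (forall j s, s \notin `[a j, b j] -> psi j s = 0) ->
  rbox (fun j => `[a j, b j]%classic) `<=` G ->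
  test_function G (prod_fun psi).
Proof.
move=> sp ps BG.
have cB : compact (rbox (fun j => `[a j, b j]%classic) : set 'rV[R]_n).
  by apply: rV_compact => j; exact: segment_compact.
have clB := compact_closed (@norm_hausdorff _ _) cB.
have sB : closure [set x | prod_fun psi x != 0] `<=`
    rbox (fun j => `[a j, b j]%classic).
  rewrite [X in _ `<=` X]((closure_id _).1 clB); apply: closure_subset => x /= /eqP px j /=.
  apply: contrapT => xj; apply: px; rewrite /prod_fun (bigD1 j)//= ps ?mul0r//.
  exact/negP.
split; first exact: smooth_prod_fun.
  by apply: subclosed_compact sB; [exact: closed_closure|exact: cB].
exact: subset_trans BG.
Qed.

End product_function.

Section tent.
Context {R : realType}.

(* Vanishes outside [1/4, 11/4], equals 1 on [1/2, 9/4]. *)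
Definition tent (s : R) : R :=
  smooth_step (4 * s - 1) * smooth_step ((-2) * s + 11 / 2).

Lemma is_derive_affine (a b s : R) : is_derive s 1 (fun s => a * s + b) a.
Proof.
have H : is_derive s 1 (fun s => cst a s * s + cst b s) _ :=
  is_deriveD (is_deriveM (is_derive_cst a s 1) (is_derive_id s 1))
    (is_derive_cst b s 1).
by apply: (is_derive_eq H); rewrite scaler0 !addr0 [_%:A]mulr1.
Qed.

Lemma smooth_tent : smooth_real tent.
Proof.
have sc (a b : R) := smooth_real_comp smooth_smooth_step (smooth_real_affine a b).
exact: smooth_realM (sc 4 (-1)) (sc (-2) (11 / 2)).
Qed.

Lemma tent_itv s : 0 <= tent s <= 1.
Proof.
rewrite /tent; have /andP := smooth_step_itv (4 * s - 1).
have /andP := smooth_step_itv ((-2) * s + 11 / 2).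
move: (smooth_step _) (smooth_step _) => a b [? ?] [? ?].
by rewrite mulr_ge0//= mulr_ile1.
Qed.

Lemma tent_out s : s \notin `[1 / 4, 11 / 4] -> tent s = 0.
Proof.
rewrite in_itv/= negb_and -!ltNge => /orP[s1|s1].
  by rewrite /tent smooth_step_le0 ?mul0r//; lra.
by rewrite /tent (@smooth_step_le0 _ (-2 * s + _)) ?mulr0//; lra.
Qed.

Lemma derive1_tent s : derive1 tent s =
  4 * derive1 smooth_step (4 * s - 1) * smooth_step ((-2) * s + 11 / 2) -
  2 * derive1 smooth_step ((-2) * s + 11 / 2) * smooth_step (4 * s - 1).
Proof.
have comp (a b : R) : is_derive s 1 (fun s => smooth_step (a * s + b))
    (derive1 smooth_step (a * s + b) * a).
  apply: (is_derive1_comp _ (is_derive_affine a b s)).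
  rewrite derive1E; apply: derivableP.
  exact: smooth_real_derivable smooth_smooth_step.
have H : is_derive s 1 tent _ := is_deriveM (comp 4 (-1)) (comp (-2) (11 / 2)).
rewrite derive1E; have [_ ->] := H; rewrite /GRing.scale/=.
move: (derive1 smooth_step (4 * s - 1)) (smooth_step (4 * s - 1)) => a b.
move: (derive1 smooth_step _) (smooth_step _) => c d; ring.
Qed.

Lemma derive1_tent_ge0 s : s <= 1 / 2 ->
  derive1 tent s = 4 * derive1 smooth_step (4 * s - 1).
Proof.
move=> s1; rewrite derive1_tent (@derive1_smooth_step_out _ (-2 * s + _)); last first.
  by apply/orP; right; lra.
by rewrite mulr0 mul0r subr0 (@smooth_step_ge1 _ (-2 * s + _)) ?mulr1//; lra.
Qed.

Lemma derive1_tent_le0 s : 9 / 4 <= s -> derive1 tent s <= 0.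
Proof.
move=> s1; rewrite derive1_tent derive1_smooth_step_out; last first.
  by apply/orP; right; lra.
rewrite mulr0 mul0r sub0r oppr_le0 mulr_ge0 ?mulr_ge0//.
  exact: derive1_smooth_step_ge0.
by have /andP[] := smooth_step_itv (4 * s - 1).
Qed.

Lemma derive1_tent_eq0 s : 1 / 2 <= s <= 9 / 4 -> derive1 tent s = 0.
Proof.
move=> /andP[s1 s2]; rewrite derive1_tent !derive1_smooth_step_out.
- by ring.
- by apply/orP; right; lra.
- by apply/orP; right; lra.
Qed.

Lemma continuous_itv_lower_bound (f : R -> R) (a b : R) : a <= b -> continuous f ->
  (forall x, x \in `[a, b] -> 0 < f x) ->
  exists2 m, 0 < m & forall x, x \in `[a, b] -> m <= f x.
Proof.
move=> ab cf f0; have [c cab Hc] := @EVT_min R f a b ab (continuous_subspaceT cf).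
by exists (f c); [exact: f0|exact: Hc].
Qed.

End tent.

Section ge0_real_integral.
Context d (T : measurableType d) {R : realType}.
Variables (mu : {measure set T -> \bar R}) (D : set T).
Hypothesis mD : measurable D.
Implicit Types (f g : T -> R) (k : R).

Lemma ge0_integralZl_real f k : measurable_fun D f ->
  (forall x, D x -> 0 <= f x) -> 0 <= k ->
  (\int[mu]_(x in D) (k * f x)%:E = k%:E * \int[mu]_(x in D) (f x)%:E)%E.
Proof.
move=> mf f0 k0; under eq_integral do rewrite EFinM.
by rewrite ge0_integralZl_EFin//; exact/measurable_EFinP.
Qed.

Lemma ge0_integralD_real f g : measurable_fun D f -> measurable_fun D g ->
  (forall x, D x -> 0 <= f x) -> (forall x, D x -> 0 <= g x) ->
  (\int[mu]_(x in D) (f x + g x)%:E =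
   \int[mu]_(x in D) (f x)%:E + \int[mu]_(x in D) (g x)%:E)%E.
Proof.
move=> mf mg f0 g0; under eq_integral do rewrite EFinD.
by rewrite ge0_integralD//; exact/measurable_EFinP.
Qed.

Lemma ge0_integral_sum_real (I : Type) (s : seq I) (f : I -> T -> R) :
  (forall i, measurable_fun D (f i)) -> (forall i x, D x -> 0 <= f i x) ->
  (\int[mu]_(x in D) (\sum_(i <- s) f i x)%:E =
   \sum_(i <- s) \int[mu]_(x in D) (f i x)%:E)%E.
Proof.
move=> mf f0; under eq_integral do rewrite -sumEFin.
by rewrite ge0_integral_sum// => i; exact/measurable_EFinP.
Qed.

Lemma ge0_le_integral_real f g : measurable_fun D f -> measurable_fun D g ->
  (forall x, D x -> 0 <= f x <= g x) ->
  (\int[mu]_(x in D) (f x)%:E <= \int[mu]_(x in D) (g x)%:E)%E.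
Proof.
move=> mf mg fg; apply: ge0_le_integral => //.
- by move=> x /fg /andP[]; rewrite lee_fin.
- exact/measurable_EFinP.
- exact/measurable_EFinP.
- by move=> x /fg /andP[]; rewrite lee_fin.
Qed.

Lemma integral_indicZl k (A : set T) : measurable A -> 0 <= k ->
  (\int[mu]_(x in D) (k * \1_A x)%:E = k%:E * mu (A `&` D))%E.
Proof.
by move=> mA k0; rewrite ge0_integralZl_real ?integral_indic.
Qed.

End ge0_real_integral.

Lemma derive1_tent_out {R : realType} (s : R) :
  s \notin `[1 / 4, 11 / 4] -> derive1 tent s = 0.
Proof.
rewrite in_itv/= negb_and -!ltNge => /orP[s1|s1].
  rewrite derive1_tent_ge0; last lra.
  by rewrite derive1_smooth_step_out ?mulr0//; apply/orP; left; lra.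
rewrite derive1_tent (@derive1_smooth_step_out _ (4 * s - 1)); last first.
  by apply/orP; right; lra.
rewrite (@derive1_smooth_step_out _ (-2 * s + _)); last first.
  by apply/orP; left; lra.
by move: (smooth_step _) (smooth_step _) => x y; ring.
Qed.

(** * A lower bound for the capacity along a tube *)

Section tube.
Context {R : realType} {n : nat}.
Local Notation mu := (lebesgue_rV R n.+1).
Implicit Types (c y : 'rV[R]_n.+1) (r s t : R).

Definition tube_lo c r s (j : 'I_n.+1) : R :=
  if j == ord0 then c ord0 ord0 + s else c ord0 j - r.

Definition tube_hi c r t (j : 'I_n.+1) : R :=
  if j == ord0 then c ord0 ord0 + t else c ord0 j + r.

(** The cross-section is a cube, not a disc, so that the tube is a box: it carries test functions of
    product form and its volume is a product. *)
Definition tube c r s t : set 'rV[R]_n.+1 :=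
  rbox (fun j => `[tube_lo c r s j, tube_hi c r t j]%classic).

Lemma tubeP c r s t y : tube c r s t y <->
  s <= y ord0 ord0 - c ord0 ord0 <= t /\
  forall i : 'I_n, `|y ord0 (lift ord0 i) - c ord0 (lift ord0 i)| <= r.
Proof.
split=> [ty|[/andP[y1 y2] yi] j].
  split=> [|i].
    by have := ty ord0; rewrite /tube_lo /tube_hi /= in_itv/=; lra.
  have := ty (lift ord0 i); rewrite /tube_lo /tube_hi /= in_itv/= ler_norml.
  by lra.
have [i ->|->] := unliftP ord0 j; rewrite /tube_lo /tube_hi /= in_itv/=.
  by have := yi i; rewrite ler_norml; lra.
by lra.
Qed.

Lemma measurable_tube c r s t : measurable (tube c r s t).
Proof. by apply: measurable_rbox => j; exact: measurable_itv. Qed.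

Lemma lebesgue_tube c r s t : 0 <= r -> s <= t ->
  mu (tube c r s t) = ((t - s) * (2 * r) ^+ n)%:E.
Proof.
move=> r0 st; have itvE (a b : R) : a <= b ->
    lebesgue_measure (`[a, b]%classic : set (measurableTypeR R)) = (b - a)%:E.
  rewrite lebesgue_measure_itv/= lte_fin le_eqVlt => /predU1P[->|->//].
  by rewrite ltxx subrr.
rewrite lebesgue_rV_rbox; last by move=> i; exact: measurable_itv.
rewrite big_ord_recl itvE /tube_lo /tube_hi/= ?lerD2l//.
rewrite (eq_bigr (fun=> (2 * r)%:E)) => [|i _]; last first.
  by rewrite itvE; [congr EFin; ring|lra].
rewrite prodEFin big_const_ord iter_mulr_1 -EFinM; congr (_ * _)%:E.
by ring.
Qed.

End tube.

Section capacity_lower_bound.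
Context {R : realType} {n : nat}.
Local Notation mu := (lebesgue_rV R n.+1).
Variables (c : 'rV[R]_n.+1) (r t : R).
Hypotheses (r0 : 0 < r) (t0 : 0 < t).
Implicit Types (y : 'rV[R]_n.+1).

Let psi (j : 'I_n.+1) : R -> R := if j == ord0
  then fun s => tent (t^-1 * s + - (t^-1 * c ord0 ord0))
  else fun s => smooth_bump (r^-1 * s + - (r^-1 * c ord0 j)).

Let phi := prod_fun psi.

Let smooth_psi j : smooth_real (psi j).
Proof.
rewrite /psi; case: ifP => _.
  exact: smooth_real_comp smooth_tent (smooth_real_affine _ _).
exact: smooth_real_comp smooth_smooth_bump (smooth_real_affine _ _).
Qed.

Let height y := t^-1 * y ord0 ord0 + - (t^-1 * c ord0 ord0).

Let section y := \prod_(i < n) smooth_bump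
  (r^-1 * y ord0 (lift ord0 i) + - (r^-1 * c ord0 (lift ord0 i))).

Let phiE y : phi y = tent (height y) * section y.
Proof. by rewrite /phi /prod_fun big_ord_recl. Qed.

Let section_itv y : 0 <= section y <= 1.
Proof.
rewrite /section prodr_ge0/=; last by move=> i _; exact: smooth_bump_ge0.
by apply: prodr_ile1 => i _; rewrite smooth_bump_ge0 smooth_bump_le1.
Qed.

Let phi_itv y : 0 <= phi y <= 1.
Proof.
rewrite phiE; move: (tent_itv (height y)) (section_itv y).
move: (tent _) (section _) => a b /andP[? ?] /andP[? ?].
by rewrite mulr_ge0//= mulr_ile1.
Qed.

Let partial_phi y : partial ord0 phi y =
  t^-1 * derive1 tent (height y) * section y.
Proof.
rewrite /phi (partial_prod_fun _ smooth_psi) /prod_fun big_ord_recl.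
congr (_ * _); rewrite /derive_factor eqxx /psi eqxx -/(height y).
have dt : is_derive (height y) 1 tent (derive1 tent (height y)).
  rewrite derive1E; apply: derivableP.
  exact: smooth_real_derivable smooth_tent.
have H := @is_derive1_comp _ tent (fun s => t^-1 * s + - (t^-1 * c ord0 ord0))
  _ _ _ dt (is_derive_affine t^-1 (- (t^-1 * c ord0 ord0)) _).
apply: etrans (derive1E _ _) _; apply: etrans (@derive_val _ _ _ _ _ _ _ H) _.
exact: mulrC.
Qed.

Let psi_out j s :
  s \notin `[tube_lo c r (t / 4) j, tube_hi c r (11 * t / 4) j] -> psi j s = 0.
Proof.
rewrite /psi /tube_lo /tube_hi; case: eqP => _ H.
  apply: tent_out; move: H; apply: contra; rewrite !in_itv/= -mulrBr.
  by rewrite ler_pdivlMl// ler_pdivrMl//; lra.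
apply: smooth_bump_out; rewrite -mulrBr normrM gtr0_norm ?invr_gt0//.
rewrite ler_pdivlMl// mulr1 leNgt; move: H; apply: contra.
by rewrite in_itv/= ltr_norml; lra.
Qed.

Let section_eq0 y (i : 'I_n) :
  r <= `|y ord0 (lift ord0 i) - c ord0 (lift ord0 i)| -> section y = 0.
Proof.
move=> H; rewrite /section (bigD1 i)//= smooth_bump_out ?mul0r//.
by rewrite -mulrBr normrM gtr0_norm ?invr_gt0// ler_pdivlMl// mulr1.
Qed.

Let phi_out y : ~ tube c r (t / 4) (11 * t / 4) y -> phi y = 0.
Proof.
move=> yT; apply: contrapT => py; apply: yT => j /=; apply: contrapT => /negP yj.
by apply: py; rewrite /phi /prod_fun (bigD1 j)//= (psi_out yj) mul0r.
Qed.

Let test_phi G : tube c r (t / 4) (11 * t / 4) `<=` G -> test_function G phi.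
Proof. exact: prod_fun_test_function smooth_psi psi_out. Qed.

(** Here 4 [height] - 1 lies in [1/4, 3/4] and the arguments of the bumps lie in [-1/2, 1/2],
    compact ranges on which the slope of [smooth_step] and the bump have positive lower bounds. *)
Let half_tube := tube c (r / 2) (5 * t / 16) (7 * t / 16).

Let heightE y s : (s <= height y) = (s * t <= y ord0 ord0 - c ord0 ord0).
Proof. by rewrite /height -mulrBr ler_pdivlMl// mulrC. Qed.

Let heightE' y s : (height y <= s) = (y ord0 ord0 - c ord0 ord0 <= s * t).
Proof. by rewrite /height -mulrBr ler_pdivrMl// mulrC. Qed.

(** At heights between t/2 and 9t/4, where nothing is known of [u], the tent is constant; on its
    rising part [u] is at least 1, and on its falling part both [u] and the slope are nonpositive.
    Hence the product is nonnegative everywhere, and quantitatively positive on [half_tube]. *)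
Let partial_phi_ge (E F G : set 'rV[R]_n.+1) (u : 'rV[R]_n.+1 -> R) (a b : R) :
  tube c r (t / 4) (t / 2) `<=` E -> tube c r (9 * t / 4) (11 * t / 4) `<=` F ->
  (forall x, E x -> 1 <= u x) -> (forall x, F x -> u x <= 0) ->
  0 <= a -> 0 <= b ->
  (forall s, s \in `[1 / 4, 3 / 4] -> a <= derive1 smooth_step s) ->
  (forall s, s \in `[- (1 / 2), 1 / 2] -> b <= smooth_bump s) ->
  forall y, t^-1 * (4 * a) * b ^+ n * \1_half_tube y <= u y * partial ord0 phi y.
Proof.
move=> TE TF Eu Fu a0 b0 Ha Hb y.
have t1 : 0 <= t^-1 by rewrite invr_ge0 ltW.
have t0' := t0.
have [s0 s1] := andP (section_itv y).
have out : ~ half_tube y -> 0 <= u y * partial ord0 phi y ->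
    t^-1 * (4 * a) * b ^+ n * \1_half_tube y <= u y * partial ord0 phi y.
  by move=> yH; rewrite indicE memNset// mulr0.
have [sy|] := pselect (forall i : 'I_n,
    `|y ord0 (lift ord0 i) - c ord0 (lift ord0 i)| < r); last first.
  move=> /existsNP[i /negP]; rewrite -leNgt => ri.
  apply: out; last by rewrite partial_phi (section_eq0 ri) !mulr0.
  move=> /tubeP[_ /(_ i)/(le_trans ri)].
  by rewrite leNgt ltr_pdivrMr// ltr_pMr// ltr1n.
have tub s s' : s * t <= y ord0 ord0 - c ord0 ord0 <= s' * t ->
    tube c r (s * t) (s' * t) y.
  by move=> H; apply/tubeP; split => // i; exact/ltW.
have [h1|h1] := leP (1 / 4) (height y); last first.
  apply: out; last first.
    rewrite partial_phi derive1_tent_out ?mulr0 ?mul0r ?mulr0//.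
    by rewrite in_itv/= leNgt h1.
  move=> /tubeP[/andP[H _] _]; move: h1; rewrite ltNge heightE => /negP; apply; lra.
have [h2|h2] := leP (height y) (1 / 2).
  have yE : E y.
    apply: TE; have -> : t / 4 = 1 / 4 * t by lra.
    have -> : t / 2 = 1 / 2 * t by lra.
    by apply: tub; rewrite -heightE -heightE' h1 h2.
  have d0 : 0 <= partial ord0 phi y.
    by rewrite partial_phi mulr_ge0// mulr_ge0// derive1_tent_ge0// mulr_ge0// derive1_smooth_step_ge0.
  apply: (@le_trans _ _ (partial ord0 phi y)); last first.
    by rewrite ler_peMl// Eu.
  rewrite indicE; case: (boolP (y \in half_tube)) => [|_]; last by rewrite mulr0.
  rewrite inE mulr1 => /tubeP[/andP[H1 H2] H3].
  rewrite partial_phi derive1_tent_ge0// ler_pM ?mulr_ge0 ?exprn_ge0//.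
    rewrite ler_wpM2l// ler_wpM2l//; apply: Ha; rewrite in_itv/=.
    have : 5 / 16 <= height y by rewrite heightE; lra.
    have : height y <= 7 / 16 by rewrite heightE'; lra.
    lra.
  rewrite /section -[X in _ ^+ X]card_ord -prodr_const.
  apply: ler_prod => i _; rewrite b0/=; apply: Hb; rewrite in_itv/= -ler_norml.
  rewrite -mulrBr normrM gtr0_norm ?invr_gt0// ler_pdivrMl//.
  by apply: le_trans (H3 i) _; lra.
apply: out.
  move=> /tubeP[/andP[_ H] _]; move: h2; rewrite ltNge heightE' => /negP; apply; lra.
have [h3|h3] := leP (height y) (9 / 4).
  by rewrite partial_phi derive1_tent_eq0 ?mulr0 ?mul0r ?mulr0// (ltW h2).
have [h4|h4] := leP (height y) (11 / 4); last first.
  rewrite partial_phi derive1_tent_out ?mulr0 ?mul0r ?mulr0//.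
  by rewrite in_itv/= negb_and -!ltNge h4 orbT.
apply: mulr_le0.
  apply: Fu; apply: TF; have -> : 9 * t / 4 = 9 / 4 * t by lra.
  have -> : 11 * t / 4 = 11 / 4 * t by lra.
  by apply: tub; rewrite -heightE -heightE' (ltW h3) h4.
rewrite partial_phi mulr_le0_ge0// mulr_ge0_le0//.
exact/derive1_tent_le0/ltW.
Qed.

(* The weak formulation is tested with [phi], whose axial derivative is
   positive only where [u >= 1] and negative only where [u <= 0]. *)
Lemma weak_gradient_tube_ge (q l a b : R) (E F G : set 'rV[R]_n.+1)
    (u : 'rV[R]_n.+1 -> R) (g : 'rV[R]_n.+1 -> 'rV[R]_n.+1) :
  1 <= q -> 0 < l -> 0 <= a -> 0 <= b -> measurable G ->
  tube c r (t / 4) (11 * t / 4) `<=` G ->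
  tube c r (t / 4) (t / 2) `<=` E -> tube c r (9 * t / 4) (11 * t / 4) `<=` F ->
  cap_admissible q E F G u -> weak_gradient q G u g ->
  (forall s, s \in `[1 / 4, 3 / 4] -> a <= derive1 smooth_step s) ->
  (forall s, s \in `[- (1 / 2), 1 / 2] -> b <= smooth_bump s) ->
  ((a * b ^+ n * r ^+ n / 2)%:E <=
   (l * (5 * t / 2 * (2 * r) ^+ n))%:E +
   (l `^ (1 - q))%:E * \int[mu]_(x in G) (enorm (g x) `^ q)%:E)%E.
Proof.
move=> q1 l0 a0 b0 mG TG TE TF [[[mu_ _] _] _ Eu Fu] wg Ha Hb.
have t0' := t0; have r0' := r0.
have mg i : measurable_fun G (fun x => g x ord0 i) by have [[]] := wg i.
have sphi : continuously_differentiable phi.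
  exact: smooth_continuously_differentiable (smooth_prod_fun smooth_psi).
have [cphi _ pphi] := sphi.
have mphi : measurable_fun G phi.
  by apply: measurable_funTS; exact: continuous_measurable_rV.
have mH : measurable half_tube by exact: measurable_tube.
have mT : measurable (tube c r (t / 4) (11 * t / 4)) by exact: measurable_tube.
set k := t^-1 * (4 * a) * b ^+ n.
have k0 : 0 <= k by rewrite !mulr_ge0 ?exprn_ge0// invr_ge0 ltW.
have HG : half_tube `<=` G.
  apply: subset_trans TG => y /tubeP[/andP[h1 h2] h3]; apply/tubeP; split.
    by apply/andP; split; lra.
  by move=> i; apply: le_trans (h3 i) _; lra.
have mind (A : set 'rV[R]_n.+1) : measurable A -> measurable_fun G (\1_A : _ -> R).
  by move=> mA; apply: measurable_funTS; exact/measurable_indicP.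
(* The half tube has length t/8 and cross-section r^n, and k = 4 a b^n / t. *)
have -> : (a * b ^+ n * r ^+ n / 2)%:E = (\int[mu]_(y in G) (k * \1_half_tube y)%:E)%E.
  rewrite integral_indicZl// (setIidl HG).
  apply/esym; apply: etrans (congr1 (mule k%:E)
    (_ : _ = ((7 * t / 16 - 5 * t / 16) * (2 * (r / 2)) ^+ n)%:E)) _.
    by apply: lebesgue_tube; lra.
  apply/esym.
  rewrite -EFinM; congr EFin; rewrite /k -[in RHS]mulrA.
  rewrite (_ : 2 * (r / 2) = r); last by field.
  by field; rewrite gt_eqF.
have tphi : test_function G phi by exact: test_phi.
apply: (@le_trans _ _ (\int[mu]_(y in G) (u y * partial ord0 phi y)%:E)%E).
  apply: ge0_le_integral_real => //.
  - by apply: measurable_funM => //; exact: mind.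
  - apply: measurable_funM => //.
    by apply: measurable_funTS; exact: continuous_measurable_rV.
  - move=> y _; rewrite mulr_ge0//=.
    exact: partial_phi_ge TE TF Eu Fu a0 b0 Ha Hb y.
(* The integral becomes minus that of [g] (coordinate 0) times [phi]. As 0 <= phi <= 1 with support
   in the tube, the integrand is at most |g| there, and [ler_add_powR] splits it into the level [l]
   and the energy. *)
have [_ wp] := wg ord0; rewrite (wp _ tphi).
apply: (le_trans (lee_abs _)); rewrite abseN.
apply: le_trans (le_abse_integral _ _ _) _ => //.
  by apply/measurable_EFinP; apply: measurable_funM.
have mgq : measurable_fun G (fun x => enorm (g x) `^ q).
  apply: (@measurableT_comp _ _ _ _ _ _ (@powR R ^~ q)) => //.
  exact: measurable_enorm.
rewrite (_ : (l * _)%:E = (\int[mu]_(y in G)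
    (l * \1_(tube c r (t / 4) (11 * t / 4)) y)%:E)%E); last first.
  rewrite integral_indicZl ?ltW// (setIidl TG).
  apply/esym; apply: etrans (congr1 (mule l%:E)
    (_ : _ = ((11 * t / 4 - t / 4) * (2 * r) ^+ n)%:E)) _.
    by apply: lebesgue_tube; lra.
  apply/esym.
  by rewrite -EFinM; congr EFin; congr (_ * (_ * _)); lra.
rewrite -ge0_integralZl_real//; last 2 first.
- by move=> y _; exact: powR_ge0.
- exact: powR_ge0.
rewrite -ge0_integralD_real//; last 4 first.
- by apply: measurable_funM => //; exact: mind.
- exact: measurable_funM.
- by move=> x _; rewrite mulr_ge0// ltW.
- by move=> x _; rewrite mulr_ge0 ?powR_ge0.
under eq_integral do rewrite abse_EFin.
apply: ge0_le_integral_real => //.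
- by apply: measurableT_comp => //; exact: measurable_funM.
- apply: measurable_funD; last exact: measurable_funM.
  by apply: measurable_funM => //; exact: mind.
move=> y _; rewrite normr_ge0/= indicE.
have [yT|yT] := pselect (tube c r (t / 4) (11 * t / 4) y); last first.
  by rewrite phi_out// mulr0 normr0 addr_ge0 ?mulr_ge0 ?powR_ge0// ltW.
rewrite mem_set// mulr1; apply: le_trans (ler_add_powR q1 _ l0); last exact: enorm_ge0.
rewrite normrM; apply: le_trans (coord_le_enorm (g y) ord0).
by rewrite ler_piMr// ger0_norm; have /andP[] := phi_itv y.
Qed.

End capacity_lower_bound.

#[global] Opaque tent.

Section capacity_lower_bound_explicit.
Context {R : realType} {n : nat}.
Local Notation mu := (lebesgue_rV R n.+1).
Implicit Types (E F G : set 'rV[R]_n.+1) (c : 'rV[R]_n.+1).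

Lemma Cap_tube_ge (q : R) : 1 <= q -> exists2 k, 0 < k &
  forall E F G c r t, 0 < r -> 0 < t -> measurable G ->
  tube c r (t / 4) (11 * t / 4) `<=` G ->
  tube c r (t / 4) (t / 2) `<=` E -> tube c r (9 * t / 4) (11 * t / 4) `<=` F ->
  ((k * (r ^+ n * t `^ (1 - q)))%:E <= Cap q E F G)%E.
Proof.
move=> q1.
have [a a0 Ha] : exists2 a : R, 0 < a &
    forall s, s \in `[1 / 4, 3 / 4] -> a <= derive1 smooth_step s.
  apply: continuous_itv_lower_bound; first lra.
    exact/smooth_real_continuous/smooth_real_derive1/smooth_smooth_step.
  by move=> x; rewrite in_itv/= => ?; apply: derive1_smooth_step_gt0; lra.
have [b b0 Hb] : exists2 b : R, 0 < b &
    forall s, s \in `[- (1 / 2), 1 / 2] -> b <= smooth_bump s.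
  apply: continuous_itv_lower_bound; first lra.
    exact/smooth_real_continuous/smooth_smooth_bump.
  move=> x; rewrite in_itv/= => ?; apply: smooth_bump_gt0.
  by rewrite ltr_norml; lra.
pose A := a * b ^+ n / 2.
have A0 : 0 < A by rewrite divr_gt0// mulr_gt0// exprn_gt0.
(* The level is L / t, the slope natural for a drop of 1 over a length of order t; [L] is fixed so
   that the level term equals half of the left-hand side A r^n and can be absorbed. *)
pose L := A / (5 * 2 ^+ n).
have L0 : 0 < L by rewrite divr_gt0// mulr_gt0// exprn_gt0.
exists (A / 2 * L `^ (q - 1)); first by rewrite mulr_gt0 ?powR_gt0// divr_gt0.
move=> E F G c r t r0 t0 mG TG TE TF.
apply: le_ereal_inf_tmp => _ [u [g [au wg ->]]].
have : (0 <= \int[mu]_(x in G) (enorm (g x) `^ q)%:E)%E.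
  by apply: integral_ge0 => x _; rewrite lee_fin powR_ge0.
have := weak_gradient_tube_ge r0 t0 q1 (divr_gt0 L0 t0) (ltW a0) (ltW b0)
  mG TG TE TF au wg Ha Hb.
case: (\int[mu]_(x in G) _)%E => [I|_ _|//]; last by rewrite leey.
rewrite -EFinM -EFinD !lee_fin => + _.
rewrite (_ : L / t * _ = A / 2 * r ^+ n); last first.
  by rewrite /L exprMn; field; rewrite !gt_eqF ?exprn_gt0.
rewrite (_ : a * _ * _ / 2 = A * r ^+ n); last by rewrite /A; ring.
rewrite powRM ?invr_ge0 ?(ltW L0) ?(ltW t0)// -[1 - q]opprB powRN opprB.
have -> : t^-1 `^ (1 - q) = (t `^ (1 - q))^-1.
  by rewrite -(powR_inv1 (ltW t0)) -powRrM mulN1r powRN.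
have P0 : 0 < L `^ (q - 1) by rewrite powR_gt0.
have Q0 : 0 < t `^ (1 - q) by rewrite powR_gt0.
move: P0 Q0; move: (L `^ _) (t `^ _) => P Q P0 Q0 H.
have {}H : A / 2 * r ^+ n <= (P * Q)^-1 * I by rewrite invfM; lra.
rewrite (_ : _ * (r ^+ n * Q) = (P * Q) * (A / 2 * r ^+ n)); last by ring.
by rewrite -ler_pdivlMl// mulr_gt0.
Qed.

End capacity_lower_bound_explicit.


Section balls.
Context {R : realType} {n : nat}.
Local Notation mu := (lebesgue_rV R n).
Implicit Types (x y : 'rV[R]_n) (r t a b : R).

Lemma eball_sub_rbox x r :
  eball x r `<=` rbox (fun j => `[x ord0 j - r, x ord0 j + r]%classic).
Proof.
move=> y /= yr j; rewrite /= in_itv/=.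
have := le_trans (coord_le_enorm (y - x) j) (ltW yr).
by rewrite !mxE ler_norml; lra.
Qed.

Lemma eball_sub_cube x r : exists M, eball x r `<=` cube M.
Proof.
have [M HM] : exists M, rbox (fun j => `[x ord0 j - r, x ord0 j + r]%classic) `<=` @cube R n M.
  by apply: compact_sub_cube; apply: rV_compact => j; exact: segment_compact.
by exists M; exact: subset_trans (@eball_sub_rbox x r) HM.
Qed.

Lemma lebesgue_eball_le x r : 0 <= r -> (mu (eball x r) <= ((2 * r) ^+ n)%:E)%E.
Proof.
move=> r0; apply: (@le_trans _ _ (mu (rbox (fun j => `[x ord0 j - r, x ord0 j + r]%classic)))).
  apply: le_measure; rewrite ?inE; [exact: measurable_eball| |exact: eball_sub_rbox].
  by apply: measurable_rbox => j; exact: measurable_itv.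
rewrite lebesgue_rV_rbox; last by move=> i; exact: measurable_itv.
rewrite (eq_bigr (fun=> (2 * r)%:E)) ?prodEFin ?big_const_ord ?iter_mulr_1//.
move=> i _; rewrite lebesgue_measure_itv/= lte_fin.
case: ifPn => [_|]; first by rewrite -EFinB; congr EFin; lra.
rewrite -leNgt => r1; have -> : r = 0 by lra.
by rewrite mulr0.
Qed.

Lemma ge0_integral_eball_le x r (f : 'rV[R]_n -> R) C : 0 <= r -> 0 <= C ->
  measurable_fun (eball x r) f -> (forall y, eball x r y -> 0 <= f y <= C) ->
  (\int[mu]_(y in eball x r) (f y)%:E <= (C * (2 * r) ^+ n)%:E)%E.
Proof.
move=> r0 C0 mf fC; have mB := measurable_eball x r.
apply: (@le_trans _ _ (\int[mu]_(y in eball x r) C%:E)%E).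
  by apply: (ge0_le_integral_real _ mB mf (g := cst C)).
rewrite integral_cst// EFinM.
by apply: lee_wpmul2l; [rewrite lee_fin|exact: lebesgue_eball_le].
Qed.

End balls.

(** * Cutoff functions and the capacity of balls *)

Section cutoff.
Context {R : realType} {n : nat}.
Implicit Types (x y : 'rV[R]_n) (a b : R) (P : pred 'I_n).

Lemma derive1_smooth_step_bounded :
  exists2 K : R, 0 < K & forall s, `|derive1 smooth_step s| <= K.
Proof.
have [c c01 Hc] := @EVT_max R (derive1 smooth_step) 0 1 ler01
  (continuous_subspaceT (smooth_real_continuous (smooth_real_derive1 smooth_smooth_step))).
exists (derive1 smooth_step c + 1); first by rewrite ltr_wpDl// derive1_smooth_step_ge0.
move=> s; rewrite ger0_norm ?derive1_smooth_step_ge0//.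
have [s01|] := boolP (s \in `[0, 1]); first by rewrite (le_trans (Hc s s01))// lerDl.
rewrite in_itv/= negb_and -!ltNge => /orP[s0|s1]; rewrite derive1_smooth_step_out;
  rewrite ?addr_ge0 ?derive1_smooth_step_ge0//; apply/orP; [left|right]; lra.
Qed.

Definition sqr_dist P x y : R := \sum_(j < n | P j) (y ord0 j - x ord0 j) ^+ 2.

(** A function of the squared distance, hence $C^1$ also where the distance vanishes. [P] selects
    the coordinates that count: all of them for balls, the radial ones for cylinders around the axis
    of the cusp. *)
Definition cutoff P x a b y : R :=
  smooth_step ((b ^+ 2 - a ^+ 2)^-1 * (b ^+ 2 - sqr_dist P x y)).

Lemma sqr_distT x y : sqr_dist predT x y = enorm (y - x) ^+ 2.
Proof. by rewrite sqr_enorm; apply: eq_bigr => i _; rewrite !mxE. Qed.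

Lemma sqr_dist_C1 P x : continuously_differentiable (sqr_dist P x).
Proof.
apply: continuously_differentiable_sum => j _.
have H : continuously_differentiable (fun y => coord_rV j y + cst (- x ord0 j) y).
  apply: continuously_differentiableD.
    exact: continuously_differentiable_coord.
  exact: continuously_differentiable_cst.
by have := continuously_differentiableM H H; under eq_fun do rewrite -expr2.
Qed.

Lemma partial_sqr_dist P x y i :
  partial i (sqr_dist P x) y = (P i)%:R * (2 * (y ord0 i - x ord0 i)).
Proof.
have H j : continuously_differentiable (fun y => coord_rV j y + cst (- x ord0 j) y).
  apply: continuously_differentiableD.
    exact: continuously_differentiable_coord.
  exact: continuously_differentiable_cst.
rewrite /sqr_dist partial_sum; last first.
  move=> j _; have := continuously_differentiableM (H j) (H j).
  by under eq_fun do rewrite -expr2.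
have E j : partial i (fun z => (z ord0 j - x ord0 j) ^+ 2) y =
    (i == j)%:R * (2 * (y ord0 j - x ord0 j)).
  have [_ dH _] := H j.
  have := partialM (dH y i) (dH y i).
  have dj : derivable (coord_rV j) y (delta_mx ord0 i).
    by have [] := is_derive_coord y i j.
  have dc : derivable (cst (- x ord0 j) : 'rV[R]_n -> R) y (delta_mx ord0 i).
    exact: derivable_cst.
  rewrite (partialD dj dc) partial_coord /partial derive_cst addr0.
  by under eq_fun do rewrite -expr2; move=> ->; rewrite /coord_rV/cst; ring.
rewrite (eq_bigr _ (fun j _ => E j)).
have [Pi|nPi] := boolP (P i); last first.
  rewrite big1 ?mul0r// => j Pj; case: eqP => [ij|]; last by rewrite mul0r.
  by move: nPi; rewrite ij Pj.
rewrite (bigD1 i)//= eqxx big1 ?addr0// => j /andP[_ /negbTE ji].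
by rewrite eq_sym ji mul0r.
Qed.

Section fixed_radii.
Variables (P : pred 'I_n) (x : 'rV[R]_n) (a b : R).
Hypotheses (a0 : 0 <= a) (ab : a < b).

Let ab2 : 0 < b ^+ 2 - a ^+ 2.
Proof. by rewrite subr_gt0 ltrXn2r. Qed.

Lemma cutoff_C1 : continuously_differentiable (cutoff P x a b).
Proof.
apply: (continuously_differentiable_comp smooth_smooth_step).
apply: (continuously_differentiableM (continuously_differentiable_cst _)).
apply: (continuously_differentiableD (continuously_differentiable_cst _)).
have := continuously_differentiableM (continuously_differentiable_cst (-1))
  (sqr_dist_C1 P x).
by under eq_fun do rewrite mulN1r.
Qed.

Lemma cutoff_itv y : 0 <= cutoff P x a b y <= 1.
Proof. exact: smooth_step_itv. Qed.

Lemma cutoff1 y : sqr_dist P x y <= a ^+ 2 -> cutoff P x a b y = 1.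
Proof.
move=> ya; apply: smooth_step_ge1; rewrite ler_pdivlMl// mulr1.
by rewrite lerD2l lerN2.
Qed.

Lemma cutoff0 y : b ^+ 2 <= sqr_dist P x y -> cutoff P x a b y = 0.
Proof.
by move=> ya; apply: smooth_step_le0; rewrite pmulr_rle0 ?invr_gt0// subr_le0.
Qed.

Lemma partial_cutoff y i : partial i (cutoff P x a b) y =
  derive1 smooth_step ((b ^+ 2 - a ^+ 2)^-1 * (b ^+ 2 - sqr_dist P x y)) *
  ((b ^+ 2 - a ^+ 2)^-1 * - ((P i)%:R * (2 * (y ord0 i - x ord0 i)))).
Proof.
have [_ dS _] := sqr_dist_C1 P x.
have d2 : is_derive y (delta_mx ord0 i) (fun y => cst (b ^+ 2) y - sqr_dist P x y)
    (0 - (P i)%:R * (2 * (y ord0 i - x ord0 i))).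
  apply: is_deriveB; rewrite -partial_sqr_dist; exact: is_partial.
have d3 : is_derive y (delta_mx ord0 i)
    (fun y => cst (b ^+ 2 - a ^+ 2)^-1 y * (cst (b ^+ 2) y - sqr_dist P x y)) _ :=
  is_deriveM (is_derive_cst _ _ _) d2.
have ds : is_derive ((b ^+ 2 - a ^+ 2)^-1 * (b ^+ 2 - sqr_dist P x y)) 1
    smooth_step (derive1 smooth_step ((b ^+ 2 - a ^+ 2)^-1 * (b ^+ 2 - sqr_dist P x y))).
  by rewrite derive1E; apply: derivableP; exact: smooth_real_derivable smooth_smooth_step.
have H := is_derive_comp_real ds d3.
apply: etrans (@derive_val _ _ _ _ _ _ _ H) _.
by rewrite scaler0 addr0 sub0r.
Qed.

Lemma partial_cutoff0 y i :
  (sqr_dist P x y <= a ^+ 2) || (b ^+ 2 <= sqr_dist P x y) ->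
  partial i (cutoff P x a b) y = 0.
Proof.
rewrite partial_cutoff => H; rewrite derive1_smooth_step_out ?mul0r//.
case/orP : H => H; apply/orP; [right|left].
  by rewrite ler_pdivlMl// mulr1 lerD2l lerN2.
by rewrite pmulr_rle0 ?invr_gt0// subr_le0.
Qed.

(** Where the cutoff is not locally constant the distance is below [b], so each coordinate of the
    offset selected by [P] is at most [b]. *)
Lemma partial_cutoff_le K y i : (forall s, `|derive1 smooth_step s| <= K) ->
  `|partial i (cutoff P x a b) y| <= K * (2 * b / (b ^+ 2 - a ^+ 2)).
Proof.
move=> HK; have K0 : 0 <= K := le_trans (normr_ge0 _) (HK 0).
have b0 : 0 < b := le_lt_trans a0 ab.
have r0 : 0 <= K * (2 * b / (b ^+ 2 - a ^+ 2)).
  by rewrite mulr_ge0// divr_ge0 ?mulr_ge0 ?ltW.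
have [yb|yb] := leP (b ^+ 2) (sqr_dist P x y).
  by rewrite partial_cutoff0 ?yb ?orbT// normr0.
rewrite partial_cutoff normrM ler_pM//.
rewrite normrM ger0_norm ?invr_ge0 ?(ltW ab2)// mulrC ler_wpM2r ?invr_ge0 ?(ltW ab2)//.
rewrite normrN; case: (boolP (P i)) => Pi; last first.
  by rewrite mul0r normr0 mulr_ge0 ?ltW.
rewrite mul1r normrM ger0_norm// ler_wpM2l//.
rewrite -ler_sqr ?nnegrE ?(ltW b0)// real_normK ?num_real//.
apply: le_trans (ltW yb); rewrite /sqr_dist (bigD1 i)//= lerDl.
by apply: sumr_ge0 => j _; exact: sqr_ge0.
Qed.

End fixed_radii.

End cutoff.

Section ball_capacity.
Context {R : realType} {n : nat}.
Local Notation mu := (lebesgue_rV R n.+1).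
Implicit Types (E F G : set 'rV[R]_n.+1) (c y : 'rV[R]_n.+1) (q r t s : R).

Definition ball_cap q E c t : \bar R :=
  Cap q (E `&` eball c t) (annulus c (2 * t) (3 * t)) (eball c (4 * t)).

Lemma sqr_enorm_recl y :
  enorm y ^+ 2 = y ord0 ord0 ^+ 2 + \sum_(i < n) y ord0 (lift ord0 i) ^+ 2.
Proof. by rewrite sqr_enorm big_ord_recl. Qed.

Lemma enorm_lt y r : 0 < r -> (enorm y < r) = (enorm y ^+ 2 < r ^+ 2).
Proof. by move=> r0; rewrite ltr_sqr ?nnegrE ?enorm_ge0 ?ltW. Qed.

Lemma tube_enorm c r s t y T : 0 <= s -> 0 <= r -> n.+1%:R * r <= T ->
  tube c r s t y ->
  s ^+ 2 <= enorm (y - c) ^+ 2 <= t ^+ 2 + T ^+ 2.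
Proof.
move=> s0 r0 rT /tubeP[/andP[h1 h2] h3]; rewrite sqr_enorm_recl !mxE.
set h := y ord0 ord0 - _ in h1 h2 *.
have S0 : 0 <= \sum_(i < n) (y - c) ord0 (lift ord0 i) ^+ 2.
  by apply: sumr_ge0 => i _; exact: sqr_ge0.
have S1 : \sum_(i < n) (y - c) ord0 (lift ord0 i) ^+ 2 <= T ^+ 2.
  apply: (@le_trans _ _ (\sum_(i < n) r ^+ 2)).
    apply: ler_sum => i _; rewrite !mxE -real_normK ?num_real//.
    by rewrite lerXn2r ?nnegrE//; exact: h3.
  rewrite sumr_const card_ord -mulr_natl.
  apply: (@le_trans _ _ ((n.+1%:R * r) ^+ 2)).
    rewrite exprMn ler_wpM2r ?sqr_ge0// expr2 -natrM ler_nat.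
    by rewrite mulSn -addn1 -addnA leq_addr ?ltnW//; exact: leq_trans (leqnSn n) (leq_addr _ _).
  by rewrite lerXn2r ?nnegrE ?mulr_ge0// (le_trans _ rT)// mulr_ge0.
apply/andP; split.
  by rewrite (le_trans (lerXn2r 2 _ _ h1)) ?nnegrE ?(le_trans s0 h1) ?lerDl.
by rewrite lerD// lerXn2r ?nnegrE ?(le_trans s0 h1)// (le_trans s0)// (le_trans h1 h2).
Qed.

Lemma tube_sub_eball c r s t T rho : 0 <= s -> 0 <= r -> n.+1%:R * r <= T ->
  0 < rho -> t ^+ 2 + T ^+ 2 < rho ^+ 2 -> tube c r s t `<=` eball c rho.
Proof.
move=> s0 r0 rT rho0 H y yT; rewrite /eball/= enorm_lt//.
by have /andP[_ /le_lt_trans] := tube_enorm s0 r0 rT yT; apply.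
Qed.

(** A width bounded by t/4 keeps the near end of the tube in B(c,t) and its far end, at heights 9t/4
    to 11t/4, strictly between the radii 2t and 3t. Only the near end depends on [E], the other set
    being the full annulus. *)
Lemma Cap_axial_ge q : 1 <= q -> exists2 k, 0 < k &
  forall E c r t, 0 < t -> 0 < r -> n.+1%:R * r <= t / 4 ->
  tube c r (t / 4) (t / 2) `<=` E ->
  ((k * (r ^+ n * t `^ (1 - q)))%:E <= ball_cap q E c t)%E.
Proof.
move=> q1; have [k k0 Hk] := @Cap_tube_ge R n q q1.
exists k => // E c r t t0 r0 rt TE.
have t40 : 0 <= t / 4 by lra.
have t20 : 0 < t ^+ 2 by rewrite exprn_gt0.
apply: Hk => //.
- exact: measurable_eball.
- apply: (tube_sub_eball t40 (ltW r0) rt); first by lra.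
  by rewrite !exprMn; lra.
- move=> y yT; split; first exact: TE.
  by apply: (tube_sub_eball t40 (ltW r0) rt t0 _ yT); rewrite !exprMn; lra.
- move=> y yT; have t90 : 0 <= 9 * t / 4 by lra.
  have /andP[h1 h2] := tube_enorm t90 (ltW r0) rt yT.
  split; rewrite /eball/=.
    rewrite enorm_lt; last by lra.
    by apply: le_lt_trans h2 _; rewrite !exprMn; lra.
  apply/negP; rewrite -leNgt -ler_sqr ?nnegrE ?enorm_ge0//; last lra.
  by apply: le_trans h1; rewrite !exprMn; lra.
Qed.

Lemma Cap_ball_ge q : 1 <= q -> exists2 k, 0 < k &
  forall c t, 0 < t -> ((k * t `^ (n.+1%:R - q))%:E <=
    Cap q (eball c t) (annulus c (2 * t) (3 * t)) (eball c (4 * t)))%E.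
Proof.
move=> q1; have [k k0 Hk] := Cap_axial_ge q1.
(* The thickest tube that [Cap_axial_ge] allows: its condition on the width holds with equality. *)
pose d : R := (4 * n.+1%:R)^-1.
have d0 : 0 < d by rewrite invr_gt0 mulr_gt0.
exists (k * d ^+ n); first by rewrite mulr_gt0// exprn_gt0.
move=> c t t0; have := Hk setT c (d * t) t t0.
rewrite /ball_cap setTI; have -> : k * ((d * t) ^+ n * t `^ (1 - q)) =
    k * d ^+ n * t `^ (n.+1%:R - q).
  rewrite exprMn -!mulrA; congr (_ * (_ * _)).
  rewrite -powR_mulrn ?(ltW t0)// -powRD; last by apply/implyP => _; rewrite gt_eqF.
  by congr (_ `^ _); rewrite -natr1; ring.
apply=> //; first by rewrite mulr_gt0.
rewrite le_eqVlt; apply/orP; left; apply/eqP; rewrite /d.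
move: (ltr0Sn R n); move: n.+1%:R => N N0; field.
by rewrite gt_eqF.
Qed.

Lemma Cap_ball_le q : 0 < q -> exists2 k, 0 < k &
  forall c t, 0 < t ->
    (Cap q (eball c t) (annulus c (2 * t) (3 * t)) (eball c (4 * t)) <=
     (k * t `^ (n.+1%:R - q))%:E)%E.
Proof.
move=> q0; have [K K0 HK] := @derive1_smooth_step_bounded R.
(* The bound of [partial_cutoff_le] for radii t and 2t is C / t, because 2b/(b^2-a^2) = 4/(3t). *)
pose C := K * (4 / 3).
have C0 : 0 < C by rewrite mulr_gt0.
exists (n.+1%:R `^ q * (n.+1%:R * (C `^ q * 8 ^+ n.+1))).
  by rewrite !mulr_gt0 ?powR_gt0 ?exprn_gt0.
move=> c t t0.
have t20 : t < 2 * t by lra.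
have t22 : (2 * t) ^+ 2 - t ^+ 2 = 3 * t ^+ 2 by ring.
have [M HM] := @eball_sub_cube R n.+1 c (4 * t).
have C1 := @cutoff_C1 R n.+1 predT c t (2 * t).
have CL := Cap_le q0 (@eball_open _ _ c (4 * t)) HM C1.
apply: (le_trans (CL _ _ _ _)).
- move=> y /ltW yt; rewrite (cutoff1 (ltW t0) t20)// sqr_distT.
  by rewrite lerXn2r ?nnegrE ?enorm_ge0 ?(ltW t0).
- move=> y [_ /negP]; rewrite -leNgt => yt; rewrite (cutoff0 (ltW t0) t20)// sqr_distT.
  by rewrite lerXn2r ?nnegrE ?enorm_ge0 ?mulr_ge0 ?(ltW t0).
rewrite -!mulrA EFinM; apply: lee_wpmul2l; first by rewrite lee_fin powR_ge0.
have [_ _ cp] := C1.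
apply: (@le_trans _ _ (\sum_(i < n.+1) ((C / t) `^ q * (2 * (4 * t)) ^+ n.+1)%:E)%E).
  apply: lee_sum => i _; apply: ge0_integral_eball_le.
  - by rewrite mulr_ge0// ltW.
  - exact: powR_ge0.
  - apply: measurable_funTS.
    apply: (@measurableT_comp _ _ _ _ _ _ (@powR R ^~ q)) => //.
    by apply: measurableT_comp => //; exact: continuous_measurable_rV.
  move=> y _; rewrite powR_ge0/= ge0_ler_powR ?nnegrE ?(ltW q0)//.
    by rewrite divr_ge0 ?ltW.
  apply: le_trans (partial_cutoff_le predT c (ltW t0) t20 y i HK) _.
  rewrite t22 /C -[leRHS]mulrA ler_wpM2l ?(ltW K0)// le_eqVlt; apply/orP; left.
  by apply/eqP; field; rewrite gt_eqF.
rewrite sumEFin lee_fin sumr_const card_ord -[leLHS]mulr_natl ler_wpM2l//.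
rewrite le_eqVlt; apply/orP; left; apply/eqP.
rewrite powRM ?invr_ge0 ?(ltW C0) ?(ltW t0)// -mulrA; congr (_ * _).
rewrite mulrA (_ : 2 * 4 = 8); last by ring.
rewrite exprMn mulrCA; congr (_ * _).
rewrite powRB; last by apply/implyP => _; rewrite gt_eqF.
rewrite powR_mulrn ?(ltW t0)// mulrC; congr (_ * _).
by rewrite -(powR_inv1 (ltW t0)) -powRrM mulN1r powRN.
Qed.

End ball_capacity.

(** * The cusp *)

Section glue.
Context {R : realType}.
Implicit Types (f g : R -> R) (a d : R).

Lemma is_derive_cvg f a d : is_derive a 1 f d ->
  h^-1 * (f (h + a) - f a) @[h --> 0^'] --> d.
Proof.
move=> [df <-]; rewrite [X in X @ _ --> _](_ : _ =
    (fun h => h^-1 *: ((f \o shift a) (h *: 1) - f a))); first exact: df.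
by apply/funext => h /=; rewrite [_%:A]mulr1.
Qed.

(** Serves the junction at 1 of the two formulas defining [cusp]. *)
Lemma is_derive_glue f g a d : f a = g a ->
  is_derive a 1 f d -> is_derive a 1 g d ->
  is_derive a 1 (fun t => if t <= a then f t else g t) d.
Proof.
move=> fga /is_derive_cvg/cvgrPdist_le df /is_derive_cvg/cvgrPdist_le dg.
set w := fun t => _.
have H : h^-1 *: ((w \o shift a) (h *: 1) - w a) @[h --> 0^'] --> d.
  apply/cvgrPdist_le => e e0; near=> h.
  rewrite /= [_%:A]mulr1 /w lexx /GRing.scale/=.
  case: ifPn => _; first by near: h; exact: df.
  rewrite fga; near: h; exact: dg.
by apply: DeriveDef; [apply/cvg_ex; exists d|exact/cvg_lim].
Unshelve. all: by end_near. Qed.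

End glue.

Section cusp_function.
Context {R : realType}.
Variable gam : R.
Hypothesis gam0 : 0 < gam.
Implicit Types (s t : R).

(* On ]0, 1] the ratio w(t)/t is a negative power of 1 - ln t, which decays
   slowly enough for the cusp to be fat; beyond 1 the graph is a straight
   line. *)
Definition cusp t : R :=
  if t <= 1 then t * (1 - ln t) `^ (- gam) else 1 + (1 + gam) * (t - 1).

(** The derivative of [cusp] for t > 0. On ]0, 1] both summands increase and tend to 0 at 0; their
    value 1 + gam at 1 is the slope of the line, so that the two pieces of [cusp] match to first
    order. *)
Definition dcusp t : R :=
  if t <= 1 then (1 - ln t) `^ (- gam) + gam * (1 - ln t) `^ (- gam - 1)
  else 1 + gam.

(** [ln] takes the value 0 at nonpositive arguments, so the bound extends to t <= 0; this settles
    the values and the continuity of [cusp] at 0. *)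
Let log_ge1 t : t <= 1 -> 1 <= 1 - ln t.
Proof. by move=> t1; rewrite lerBrDr gerDl ln_le0. Qed.

Let log_gt0 t : t <= 1 -> 0 < 1 - ln t.
Proof. by move=> /log_ge1; exact: lt_le_trans. Qed.

Let pow_le1 t : t <= 1 -> (1 - ln t) `^ (- gam) <= 1.
Proof.
move=> t1; rewrite -[leRHS](powRr0 (1 - ln t)); apply: ler_powR.
  exact: log_ge1.
by rewrite oppr_le0 ltW.
Qed.

Let pow_gt0 t x : t <= 1 -> 0 < (1 - ln t) `^ x.
Proof. by move=> t1; rewrite powR_gt0// log_gt0. Qed.

Let pow_lt s t x : 0 < s -> s < t -> t <= 1 -> x < 0 ->
  (1 - ln s) `^ x < (1 - ln t) `^ x.
Proof.
move=> s0 st t1 x0; have s1 : s <= 1 := le_trans (ltW st) t1.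
rewrite -[x]opprK !(powRN _ (- x)) ltf_pV2 ?posrE ?powR_gt0 ?log_gt0//.
have /ltW L1 := log_gt0 t1; have /ltW L2 := log_gt0 s1.
apply: gt0_ltr_powR; rewrite ?oppr_gt0 ?nnegrE//.
by rewrite ltrD2l ltrN2 ltr_ln ?posrE// (lt_trans s0).
Qed.

Let pow_small e : 0 < e -> exists2 d, 0 < d & d <= 1 /\
  forall t, 0 < t -> t < d -> (1 - ln t) `^ (- gam) <= e.
Proof.
(* The exponential is the solution t of (1 - ln t)^(-gam) = e. *)
move=> e0; exists (Num.min 1 (expR (1 - e `^ (- gam^-1)))).
  by rewrite lt_min ltr01 expR_gt0.
split=> [|t t0]; first by rewrite ge_min lexx.
rewrite lt_min => /andP[t1 te].
have H : e `^ (- gam^-1) <= 1 - ln t.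
  have : ln t <= 1 - e `^ (- gam^-1).
    by rewrite -[leRHS]expRK ler_ln ?posrE ?expR_gt0// ltW.
  lra.
have eE : e = ((e `^ (- gam^-1)) `^ gam)^-1.
  rewrite -powRrM mulNr mulVf ?gt_eqF// powR_inv1 ?(ltW e0)// invrK//.
rewrite [leRHS]eE powRN lef_pV2 ?posrE ?powR_gt0 ?log_gt0 ?(ltW t1)//.
by apply: ge0_ler_powR; rewrite ?nnegrE ?powR_ge0 ?(ltW gam0)// ltW// log_gt0// ltW.
Qed.

Lemma cusp_le1E t : t <= 1 -> cusp t = t * (1 - ln t) `^ (- gam).
Proof. by rewrite /cusp => ->. Qed.

Lemma cusp_gt1E t : 1 < t -> cusp t = 1 + (1 + gam) * (t - 1).
Proof. by rewrite /cusp ltNge => /negbTE ->. Qed.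

Lemma cusp_eq1 : cusp 1 = 1.
Proof. by rewrite cusp_le1E// ln1 subr0 powR1 mulr1. Qed.

Lemma cusp_le t : 0 <= t <= 1 -> cusp t <= t.
Proof. by move=> /andP[t0 t1]; rewrite cusp_le1E// ler_piMr// pow_le1. Qed.

Lemma cusp_gt0 t : 0 < t -> 0 < cusp t.
Proof.
move=> t0; have [t1|t1] := leP t 1; first by rewrite cusp_le1E// mulr_gt0// pow_gt0.
by rewrite cusp_gt1E// addr_gt0// mulr_gt0 ?subr_gt0// addr_gt0.
Qed.

Lemma cusp_lt s t : 0 <= s -> s < t -> cusp s < cusp t.
Proof.
rewrite le_eqVlt => /predU1P[<- t0|s0 st].
  by rewrite (@cusp_le1E 0)// mul0r cusp_gt0.
have [t1|t1] := leP t 1.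
  have s1 := le_trans (ltW st) t1; rewrite !cusp_le1E//.
  apply: ltr_pM => //; rewrite ?powR_ge0 ?ltW//.
  by apply: pow_lt => //; rewrite oppr_lt0.
have [s1|s1] := leP s 1.
  apply: (@le_lt_trans _ _ 1); first by rewrite (le_trans (cusp_le _)) ?s1 ?ltW.
  by rewrite cusp_gt1E// ltrDl mulr_gt0 ?subr_gt0// addr_gt0.
by rewrite !cusp_gt1E// ltrD2l ltr_pM2l ?addr_gt0// ltrD2r.
Qed.

Lemma is_derive_cusp t : 0 < t -> is_derive t 1 cusp (dcusp t).
Proof.
move=> t0.
have d1 s : 0 < s -> s <= 1 -> is_derive s 1 (fun t => t * (1 - ln t) `^ (- gam))
    ((1 - ln s) `^ (- gam) + gam * (1 - ln s) `^ (- gam - 1)).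
  move=> s0 s1.
  have dl : is_derive s 1 (fun t : R => cst 1 t - ln t) (0 - s^-1).
    by apply: is_deriveB; exact: is_derive1_ln.
  have dp := @is_derive1_comp _ (fun x : R => x `^ (- gam)) (fun t : R => cst 1 t - ln t)
    s _ _ (@is_derive1_powR R (- gam) _ (log_gt0 s1)) dl.
  have dm : is_derive s 1 (fun t : R => t * (1 - ln t) `^ (- gam)) _ :=
    is_deriveM (is_derive_id s 1) dp.
  apply: (is_derive_eq dm); rewrite /GRing.scale/= sub0r.
  by move: (_ `^ _) (_ `^ _) => A B; field; rewrite gt_eqF.
have d2 s : is_derive s 1 (fun t => 1 + (1 + gam) * (t - 1)) (1 + gam).
  have H : is_derive s 1 (fun t => (1 + gam) * t + - gam) (1 + gam) :=
    is_derive_affine (1 + gam) (- gam) s.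
  rewrite (_ : (fun _ => _) = (fun t => (1 + gam) * t + - gam))//.
  by apply/funext => x; ring.
have [t1|t1|->] := ltgtP t 1.
- rewrite /dcusp (ltW t1); apply: (@near_eq_is_derive _ _ _
    (fun t => t * (1 - ln t) `^ (- gam)) cusp); last exact: d1 t0 (ltW t1).
  near=> s; rewrite cusp_le1E//; apply/ltW; near: s; exact: lt_nbhsl.
- rewrite /dcusp leNgt t1 /=; apply: (@near_eq_is_derive _ _ _
    (fun t => 1 + (1 + gam) * (t - 1)) cusp).
  near=> s; rewrite cusp_gt1E//; near: s; exact: lt_nbhsr.
- apply: is_derive_glue; first by rewrite ln1 subr0 powR1 subrr mulr0 mulr1 addr0.
    by rewrite /dcusp lexx; exact: d1.
  by rewrite /dcusp lexx ln1 subr0 !powR1 mulr1; exact: d2.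
Unshelve. all: by end_near. Qed.

Lemma cusp_small e : 0 < e -> exists2 d, 0 < d &
  forall t, 0 < t -> t < d -> t <= 1 /\ cusp t <= e * t.
Proof.
move=> /pow_small[d d0 [d1 Hd]]; exists d => // t t0 td.
have t1 := le_trans (ltW td) d1; split => //.
by rewrite cusp_le1E// mulrC ler_wpM2r ?(ltW t0)// Hd.
Qed.

Let log2_le1 : ln (2 : R) <= 1.
Proof.
by have := @le_ln1Dx R 1 _; rewrite (_ : 1 + 1 = 2); [apply; lra|lra].
Qed.

Let pow2_ge1 : 1 <= 2 `^ gam.
Proof.
by rewrite -[leLHS](powRr0 2) ler_powR ?ler1n// ltW.
Qed.

Let pow_half s t : s <= 1 -> t <= 1 -> 1 - ln t <= 2 * (1 - ln s) ->
  (1 - ln s) `^ (- gam) <= 2 `^ gam * (1 - ln t) `^ (- gam).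
Proof.
move=> s1 t1 H; rewrite !powRN ler_pdivlMr ?powR_gt0 ?log_gt0//.
rewrite mulrC ler_pdivrMr ?powR_gt0 ?log_gt0//.
rewrite -powRM//; last exact/ltW/log_gt0.
apply: ge0_ler_powR; rewrite ?nnegrE ?(ltW gam0)//; first exact/ltW/log_gt0.
by rewrite mulr_ge0//; exact/ltW/log_gt0.
Qed.

(** Since ln 2 <= 1, doubling [t] at most halves 1 - ln t, which costs 2^gam; the factor 2 (1 + gam)
    covers the linear growth beyond 1. The mixed case t <= 1 < 2t uses both. *)
Lemma cusp_double t : 0 < t ->
  cusp (2 * t) <= 2 `^ gam * (2 * (1 + gam)) * cusp t.
Proof.
move=> t0; have t20 : 0 < 2 * t by rewrite mulr_gt0.
have g0 := gam0; have p0 : 0 <= 2 `^ gam by exact: powR_ge0.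
have [t1|t1] := leP (2 * t) 1.
  have t1' : t <= 1 by lra.
  rewrite !cusp_le1E//.
  have ln2t : ln (2 * t) = ln 2 + ln t by rewrite lnM ?posrE.
  have : (1 - ln (2 * t)) `^ (- gam) <= 2 `^ gam * (1 - ln t) `^ (- gam).
    apply: pow_half => //; have := log_ge1 t1; have := log2_le1.
    by rewrite ln2t; lra.
  move=> /(ler_wpM2l (ltW t20)) /le_trans; apply.
  rewrite (_ : 2 `^ gam * _ * _ = (1 + gam) * (2 * t * (2 `^ gam * (1 - ln t) `^ (- gam)))).
    apply: ler_peMl; last by rewrite lerDl ltW.
    by rewrite !mulr_ge0 ?(ltW t0) ?powR_ge0.
  by ring.
rewrite (cusp_gt1E t1); apply: (@le_trans _ _ ((2 * (1 + gam)) * t)).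
  by lra.
rewrite (mulrC (2 `^ gam)) -[leRHS]mulrA; apply: ler_wpM2l.
  by rewrite mulr_ge0// addr_ge0// ltW.
have [t1'|t1'] := leP t 1; last first.
  apply: (@le_trans _ _ (cusp t)); last first.
    by rewrite ler_peMl// ltW// cusp_gt0.
  rewrite cusp_gt1E//.
  have : 0 <= gam * (t - 1) by rewrite mulr_ge0 ?subr_ge0// ltW.
  lra.
rewrite cusp_le1E// mulrCA -[leLHS]mulr1 ler_wpM2l ?(ltW t0)//.
have := @pow_half 1 t; rewrite ln1 subr0 powR1 mulr1; apply => //.
have : ln (2 * t) = ln 2 + ln t by rewrite lnM ?posrE.
have := ln_ge0 (ltW t1); have := log2_le1; lra.
Qed.

Lemma doubling_cusp_function_cusp : doubling_cusp_function cusp.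
Proof.
split.
- by move=> t; rewrite le_eqVlt => /predU1P[<-|/cusp_gt0/ltW//]; rewrite cusp_le1E// mul0r.
- apply: continuous_in_subspaceT => t; rewrite inE/= in_itv/= andbT le_eqVlt.
  move=> /predU1P[<-|t0]; last first.
    apply: differentiable_continuous; apply/derivable1_diffP.
    by have [] := is_derive_cusp t0.
  apply/cvgrPdist_le => e e0; near=> s.
  rewrite (@cusp_le1E 0)// mul0r sub0r normrN.
  have s1 : s <= 1 by apply/ltW; near: s; exact: lt_nbhsl.
  rewrite cusp_le1E// normrM (ger0_norm (powR_ge0 _ _)).
  apply: le_trans (ler_piMr (normr_ge0 _) (pow_le1 s1)) _.
  near: s; apply/nbhs_ballP; exists e => //= y.
  by rewrite /ball/= sub0r normrN => /ltW.
- move=> s t; rewrite !in_itv/= !andbT => s0 _; exact: cusp_lt.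
- by move=> t t0; have [] := is_derive_cusp t0.
- apply/cvg_ex; exists 0; apply/cvgrPdist_le => e e0.
  have [d d0 [d1 Hd]] := pow_small e0; near=> h.
  have h0 : 0 < h by near: h; exact: nbhs_right_gt.
  have hd : h < d by near: h; exact: nbhs_right_lt.
  have h1 := le_trans (ltW hd) d1.
  rewrite (@cusp_le1E 0)// mul0r subr0 cusp_le1E// mulKf ?gt_eqF// sub0r normrN.
  by rewrite ger0_norm ?powR_ge0// Hd.
- by rewrite cusp_le1E// mul0r.
- exact: cusp_eq1.
- exists (2 `^ gam * (2 * (1 + gam))) => t t0.
  exact: cusp_double.
- move=> s t; rewrite !in_itv/= => /andP[s0 s1] /andP[t0 t1] st.
  have -> : derive1 cusp s = dcusp s by rewrite derive1E; have [_] := is_derive_cusp s0.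
  have -> : derive1 cusp t = dcusp t by rewrite derive1E; have [_] := is_derive_cusp t0.
  rewrite /dcusp (ltW s1) (ltW t1) ltrD//.
    by apply: pow_lt => //; [exact: ltW|rewrite oppr_lt0].
  have g0 := gam0.
  by rewrite ltr_pM2l// pow_lt//; [exact: ltW|lra].
- apply/cvgrPdist_le => e e0.
  have e1 : 0 < e / (1 + gam) by rewrite divr_gt0// addr_gt0.
  have [d d0 [d1 Hd]] := pow_small e1; near=> h.
  have h0 : 0 < h by near: h; exact: nbhs_right_gt.
  have hd : h < d by near: h; exact: nbhs_right_lt.
  have h1 := le_trans (ltW hd) d1.
  have -> : derive1 cusp h = dcusp h by rewrite derive1E; have [_] := is_derive_cusp h0.
  rewrite /dcusp h1 sub0r normrN ger0_norm; last first.
    by rewrite addr_ge0 ?mulr_ge0 ?powR_ge0 ?(ltW gam0).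
  have H1 := Hd h h0 hd.
  have H2 : (1 - ln h) `^ (- gam - 1) <= (1 - ln h) `^ (- gam).
    by apply: ler_powR; [exact: log_ge1|rewrite gerDl lerN10].
  apply: (@le_trans _ _ ((1 + gam) * (1 - ln h) `^ (- gam))).
    by rewrite mulrDl mul1r lerD2l ler_wpM2l// ltW.
  by rewrite mulrC -ler_pdivlMr// addr_gt0.
Unshelve. all: by end_near. Qed.

End cusp_function.

(** * Lower bounds for integrals and comparison of quotients *)

Section integral_lower_bound.
Context d (T : measurableType d) {R : realType}.
Variable mu : {measure set T -> \bar R}.

(** The integral of a nonnegative function is a supremum over simple functions below it, hence
    monotone for arbitrary functions. This matters for the capacity quotient as a function of the
    radius. *)
Lemma ge0_le_integral_nonmeasurable (D : set T) (f g : T -> \bar R) :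
  (forall x, D x -> (0 <= f x)%E) -> (forall x, D x -> (f x <= g x)%E) ->
  (\int[mu]_(x in D) f x <= \int[mu]_(x in D) g x)%E.
Proof.
move=> f0 fg; have g0 x : D x -> (0 <= g x)%E.
  by move=> Dx; exact: le_trans (f0 x Dx) (fg x Dx).
rewrite !ge0_integralE//; apply: ereal_sup_le => _ [h hf <-]; exists h => // x.
exact: le_trans (hf x) (lee_restrict fg x).
Qed.

End integral_lower_bound.

Section disjoint_intervals.
Context {R : realType}.
Local Notation mu := (@lebesgue_measure R).

(** Common to the divergence of the integral for the cusp and to the contradiction from bad radii.
    The intervals run towards 0, and a step function supported on the first [M] of them lies below
    [f]. *)
Lemma integral_ge_disjoint_itv (f : R -> \bar R) (a b c : nat -> R) (M : nat) :
  (forall t, 0 < t < 1 -> (0 <= f t)%E) ->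
  (forall k, 0 <= a k < b k) -> (forall k, b k <= 1) -> (forall k, 0 <= c k) ->
  (forall j k, (j < k)%N -> b k <= a j) ->
  (forall k t, a k < t < b k -> ((c k)%:E <= f t)%E) ->
  ((\sum_(k < M) c k * (b k - a k))%:E <= \int[mu]_(t in `]0%R, 1%R[) f t)%E.
Proof.
move=> f0 ab b1 c0 dis Hc.
pose g t := \sum_(k < M) c k * \1_(`]a k, b k[%classic) t.
apply: (@le_trans _ _ (\int[mu]_(t in `]0%R, 1%R[) (g t)%:E)%E); last first.
  apply: ge0_le_integral_nonmeasurable => t.
    by move=> _; rewrite lee_fin sumr_ge0// => k _; rewrite mulr_ge0.
  rewrite /= in_itv/= => t01; rewrite /g.
  have [[k0 tk0]|H] := pselect (exists k : 'I_M, a k < t < b k); last first.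
    rewrite big1 ?f0// => k _; rewrite indicE memNset ?mulr0//= in_itv/= => tk.
    by apply: H; exists k.
  rewrite (bigD1 k0)//= big1 => [|j jk0]; last first.
    rewrite indicE memNset ?mulr0//= in_itv/= => /andP[t1 t2].
    move/andP : tk0 => [t3 t4]; move: jk0.
    rewrite -(inj_eq val_inj) neq_ltn => /orP[/dis|/dis] H; lra.
  by rewrite addr0 indicE mem_set/= ?mulr1 ?Hc// in_itv/=.
rewrite ge0_integral_sum_real//; last 2 first.
- by move=> k; apply: measurable_funM => //; exact: measurable_funTS.
- by move=> k t _; rewrite mulr_ge0.
rewrite -sumEFin le_eqVlt; apply/orP; left; apply/eqP; apply: eq_bigr => k _.
rewrite integral_indicZl// EFinM; congr (_ * _)%E.
rewrite setIidl.
  apply/esym; apply: etrans (lebesgue_measure_itv _) _.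
  by rewrite /= lte_fin; have /andP[_ ->] := ab k.
move=> t /=; rewrite !in_itv/= => /andP[t1 t2].
by have /andP[a0 _] := ab k; have bk := b1 k; lra.
Qed.

Lemma harmonic_unbounded (c B : R) : 0 < c ->
  (forall M, \sum_(k < M) c / (k%:R + 4) <= B) -> False.
Proof.
move=> c0 HB; apply: (@dvg_harmonic R).
apply: nondecreasing_is_cvgn.
  apply: nondecreasing_series => n _ _; exact: harmonic_ge0.
exists (4 / c * B) => _ [M _ <-] /=; rewrite /series/= big_mkord.
apply: (@le_trans _ _ (4 / c * \sum_(k < M) c / (k%:R + 4))); last first.
  by rewrite ler_wpM2l ?HB// divr_ge0// ltW.
rewrite mulr_sumr; apply: ler_sum => k _.
rewrite mulrA divfK ?gt_eqF// /harmonic/= -natr1.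
have k0 : 0 <= k%:R :> R by [].
rewrite ler_pdivlMr; last lra.
by rewrite mulrC ler_pdivrMr; lra.
Qed.

End disjoint_intervals.

Section extended_ratio.
Context {R : realType}.
Implicit Types (a b : R) (x y : \bar R).
Local Open Scope ereal_scope.

(** The case y = 0 is included: the inverse of 0 in [\bar R] is +oo. *)
Lemma lee_pdiv a b x y : (0 <= a)%R -> (0 < b)%R ->
  a%:E <= x -> 0 <= y -> y <= b%:E -> (a / b)%:E <= x / y.
Proof.
move=> a0 b0 ax y0 yb; have x0 : 0 <= x by rewrite (le_trans _ ax)// lee_fin.
rewrite EFinM; apply: lee_pmul => //.
  by rewrite lee_fin invr_ge0 ltW.
case: y y0 yb => [y||]//; rewrite !lee_fin => y0 yb.
rewrite inver; case: eqP => [|/eqP yn0]; first by rewrite leey.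
by rewrite lee_fin lef_pV2 ?posrE// lt_def yn0.
Qed.

Lemma lee_pdivr a b x y : (0 <= a)%R -> (0 < b)%R ->
  0 <= x -> x <= a%:E -> b%:E <= y -> x / y <= (a / b)%:E.
Proof.
move=> a0 b0 x0 xa by_; rewrite EFinM; apply: lee_pmul => //.
  by rewrite inve_ge0 (le_trans _ by_)// lee_fin ltW.
case: y by_ => [y|_|]; last by rewrite leeNy_eq.
  rewrite lee_fin => by_; have y0 := lt_le_trans b0 by_.
  by rewrite inver gt_eqF// lee_fin lef_pV2 ?posrE.
by rewrite invey lee_fin invr_ge0 ltW.
Qed.

End extended_ratio.

Section capacity_order.
Context {R : realType} {n : nat}.
Implicit Types (E F G : set 'rV[R]_n) (q : R).
Local Open Scope ereal_scope.

Lemma Cap_ge0 q E F G : 0 <= Cap q E F G.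
Proof.
apply: le_ereal_inf_tmp => _ [u [g [_ _ ->]]].
by apply: integral_ge0 => x _; rewrite lee_fin powR_ge0.
Qed.

End capacity_order.

(** * Fatness of the cusp *)

Section cusp_fat.
Context {R : realType} {n : nat}.
Hypothesis n2 : (2 <= n)%N.
Variable q : R.
Hypothesis q1 : 1 < q.

Let gam : R := (q - 1) / n%:R.

Let n0 : 0 < n%:R :> R.
Proof. by rewrite ltr0n (leq_trans _ n2). Qed.

Let gam0 : 0 < gam.
Proof. by rewrite divr_gt0 ?subr_gt0. Qed.

Lemma cons_rV_ord0 (t : R) (x : 'rV[R]_n) : cons_rV t x ord0 ord0 = t.
Proof. exact: (@consp_rV_ord0 _ _ (t, x)). Qed.

Lemma cons_rV_lift (t : R) (x : 'rV[R]_n) i :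
  cons_rV t x ord0 (lift ord0 i) = x ord0 i.
Proof. exact: (@consp_rV_lift _ _ (t, x)). Qed.

Lemma cons_rV_eta (y : 'rV[R]_n.+1) :
  y = cons_rV (y ord0 ord0) (\row_i y ord0 (lift ord0 i)).
Proof.
apply/rowP => j; have [i ->|->] := unliftP ord0 j.
  by rewrite cons_rV_lift mxE.
by rewrite cons_rV_ord0.
Qed.

(** The cusp widens with height, so only its cross-section at the bottom t/4 of the tube matters; a
    cube of half-side r lies in the closed Euclidean ball of radius n r. *)
Lemma tube_sub_cusp t r : 0 < t < 1 -> n%:R * r < cusp gam (t / 4) ->
  tube 0 r (t / 4) (t / 2) `<=` outward_cusp n (cusp gam).
Proof.
move=> /andP[t0 t1] rt y /tubeP[]; rewrite mxE subr0 => /andP[y1 y2] yr; left.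
exists (y ord0 ord0), (\row_i y ord0 (lift ord0 i)); split.
- exact: cons_rV_eta.
- by apply/andP; split; lra.
apply: le_lt_trans (enorm_le_sum _) _.
apply: (@le_lt_trans _ _ (n%:R * r)).
  rewrite mulr_natl -[n in X in _ <= X](card_ord n) -sumr_const.
  by apply: ler_sum => i _; have := yr i; rewrite !mxE subr0.
apply: lt_le_trans rt _; move: y1; rewrite le_eqVlt => /predU1P[->//|y1].
by apply/ltW/cusp_lt => //; lra.
Qed.

Lemma cusp_fat : fat q (outward_cusp n (cusp gam)) 0.
Proof.
rewrite /fat /thin gt_eqF// => H.
have [k k0 Hk] := @Cap_axial_ge R n q (ltW q1).
have [k' k'0 Hk'] := @Cap_ball_le R n q (lt_trans ltr01 q1).
pose f (t : R) : \bar R := ((ball_cap q (outward_cusp n (cusp gam)) 0 t /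
  Cap q (eball (0 : 'rV[R]_n.+1) t) (annulus 0 (2 * t) (3 * t)) (eball 0 (4 * t)))
    `^ (q - 1)^-1 * (t^-1)%:E)%E.
have {}H : (\int[lebesgue_measure]_(t in `]0%R, 1%R[) f t < +oo)%E := H.
(* The tube at scale t has r = w(t/4) / (2 (n+1)), half of what the cusp permits; since w(t/4)
   carries a factor t/4, this is t (1 - ln (t/4))^(-gam) / N. *)
pose N : R := 8 * n.+1%:R.
have N0 : 0 < N by rewrite mulr_gt0.
pose K := (k / k' * N^-1 ^+ n) `^ (q - 1)^-1.
have K0 : 0 < K by rewrite powR_gt0// !mulr_gt0 ?exprn_gt0 ?invr_gt0.
have fge t : 0 < t < 1 -> ((K / (1 - ln (t / 4)) * t^-1)%:E <= f t)%E.
  move=> t01; have /andP[t0 t1] := t01.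
  have t40 : 0 < t / 4 by rewrite divr_gt0.
  have t41 : t / 4 <= 1 by lra.
  have w0 := cusp_gt0 gam0 t40.
  have w1 : cusp gam (t / 4) <= t / 4 by apply: cusp_le => //; rewrite (ltW t40).
  pose r := cusp gam (t / 4) / (2 * n.+1%:R).
  have r0 : 0 < r by rewrite divr_gt0// mulr_gt0.
  have nr : n.+1%:R * r = cusp gam (t / 4) / 2.
    rewrite /r; move: (ltr0Sn R n); move: n.+1%:R => m m0; field.
    by rewrite gt_eqF.
  have L0 : 0 < 1 - ln (t / 4).
    by rewrite subr_gt0 (le_lt_trans (ln_le0 t41)).
  have TE : tube 0 r (t / 4) (t / 2) `<=` outward_cusp n (cusp gam).
    apply: tube_sub_cusp => //; apply: (@lt_trans _ _ (n.+1%:R * r)).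
      by rewrite ltr_pM2r// ltr_nat.
    by rewrite nr; lra.
  have rt : n.+1%:R * r <= t / 4 by rewrite nr; lra.
  have H1 := Hk _ _ _ _ t0 r0 rt TE.
  have H2 := Hk' 0 t t0.
  have tq0 : 0 < t `^ (n.+1%:R - q) by rewrite powR_gt0.
  have rat : ((k * (r ^+ n * t `^ (1 - q))) / (k' * t `^ (n.+1%:R - q)) =
      k / k' * N^-1 ^+ n * (1 - ln (t / 4)) `^ (- (q - 1))).
    have rE : r = N^-1 * (t * (1 - ln (t / 4)) `^ (- gam)).
      rewrite /r cusp_le1E// /N; move: (ltr0Sn R n); move: n.+1%:R => m m0; field.
      by rewrite gt_eqF.
    (* This identity is the reason for the value of [gam]: the n-th power of the tube radius gives
       exponent -(q-1), which the power 1/(q-1) in the definition of thinness turns into -1. *)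
    have -> : - (q - 1) = - gam * n%:R.
      by rewrite mulNr /gam divfK// gt_eqF.
    rewrite powRrM (powR_mulrn _ (powR_ge0 _ _)) rE.
    have -> : t `^ (n.+1%:R - q) = t ^+ n * t `^ (1 - q).
      rewrite -powR_mulrn ?(ltW t0)// -powRD; last by apply/implyP => _; rewrite gt_eqF.
      by congr (_ `^ _); rewrite -natr1; ring.
    have := powR_gt0 (1 - q) t0; move: (t `^ (1 - q)) => Q Q0.
    rewrite !exprMn; move: (_ `^ _ ^+ n) (N^-1 ^+ n) => A B.
    have : 0 < t ^+ n by rewrite exprn_gt0.
    by move: (t ^+ n) => D D0; field; rewrite !gt_eqF.
  rewrite /f EFinM; apply: lee_pmul => //.
  - by rewrite lee_fin divr_ge0// ltW.
  - by rewrite lee_fin invr_ge0 ltW.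
  apply: (@le_trans _ _ ((((k * (r ^+ n * t `^ (1 - q))) / (k' * t `^ (n.+1%:R - q)))%:E) `^ (q - 1)^-1)%E); last first.
    apply: gt0_ler_poweR.
    - by rewrite invr_ge0 subr_ge0 ltW.
    - by rewrite in_itv/= leey andbT lee_fin divr_ge0// ?mulr_ge0 ?exprn_ge0 ?powR_ge0// ltW.
    - rewrite in_itv/= leey andbT; apply: mule_ge0; first exact: Cap_ge0.
      by rewrite inve_ge0 Cap_ge0.
    apply: lee_pdiv; rewrite ?Cap_ge0//.
    - by rewrite !mulr_ge0 ?exprn_ge0 ?powR_ge0// ltW.
    - by rewrite mulr_gt0.
  rewrite poweR_EFin lee_fin rat powRM ?powR_ge0//; last first.
    by rewrite !mulr_ge0 ?exprn_ge0 ?invr_ge0// ltW.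
  rewrite -powRrM mulNr divff ?subr_eq0 ?gt_eqF//.
  by rewrite powR_inv1// ltW.
have If : (0 <= \int[lebesgue_measure]_(t in `]0%R, 1%R[) f t)%E.
  apply: integral_ge0 => t; rewrite /= in_itv/= => /andP[t0 _].
  by rewrite mule_ge0 ?poweR_ge0// lee_fin invr_ge0 ltW.
have If' := ge0_fin_numE If; rewrite H in If'.
apply: (@harmonic_unbounded R (K / 2) (fine (\int[lebesgue_measure]_(t in `]0%R, 1%R[) f t)%E)).
  by rewrite divr_gt0.
move=> M; rewrite -lee_fin fineK//.
(* On ]2^-(j+1), 2^-j[ one has ln t >= -(j+1), and ln 4 <= 2, so 1 - ln (t/4) <= j + 4. The interval
   contributes at least (K/2)/(j+4), a divergent series. *)
pose p (k : nat) : R := 2^-1 ^+ k.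
have p0 j : 0 < p j by rewrite exprn_gt0.
have pS j : p j.+1 = 2^-1 * p j by rewrite /p exprS.
have ln2 : ln (2 : R) <= 1.
  by have := @le_ln1Dx R 1 _; rewrite (_ : 1 + 1 = 2); [apply; lra|lra].
have H1 := @integral_ge_disjoint_itv R f (fun j => p j.+1) p
  (fun j => K / (j%:R + 4) * (p j)^-1) M.
apply: le_trans (H1 _ _ _ _ _ _).
- rewrite lee_fin le_eqVlt; apply/orP; left; apply/eqP; apply: eq_bigr => j _.
  have j0 : 0 <= j%:R :> R by [].
  rewrite pS; have := p0 j; move: (p j) => P P0; field.
  by rewrite !gt_eqF//; lra.
- move=> t /andP[t0 _]; apply: mule_ge0; first exact: poweR_ge0.
  by rewrite lee_fin invr_ge0 ltW.
- by move=> j; rewrite pS; have := p0 j; lra.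
- by move=> j; rewrite /p exprn_ile1// ?invr_ge0// invf_le1// ler1n.
- move=> j; have j0 : 0 <= j%:R :> R by [].
  by rewrite mulr_ge0 ?invr_ge0 ?(ltW (p0 _))// divr_ge0 ?(ltW K0)//; lra.
- move=> j m jm; rewrite /p; by apply: ler_wiXn2l => //; lra.
move=> j t /andP[t1 t2]; have tp := lt_trans (p0 _) t1.
have j0 : 0 <= j%:R :> R by [].
have pj1 : p j <= 1 by rewrite /p exprn_ile1// ?invr_ge0// invf_le1// ler1n.
have t1' : t < 1 by exact: lt_le_trans t2 pj1.
apply: le_trans (fge t _); last by rewrite tp.
have L4 : ln (t / 4) = ln t - 2 * ln 2.
  rewrite ln_div ?posrE// (_ : 4 = 2 * 2); last by ring.
  by rewrite lnM ?posrE//; ring.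
have Lt : - (j%:R + 1) <= ln t.
  have : ln (p j.+1) <= ln t by rewrite ler_ln ?posrE// ltW.
  apply: le_trans; rewrite /p lnXn ?invr_gt0// lnV ?posrE//.
  rewrite -[leRHS]mulr_natl -natr1 mulrN lerN2 -[leRHS]mulr1.
  by rewrite ler_wpM2l// addr_ge0.
have L0 : 0 < 1 - ln (t / 4).
  by rewrite subr_gt0 (@le_lt_trans _ _ 0)// ln_le0//; lra.
rewrite lee_fin ler_pM ?invr_ge0 ?(ltW (p0 _)) ?divr_ge0 ?(ltW K0)//.
- by rewrite ler_wpM2l ?(ltW K0)// lef_pV2 ?posrE//; lra.
- by rewrite lef_pV2 ?posrE// ltW.
Qed.

End cusp_fat.

(** * Failure of capacitory density for the cusp *)

Section not_dense_criterion.
Context {R : realType} {n : nat}.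
Implicit Types (E : set 'rV[R]_n.+1) (z : 'rV[R]_n.+1).

(** The numerator in capacitory density at radius r = 4t. In this scaling its denominator is the
    capacity of balls already estimated, and only the second set distinguishes it from
    [ball_cap]. *)
Definition self_cap (q : R) E z t : \bar R :=
  Cap q (E `&` eball z t) (E `&` annulus z (2 * t) (3 * t)) (eball z (4 * t)).

Lemma not_capacitory_dense (q : R) E z : 1 <= q ->
  (forall e : R, 0 < e -> exists2 d : R, 0 < d & forall t, 0 < t -> t < d ->
     (self_cap q E z t <= (e * t `^ (n.+1%:R - q))%:E)%E) ->
  ~ capacitory_dense q E z.
Proof.
move=> q1 H; rewrite /capacitory_dense; apply/negP; rewrite -leNgt.
have [k k0 Hk] := @Cap_ball_ge R n q q1.
apply/lee_addgt0Pr => e e0; rewrite add0e.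
have [d d0 Hd] := H (k * e) (mulr_gt0 k0 e0).
apply: ge_ereal_inf; eexists.
  exists [set r | 0 < r < 4 * d]; last reflexivity.
  near=> r; apply/andP; split; near: r; first exact: nbhs_right_gt.
  by apply: nbhs_right_lt; rewrite mulr_gt0.
apply: ge_ereal_sup => _ [r /andP[r0 rd] <-].
pose t := r / 4; have t0 : 0 < t by rewrite divr_gt0.
have td : t < d by rewrite /t; lra.
have -> : r / 2 = 2 * t by rewrite /t; lra.
have -> : 3 * r / 4 = 3 * t by rewrite /t; lra.
have -> : r = 4 * t by rewrite /t; lra.
have -> : 4 * t / 4 = t by lra.
have tq : 0 < t `^ (n.+1%:R - q) by rewrite powR_gt0.
rewrite (_ : e = (k * e * t `^ (n.+1%:R - q)) / (k * t `^ (n.+1%:R - q))); last first.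
  by move: tq; move: (t `^ _) => Q Q0; field; rewrite !gt_eqF.
apply: lee_pdivr.
- by rewrite !mulr_ge0// ltW.
- by rewrite mulr_gt0.
- exact: Cap_ge0.
- exact: Hd.
- exact: Hk.
Unshelve. all: by end_near. Qed.

End not_dense_criterion.

Section disjoint_sum.
Context {R : realType}.

Lemma powR_sum_disjoint (q : R) (I : finType) (a : I -> R) : 0 < q ->
  (forall j k, a j != 0 -> a k != 0 -> j = k) ->
  `|\sum_j a j| `^ q <= \sum_j `|a j| `^ q.
Proof.
move=> q0 H; have [[j aj]|A0] := pselect (exists j, a j != 0); last first.
  rewrite big1 ?normr0 ?powR0 ?gt_eqF// => [|j _].
    by apply: sumr_ge0 => j _; exact: powR_ge0.
  by apply: contrapT => /eqP aj; apply: A0; exists j.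
have E k : k != j -> a k = 0.
  by move=> kj; apply: contrapT => /eqP ak; move: kj; rewrite (H k j)// eqxx.
rewrite (bigD1 j)//= big1 ?addr0; last by move=> k /E.
by rewrite [leRHS](bigD1 j)//= lerDl sumr_ge0// => k _; exact: powR_ge0.
Qed.

End disjoint_sum.

Section cusp_competitor.
Context {R : realType} {n : nat}.
Local Notation mu := (lebesgue_rV R n.+1).
Local Notation radial := (predC1 (ord0 : 'I_n.+1)).
Variables (M : nat) (W t : R).
Hypotheses (M0 : (0 < M)%N) (W0 : 0 < W) (t0 : 0 < t).
Implicit Types (y : 'rV[R]_n.+1).

Let a (j : nat) : R := 2 ^+ j * W.

Let a0 j : 0 < a j. Proof. by rewrite mulr_gt0// exprn_gt0. Qed.

Let aS j : a j.+1 = 2 * a j. Proof. by rewrite /a exprS mulrA. Qed.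

Let aa j : a j < a j.+1. Proof. by rewrite aS ltr_pMl// ltr1n. Qed.

Let a_le j k : (j <= k)%N -> a j <= a k.
Proof. by move=> jk; rewrite ler_pM2r// ler_weXn2l// ler1n. Qed.

Let chi j : 'rV[R]_n.+1 -> R := cutoff radial 0 (a j) (a j.+1).

(** Equal to 1 at heights up to t and to 0 from 3t/2 on. *)
Let axial y : R := smooth_step (- (2 / t) * coord_rV ord0 y + 3).

(* Averaging M cutoffs at dyadic scales mimics a logarithmic cutoff: their
   gradients have disjoint supports and comparable conformal energies. *)
Definition cusp_competitor y : R :=
  axial y * (M%:R^-1 * \sum_(j < M) chi j y).

Let axial_C1 : continuously_differentiable axial.
Proof.
apply: (continuously_differentiable_comp smooth_smooth_step).
apply: continuously_differentiableD (continuously_differentiable_cst _).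
apply: (continuously_differentiableM (continuously_differentiable_cst _)).
exact: continuously_differentiable_coord.
Qed.

Let chi_C1 j : continuously_differentiable (chi j).
Proof. exact: cutoff_C1. Qed.

Let avg_C1 : continuously_differentiable (fun y => M%:R^-1 * \sum_(j < M) chi j y).
Proof.
apply: (continuously_differentiableM (continuously_differentiable_cst _)).
by apply: continuously_differentiable_sum => j _; exact: chi_C1.
Qed.

Let partial_avg i y : partial i (fun y => M%:R^-1 * \sum_(j < M) chi j y) y =
  M%:R^-1 * \sum_(j < M) partial i (chi j) y.
Proof.
have [_ ds _] := @continuously_differentiable_sum R n.+1 _ (index_enum _) xpredT
  (fun j : 'I_M => chi j) (fun j _ => chi_C1 j).
have dc : derivable (cst M%:R^-1 : 'rV[R]_n.+1 -> R) y (delta_mx ord0 i).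
  exact: derivable_cst.
apply: etrans (partialM dc (ds y i)) _.
rewrite [partial i (cst _) y]derive_cst mulr0 addr0; congr (_ * _).
exact: (@partial_sum R n.+1 _ (index_enum _) xpredT (fun j : 'I_M => chi j) y i
  (fun j _ => chi_C1 j)).
Qed.

Lemma cusp_competitor_C1 : continuously_differentiable cusp_competitor.
Proof. exact: continuously_differentiableM axial_C1 avg_C1. Qed.

Let partial_axial i y : partial i axial y =
  derive1 smooth_step (- (2 / t) * coord_rV ord0 y + 3) * (- (2 / t) * (i == ord0)%:R).
Proof.
have d1 := is_derive_coord y i ord0.
have d2 : is_derive y (delta_mx ord0 i) (fun y => - (2 / t) * coord_rV ord0 y + 3)
    (- (2 / t) * (i == ord0)%:R).
  apply: (@is_derive_comp_real _ _ (fun s => - (2 / t) * s + 3) _ _ _ _ _ _ d1).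
  exact: is_derive_affine.
have ds : is_derive (- (2 / t) * coord_rV ord0 y + 3) 1 smooth_step
    (derive1 smooth_step (- (2 / t) * coord_rV ord0 y + 3)).
  by rewrite derive1E; apply: derivableP; exact: smooth_real_derivable smooth_smooth_step.
exact: (@derive_val _ _ _ _ _ _ _ (is_derive_comp_real ds d2)).
Qed.

Let axial_itv y : 0 <= axial y <= 1.
Proof. exact: smooth_step_itv. Qed.

Let avg_itv y : 0 <= M%:R^-1 * \sum_(j < M) chi j y <= 1.
Proof.
have M1 : 0 < M%:R :> R by rewrite ltr0n.
rewrite mulr_ge0 ?invr_ge0 ?sumr_ge0//=; last first.
  by move=> j _; have /andP[] := cutoff_itv radial 0 (a j) (a j.+1) y.
rewrite ler_pdivrMl// mulr1 -[M in X in _ <= X]card_ord -sumr_const.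
by apply: ler_sum => j _; have /andP[] := cutoff_itv radial 0 (a j) (a j.+1) y.
Qed.

Lemma cusp_competitor1 y : y ord0 ord0 <= t -> sqr_dist radial 0 y <= W ^+ 2 ->
  cusp_competitor y = 1.
Proof.
move=> yt yW; have t0' := t0; rewrite /cusp_competitor /axial smooth_step_ge1; last first.
  have : 2 / t * y ord0 ord0 <= 2 by rewrite mulrAC ler_pdivrMr//; lra.
  by rewrite /coord_rV mulNr; lra.
rewrite mul1r (eq_bigr (fun=> 1)) => [|j _].
  by rewrite sumr_const card_ord mulVf// pnatr_eq0 -lt0n.
rewrite /chi (cutoff1 (ltW (a0 _)) (aa _))//; apply: (le_trans yW).
rewrite lerXn2r ?nnegrE ?(ltW W0) ?(ltW (a0 _))//.
by have := a_le (leq0n j); rewrite {1}/a expr0 mul1r.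
Qed.

Lemma cusp_competitor0 y : 3 * t / 2 <= y ord0 ord0 -> cusp_competitor y = 0.
Proof.
move=> yt; have t0' := t0; rewrite /cusp_competitor /axial smooth_step_le0 ?mul0r//.
have : 3 <= 2 / t * y ord0 ord0 by rewrite mulrAC ler_pdivlMr//; lra.
by rewrite /coord_rV mulNr; lra.
Qed.

Let in_tube (b : R) y : 0 < b -> eball 0 (4 * t) y ->
  sqr_dist radial 0 y < b ^+ 2 -> tube 0 b (- (4 * t)) (4 * t) y.
Proof.
move=> b0; rewrite /eball/= subr0 => yt yb; apply/tubeP; split.
  have := le_trans (coord_le_enorm y ord0) (ltW yt).
  by rewrite ler_norml mxE subr0.
move=> i; rewrite mxE subr0 -ler_sqr ?nnegrE ?(ltW b0)// real_normK ?num_real//.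
apply: le_trans (ltW yb); rewrite /sqr_dist (bigD1 (lift ord0 i))//= mxE subr0.
by rewrite lerDl sumr_ge0// => j _; exact: sqr_ge0.
Qed.

Variables (q K : R).
Hypotheses (q1 : 1 < q) (K0 : 0 < K).
Hypothesis HK : forall s : R, `|derive1 smooth_step s| <= K.

Let q0 : 0 < q. Proof. exact: lt_trans q1. Qed.

Let partial_axial_le y : eball 0 (4 * t) y ->
  `|partial ord0 cusp_competitor y| `^ q <=
  (K * (2 / t)) `^ q * \1_(tube 0 (a M) (- (4 * t)) (4 * t)) y.
Proof.
move=> yt; have [_ da _] := axial_C1; have [_ dg _] := avg_C1.
have E j : partial ord0 (chi j) y = 0.
  by rewrite /chi partial_cutoff /= mul0r oppr0 !mulr0.
have P0 : partial ord0 cusp_competitor y =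
    (M%:R^-1 * \sum_(j < M) chi j y) * partial ord0 axial y.
  rewrite /cusp_competitor (partialM (da y ord0) (dg y ord0)) partial_avg big1.
    by rewrite !mulr0 add0r.
  by move=> j _; exact: E.
have [yT|yT] := ltP (sqr_dist radial 0 y) (a M ^+ 2); last first.
  rewrite P0 big1 ?mulr0 ?mul0r ?normr0 ?powR0 ?gt_eqF//.
    by rewrite mulr_ge0// powR_ge0.
  move=> j _; rewrite /chi (cutoff0 (ltW (a0 _)) (aa _))//; apply: le_trans yT.
  by rewrite lerXn2r ?nnegrE ?(ltW (a0 _))// a_le.
rewrite indicE mem_set ?mulr1; last exact: in_tube.
apply: ge0_ler_powR; rewrite ?nnegrE ?(ltW q0)//.
  by rewrite mulr_ge0 ?divr_ge0 ?ltW.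
rewrite P0 normrM; have /andP[g0 g1] := avg_itv y; rewrite (ger0_norm g0).
apply: (@le_trans _ _ `|partial ord0 axial y|); first by rewrite ler_piMl.
rewrite partial_axial eqxx mulr1 normrM ler_pM//.
by rewrite normrN ger0_norm// divr_ge0// ltW.
Qed.

Let partial_radial_le i y : i != ord0 -> eball 0 (4 * t) y ->
  `|partial i cusp_competitor y| `^ q <=
  \sum_(j < M) (M%:R^-1 * (K * (4 / 3 / a j))) `^ q *
    \1_(tube 0 (a j.+1) (- (4 * t)) (4 * t)) y.
Proof.
move=> i0 yt; have [_ da _] := axial_C1; have [_ dg _] := avg_C1.
have P0 : partial i cusp_competitor y =
    axial y * (\sum_(j < M) M%:R^-1 * partial i (chi j) y).
  rewrite /cusp_competitor (partialM (da y i) (dg y i)).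
  rewrite [partial i axial y]partial_axial (negbTE i0) !mulr0 addr0.
  congr (_ * _).
  by rewrite partial_avg mulr_sumr.
have nz j : partial i (chi j) y != 0 ->
    a j ^+ 2 < sqr_dist radial 0 y < a j.+1 ^+ 2.
  move=> H; apply/andP; split; rewrite ltNge; apply: contra H => H; apply/eqP;
    apply: (partial_cutoff0 (ltW (a0 _)) (aa _)); rewrite H ?orbT//.
apply: (@le_trans _ _ (`|\sum_(j < M) M%:R^-1 * partial i (chi j) y| `^ q)).
  apply: ge0_ler_powR; rewrite ?nnegrE ?(ltW q0)//.
  rewrite P0 normrM ler_piMl//; have /andP[h0 h1] := axial_itv y.
  by rewrite ger0_norm.
(* The shells between a j and a j.+1 are disjoint, so at most one term is nonzero at y: the power q
   passes through the sum without a factor depending on M, and the gain M^(1-q) survives. *)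
have disj (j k : 'I_M) : M%:R^-1 * partial i (chi j) y != 0 ->
    M%:R^-1 * partial i (chi k) y != 0 -> j = k.
  have nzM (x : R) : M%:R^-1 * x != 0 -> x != 0.
    by apply: contraNN => /eqP ->; rewrite mulr0.
  move=> /nzM/nz/andP[j1 j2] /nzM/nz/andP[k1 k2].
  have lt (j' k' : 'I_M) : a j' ^+ 2 < sqr_dist radial 0 y ->
      sqr_dist radial 0 y < a k'.+1 ^+ 2 -> (j' <= k')%N.
    move=> h1 h2; rewrite leqNgt; apply/negP => /a_le h3.
    have : a k'.+1 ^+ 2 <= a j' ^+ 2 by rewrite lerXn2r ?nnegrE ?(ltW (a0 _)).
    by rewrite leNgt (lt_trans h1 h2).
  by apply/val_inj/eqP; rewrite eqn_leq lt// lt.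
apply: le_trans (powR_sum_disjoint q0 disj) _.
apply: ler_sum => j _.
have [yT|yT] := ltP (sqr_dist radial 0 y) (a j.+1 ^+ 2); last first.
  rewrite (_ : partial i (chi j) y = 0); last first.
    by apply: (partial_cutoff0 (ltW (a0 _)) (aa _)); rewrite yT orbT.
  by rewrite mulr0 normr0 powR0 ?gt_eqF// mulr_ge0// powR_ge0.
rewrite indicE mem_set ?mulr1; last exact: in_tube.
have A0 : 0 <= M%:R^-1 * (K * (4 / 3 / a j)).
  by rewrite mulr_ge0 ?invr_ge0// mulr_ge0 ?(ltW K0)// divr_ge0// ltW.
apply: ge0_ler_powR; rewrite ?nnegrE ?(ltW q0)//.
rewrite normrM ger0_norm ?invr_ge0// ler_wpM2l ?invr_ge0//.
apply: le_trans (partial_cutoff_le radial 0 (ltW (a0 _)) (aa _) y i HK) _.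
rewrite aS ler_wpM2l ?(ltW K0)// le_eqVlt; apply/orP; left; apply/eqP.
have := a0 j; move: (a j) => b b0; field.
rewrite gt_eqF//=; have : 0 < b ^+ 2 by rewrite exprn_gt0.
by move=> ?; rewrite gt_eqF//; rewrite exprMn; lra.
Qed.

Let integral_tube_le (c b : R) : 0 <= c -> 0 < b ->
  (\int[mu]_(y in eball 0 (4 * t)) (c * \1_(tube 0 b (- (4 * t)) (4 * t)) y)%:E <=
   (c * (8 * t * (2 * b) ^+ n))%:E)%E.
Proof.
move=> c0 b0; have t0' := t0; have mT := @measurable_tube R n 0 b (- (4 * t)) (4 * t).
have mB := @measurable_eball R n.+1 0 (4 * t).
rewrite integral_indicZl// EFinM; apply: lee_wpmul2l; first by rewrite lee_fin.
apply: (@le_trans _ _ (mu (tube 0 b (- (4 * t)) (4 * t)))).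
  apply: le_measure; rewrite ?inE//; first exact: measurableI.
rewrite lebesgue_tube ?(ltW b0)//; last lra.
by rewrite lee_fin le_eqVlt; apply/orP; left; apply/eqP; congr (_ * _); lra.
Qed.

Lemma cusp_competitor_energy :
  (\sum_i \int[mu]_(y in eball 0 (4 * t)) (`|partial i cusp_competitor y| `^ q)%:E <=
   ((K * (2 / t)) `^ q * (8 * t * (2 * a M) ^+ n) +
    n%:R * \sum_(j < M) (M%:R^-1 * (K * (4 / 3 / a j))) `^ q *
      (8 * t * (2 * a j.+1) ^+ n))%:E)%E.
Proof.
have [_ _ cp] := cusp_competitor_C1; have mB := @measurable_eball R n.+1 0 (4 * t).
have mp i : measurable_fun (eball 0 (4 * t)) (fun y => `|partial i cusp_competitor y| `^ q).
  apply: measurable_funTS.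
  apply: (@measurableT_comp _ _ _ _ _ _ (@powR R ^~ q)) => //.
  by apply: measurableT_comp => //; exact: continuous_measurable_rV.
have mI c b : measurable_fun (eball 0 (4 * t))
    (fun y => c * \1_(tube 0 b (- (4 * t)) (4 * t)) y : R).
  apply: measurable_funM => //; apply: measurable_funTS.
  by apply/measurable_indicP; exact: measurable_tube.
rewrite big_ord_recl EFinD; apply: leeD.
  apply: le_trans (integral_tube_le (powR_ge0 _ _) (a0 M)).
  by apply: ge0_le_integral_real => // y yt; rewrite powR_ge0 partial_axial_le.
set S := \sum_(j < M) _ * _.
have -> : (n%:R * S)%:E = (\sum_(i < n) S%:E)%E.
  by rewrite sumEFin sumr_const card_ord (mulr_natl S n).
apply: lee_sum => i _; rewrite {}/S.
apply: (@le_trans _ _ (\int[mu]_(y in eball 0 (4 * t))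
    (\sum_(j < M) (M%:R^-1 * (K * (4 / 3 / a j))) `^ q *
    \1_(tube 0 (a j.+1) (- (4 * t)) (4 * t)) y)%:E)%E).
  apply: ge0_le_integral_real => //.
    by apply: measurable_sum => j; exact: mI.
  by move=> y yt; rewrite powR_ge0 partial_radial_le.
rewrite ge0_integral_sum_real//; last first.
  by move=> j y _; rewrite mulr_ge0// powR_ge0.
rewrite -sumEFin; apply: lee_sum => j _; apply: integral_tube_le => //.
exact: powR_ge0.
Qed.

(** The axial derivative is of order 1/t on a tube of radius a M <= d t, which yields the factor d.
    A shell of radius b <= t has energy of order b^(n-q) t <= t^(n+1-q), where q <= n enters; M
    shells weighted by M^(-q) add up to M^(1-q). *)
Lemma cusp_competitor_energy_le (d : R) : (0 < n)%N -> q <= n%:R ->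
  0 < d -> d <= 1 -> 2 ^+ M * W <= d * t ->
  (\sum_i \int[mu]_(y in eball 0 (4 * t)) (`|partial i cusp_competitor y| `^ q)%:E <=
   (((2 * K) `^ q * 8 * 2 ^+ n * d +
     n%:R * ((4 / 3 * K) `^ q * 8 * 4 ^+ n) * M%:R `^ (1 - q)) *
    t `^ (n.+1%:R - q))%:E)%E.
Proof.
move=> n0 qn d0 d1 Hd; apply: (le_trans cusp_competitor_energy).
have M1 : 0 < M%:R :> R by rewrite ltr0n.
have invq (x : R) : 0 < x -> x^-1 `^ q = x `^ (- q).
  by move=> x0; rewrite -(powR_inv1 (ltW x0)) -powRrM mulN1r.
have subq (x : R) (m : nat) : 0 < x -> x `^ (- q) * x ^+ m = x `^ (m%:R - q).
  move=> x0; rewrite -powR_mulrn ?(ltW x0)// -powRD; last by apply/implyP => _; rewrite gt_eqF.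
  by congr (_ `^ _); rewrite addrC.
have aM : a M <= d * t by [].
have tq0 : 0 <= t `^ (n.+1%:R - q) by exact: powR_ge0.
rewrite lee_fin [leRHS]mulrDl; apply: lerD.
  rewrite (_ : K * (2 / t) = 2 * K * t^-1); last by ring.
  rewrite powRM ?invr_ge0 ?(ltW t0)//; last by rewrite mulr_ge0// ltW.
  rewrite invq// -subq// exprMn.
  have : a M ^+ n <= d * t ^+ n.
    apply: (@le_trans _ _ ((d * t) ^+ n)).
      by rewrite lerXn2r ?nnegrE ?(ltW (a0 _))// (le_trans _ aM)// ltW.
    rewrite exprMn ler_wpM2r ?exprn_ge0 ?(ltW t0)//.
    by rewrite -(prednK n0) exprS ler_piMr ?(ltW d0)// exprn_ile1// ltW.
  move=> /(ler_wpM2l (_ : 0 <= (2 * K) `^ q * t `^ (- q) * 8 * t * 2 ^+ n)) H.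
  rewrite exprS.
  apply: le_trans (le_trans (H _) _); first by rewrite le_eqVlt; apply/orP; left; apply/eqP; ring.
    by rewrite !mulr_ge0 ?powR_ge0 ?exprn_ge0// ltW.
  by rewrite le_eqVlt; apply/orP; left; apply/eqP; ring.
rewrite -!mulrA ler_wpM2l//.
have term (j : 'I_M) : (M%:R^-1 * (K * (4 / 3 / a j))) `^ q * (8 * t * (2 * a j.+1) ^+ n) <=
    M%:R `^ (- q) * ((4 / 3 * K) `^ q * (8 * (4 ^+ n * t `^ (n.+1%:R - q)))).
  rewrite aS (_ : 2 * (2 * a j) = 4 * a j); last by ring.
  have b0 := a0 j; have bt : a j <= t.
    apply: (le_trans (a_le (ltnW (ltn_ord j)))); apply: (le_trans aM).
    by rewrite ler_piMl// ltW.
  move: (a j) b0 bt => b b0 bt.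
  rewrite (_ : M%:R^-1 * (K * (4 / 3 / b)) = M%:R^-1 * (4 / 3 * K) * b^-1); last by ring.
  rewrite powRM ?invr_ge0 ?(ltW b0)//; last first.
    by rewrite !mulr_ge0 ?invr_ge0// ltW.
  rewrite powRM ?invr_ge0//; last by rewrite mulr_ge0 ?(ltW K0)// divr_ge0.
  rewrite invq// invq// exprMn.
  have : b `^ (- q) * b ^+ n * t <= t `^ (n.+1%:R - q).
    rewrite subq// (_ : t `^ (n.+1%:R - q) = t `^ (n%:R - q) * t).
      rewrite ler_wpM2r ?(ltW t0)//.
      by apply: ge0_ler_powR; rewrite ?subr_ge0 ?nnegrE ?(ltW b0) ?(ltW t0).
    by rewrite -!subq// exprS; ring.
  move=> /(ler_wpM2l (_ : 0 <= M%:R `^ (- q) * (4 / 3 * K) `^ q * 8 * 4 ^+ n)) H.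
  apply: le_trans (le_trans (H _) _); first by rewrite le_eqVlt; apply/orP; left; apply/eqP; ring.
    by rewrite !mulr_ge0 ?powR_ge0 ?exprn_ge0.
  by rewrite le_eqVlt; apply/orP; left; apply/eqP; ring.
apply: le_trans (ler_sum _ (fun j _ => term j)) _.
rewrite sumr_const card_ord -[leLHS]mulr_natl.
rewrite (_ : M%:R `^ (1 - q) = M%:R * M%:R `^ (- q)); last first.
  by rewrite powRD ?powRr1//; apply/implyP => _; rewrite gt_eqF.
rewrite (mulrA 4 3^-1 K).
by rewrite le_eqVlt; apply/orP; left; apply/eqP; ring.
Qed.

End cusp_competitor.

Section cusp_not_dense.
Context {R : realType} {n : nat}.
Local Notation radial := (predC1 (ord0 : 'I_n.+1)).

Lemma sqr_dist_radial (s : R) (x : 'rV[R]_n) :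
  sqr_dist radial 0 (cons_rV s x) = enorm x ^+ 2.
Proof.
rewrite /sqr_dist big_mkcond big_ord_recl/= add0r sqr_enorm.
by apply: eq_bigr => i _; rewrite cons_rV_lift [X in _ - X]mxE subr0.
Qed.

Lemma sqr_enorm_cons (s : R) (x : 'rV[R]_n) :
  enorm (cons_rV s x) ^+ 2 = s ^+ 2 + enorm x ^+ 2.
Proof.
rewrite sqr_enorm_recl cons_rV_ord0 [in RHS]sqr_enorm; congr (_ + _).
by apply: eq_bigr => i _; rewrite cons_rV_lift.
Qed.

Lemma powR_nat_small (q e : R) : 1 < q -> 0 < e ->
  exists2 M : nat, (0 < M)%N & M%:R `^ (1 - q) <= e.
Proof.
move=> q1 e0; have q10 : 0 < q - 1 by rewrite subr_gt0.
pose x := e `^ (- (q - 1)^-1); have x0 : 0 < x by rewrite powR_gt0.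
have xM := archi_boundP (ltW x0); set M := Num.bound x in xM.
have M0 : (0 < M)%N by rewrite -(ltr0n R) (lt_trans x0).
exists M => //.
have eE : e = (x `^ (q - 1))^-1.
  by rewrite /x -powRrM mulNr mulVf ?gt_eqF// powR_inv1 ?(ltW e0)// invrK.
rewrite [leRHS]eE -[1 - q]opprB powRN lef_pV2 ?posrE ?powR_gt0 ?ltr0n//.
by apply: ge0_ler_powR; rewrite ?nnegrE ?(ltW q10) ?(ltW x0)// ltW.
Qed.

(* Near the origin only the cusp part of the domain is visible. *)
Lemma outward_cuspE (w : R -> R) (y : 'rV[R]_n.+1) :
  enorm y <= 1 / 2 -> outward_cusp n w y ->
  exists t x, [/\ y = cons_rV t x, 0 < t <= 1 & enorm x < w t].
Proof.
move=> y1 [//|]; rewrite /eball/= => y2; exfalso.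
have yE : (y - cons_rV 2 0) ord0 ord0 = y ord0 ord0 - 2.
  by rewrite [LHS]mxE [X in _ + X]mxE cons_rV_ord0.
have h1 := le_lt_trans (coord_le_enorm (y - cons_rV 2 0) ord0) y2.
have h2 := le_trans (coord_le_enorm y ord0) y1.
have h3 : Num.sqrt 2 < 3 / 2 :> R.
  by rewrite -ltr_sqr ?nnegrE ?sqrtr_ge0 ?divr_ge0// sqr_sqrtr//; lra.
by move: h1 h2; rewrite yE ltr_norml ler_norml; lra.
Qed.

(** The parameters are fixed in this order: M makes the radial energy at most half of the allowance,
    then d does so for the axial energy, and last t is small enough that 2^M w(t) <= d t. *)
Lemma cusp_not_dense (gam q : R) : 0 < gam -> (0 < n)%N -> 1 < q -> q <= n%:R ->
  ~ capacitory_dense q (outward_cusp n (cusp gam)) 0.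
Proof.
move=> g0 n0 q1 qn; apply: not_capacitory_dense; first exact: ltW.
move=> e e0; have [K K0 HK] := @derive1_smooth_step_bounded R.
have q0 : 0 < q := lt_trans ltr01 q1.
pose B1 : R := (2 * K) `^ q * 8 * 2 ^+ n.
pose B2 : R := n%:R * ((4 / 3 * K) `^ q * 8 * 4 ^+ n).
pose Nq : R := n.+1%:R `^ q.
have B10 : 0 < B1 by rewrite !mulr_gt0 ?powR_gt0 ?mulr_gt0 ?exprn_gt0.
have B20 : 0 < B2.
  have h : 0 < 4 / 3 * K by rewrite mulr_gt0// divr_gt0.
  by apply: mulr_gt0; [rewrite ltr0n|apply: mulr_gt0; [apply: mulr_gt0 => //; exact: powR_gt0|exact: exprn_gt0]].
have Nq0 : 0 < Nq by rewrite powR_gt0.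
have P1 : 0 < 2 * Nq * B1 := mulr_gt0 (mulr_gt0 (ltr0Sn R 1) Nq0) B10.
have P2 : 0 < 2 * Nq * B2 := mulr_gt0 (mulr_gt0 (ltr0Sn R 1) Nq0) B20.
have [M M0 HM] : exists2 M : nat, (0 < M)%N & M%:R `^ (1 - q) <= e / (2 * Nq * B2).
  by apply: powR_nat_small => //; rewrite divr_gt0.
pose d := Num.min 1 (e / (2 * Nq * B1)).
have d0 : 0 < d by rewrite lt_min ltr01 divr_gt0.
have d1 : d <= 1 by rewrite ge_min lexx.
have dB : d <= e / (2 * Nq * B1) by rewrite ge_min lexx orbT.
have M20 : 0 < 2 ^+ M :> R by rewrite exprn_gt0.
have [d2 d20 Hd2] := cusp_small g0 (divr_gt0 d0 M20).
have e6 : 0 < 1 / 6 :> R by rewrite divr_gt0.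
have [d3 d30 Hd3] := cusp_small g0 e6.
(* The bound 1/6 keeps norms up to 3t below 1/2, where [outward_cuspE] applies; d3/3 makes the cusp
   at height 3t at most t/2 wide. *)
exists (Num.min (Num.min d2 (d3 / 3)) (1 / 6)).
  by rewrite !lt_min d20 !divr_gt0.
move=> t t0; rewrite !lt_min => /andP[/andP[t2 t3] t6].
have [t1 Wt] := Hd2 t t0 t2.
have [_ W3] : 3 * t <= 1 /\ cusp gam (3 * t) <= 1 / 6 * (3 * t) by apply: Hd3; lra.
pose W := cusp gam t.
have W0 : 0 < W by exact: cusp_gt0.
have Wd : 2 ^+ M * W <= d * t.
  by move: Wt; rewrite mulrAC ler_pdivlMr// mulrC.
have [L HL] := @eball_sub_cube R n.+1 0 (4 * t).
have CL := Cap_le q0 (@eball_open _ _ 0 (4 * t)) HL (cusp_competitor_C1 M W t).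
apply: le_trans (CL (outward_cusp n (cusp gam) `&` eball 0 t)
  (outward_cusp n (cusp gam) `&` annulus 0 (2 * t) (3 * t)) _ _) _.
- move=> y [yO]; rewrite /eball/= subr0 => yt.
  have [s [x [yE /andP[s0 s1] xs]]] : exists s x,
      [/\ y = cons_rV s x, 0 < s <= 1 & enorm x < cusp gam s].
    by apply: outward_cuspE => //; lra.
  have st : s <= t.
    have := le_trans (coord_le_enorm y ord0) (ltW yt).
    by rewrite yE cons_rV_ord0; apply: le_trans; exact: ler_norm.
  rewrite cusp_competitor1//; first by rewrite yE cons_rV_ord0.
  rewrite yE sqr_dist_radial lerXn2r ?nnegrE ?enorm_ge0 ?(ltW W0)//.
  apply: (le_trans (ltW xs)); move: st; rewrite le_eqVlt => /predU1P[->//|st].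
  by apply/ltW/cusp_lt => //; exact: ltW.
- move=> y [yO []]; rewrite /eball/= subr0 => yt /negP; rewrite -leNgt => ty.
  have [s [x [yE /andP[s0 s1] xs]]] : exists s x,
      [/\ y = cons_rV s x, 0 < s <= 1 & enorm x < cusp gam s].
    by apply: outward_cuspE => //; lra.
  have st : s < 3 * t.
    have := le_lt_trans (coord_le_enorm y ord0) yt.
    by rewrite yE cons_rV_ord0; apply: le_lt_trans; exact: ler_norm.
  have xt : enorm x <= t / 2.
    have : cusp gam s <= cusp gam (3 * t) by apply/ltW/cusp_lt => //; exact: ltW.
    lra.
  rewrite cusp_competitor0// yE cons_rV_ord0.
  (* A point of norm at least 2t with radial part at most t/2 has height at least 3t/2, because 4 -
     1/4 >= 9/4; there the axial cutoff vanishes. *)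
  have H : (2 * t) ^+ 2 <= s ^+ 2 + enorm x ^+ 2.
    by rewrite -sqr_enorm_cons -yE lerXn2r ?nnegrE ?enorm_ge0// mulr_ge0// ltW.
  have H' : enorm x ^+ 2 <= (t / 2) ^+ 2.
    by rewrite lerXn2r ?nnegrE ?enorm_ge0// divr_ge0// ltW.
  have t20 : 0 < t ^+ 2 by rewrite exprn_gt0.
  rewrite -ler_sqr ?nnegrE ?(ltW s0)//; last by rewrite divr_ge0// mulr_ge0// ltW.
  by move: H H'; rewrite !exprMn; lra.
have EL := cusp_competitor_energy_le M0 W0 t0 q1 K0 HK n0 qn d0 d1 Wd.
apply: le_trans (lee_wpmul2l _ EL) _; first by rewrite lee_fin powR_ge0.
rewrite -EFinM lee_fin -/Nq -/B1 -/B2 [leLHS]mulrA ler_wpM2r ?powR_ge0//.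
have H1 : Nq * (B1 * d) <= e / 2.
  move: dB; rewrite ler_pdivlMr//.
  have -> : d * (2 * Nq * B1) = 2 * (Nq * (B1 * d)) by ring.
  lra.
have H2 : Nq * (B2 * M%:R `^ (1 - q)) <= e / 2.
  move: HM; rewrite ler_pdivlMr//.
  have -> : M%:R `^ (1 - q) * (2 * Nq * B2) = 2 * (Nq * (B2 * M%:R `^ (1 - q))) by ring.
  lra.
by rewrite mulrDr; lra.
Qed.

End cusp_not_dense.

(** * Hausdorff measure of balls *)

Section hausdorff_ball.
Context {R : realType} {n : nat}.
Local Notation N := n.+1.
Implicit Types (A : set 'rV[R]_N) (c : 'rV[R]_N).

Lemma ediam_ge0 A : (0 <= ediam A)%E.
Proof. by apply: ereal_sup_ubound; left. Qed.

Lemma ediam_le A (D : R) : 0 <= D ->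
  (forall x y, A x -> A y -> enorm (x - y) <= D) -> (ediam A <= D%:E)%E.
Proof.
move=> D0 H; apply: ge_ereal_sup => _ [->|[[x y] [/= Ax Ay] <-]].
  by rewrite lee_fin.
by rewrite lee_fin; exact: H.
Qed.

Lemma ediam_set0 : ediam (set0 : set 'rV[R]_N) = 0%E.
Proof.
by apply/eqP; rewrite eq_le ediam_ge0 andbT; apply: ediam_le.
Qed.

Lemma sum_if_lt (a : R) (K m : nat) : 0 <= a ->
  \sum_(0 <= k < m) (if (k < K)%N then a else 0) <= a * K%:R.
Proof.
move=> a0; rewrite big_mkord -big_mkcond/= (eq_bigl (mem [pred k : 'I_m | (k < K)%N]))// sumr_const.
rewrite -[leLHS]mulr_natr ler_wpM2l// ler_nat.
have inj : injective (fun k : 'I_m => val k) by exact: val_inj.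
have -> : #|[pred k : 'I_m | (k < K)%N]| = size [seq val k | k : 'I_m <- enum [pred k : 'I_m | (k < K)%N]].
  by rewrite size_map cardE.
rewrite -[K in leqRHS](size_iota 0 K); apply: uniq_leq_size.
  by rewrite map_inj_uniq ?enum_uniq.
by move=> k /mapP[j]; rewrite mem_enum inE => jK ->; rewrite mem_iota.
Qed.

(** The finite cover is continued by empty sets, whose diameter is 0 and whose terms vanish as the
    exponent N is positive. The factor 2^N bounds the volume of the unit ball. *)
Lemma hausdorff_delta_le (d : R) A (K : nat) (Q : 'I_K -> set 'rV[R]_N) (D : R) :
  0 <= D -> D <= d -> A `<=` \bigcup_k Q k ->
  (forall k x y, Q k x -> Q k y -> enorm (x - y) <= D) ->
  (hausdorff_delta d%:E A <= (2 ^+ N * (2^-1 * D) ^+ N * K%:R)%:E)%E.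
Proof.
move=> D0 Dd AQ HQ.
pose F (k : nat) : set 'rV[R]_N := if insub k is Some j then Q j else set0.
have FD k : (ediam (F k) <= (if (k < K)%N then D else 0)%:E)%E.
  rewrite /F; case: insubP => [j jK _|]; first by rewrite jK; apply: ediam_le => // x y; exact: HQ.
  by move=> /negbTE ->; rewrite ediam_set0.
have ball0 : (0 <= lebesgue_rV R N (eball 0 1))%E by [].
have ball1 : (lebesgue_rV R N (eball 0 1) <= (2 ^+ N)%:E)%E.
  by have := @lebesgue_eball_le R N 0 1 ler01; rewrite mulr1.
have Fk k : (lebesgue_rV R N (eball 0 1) * (2^-1%:E * ediam (F k)) ^+ N <=
    (if (k < K)%N then 2 ^+ N * (2^-1 * D) ^+ N else 0)%:E)%E.
  have := FD k; have := ediam_ge0 (F k); case: (ediam (F k)) => [e e0|_|]; [|by case: (k < K)%N|by rewrite leNgt ltNyr].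
  rewrite lee_fin in e0; rewrite lee_fin => eD.
  rewrite -EFinM -EFin_expe.
  have -> : (if (k < K)%N then 2 ^+ N * (2^-1 * D) ^+ N else 0) =
      2 ^+ N * (2^-1 * (if (k < K)%N then D else 0)) ^+ N.
    by case: ifP => // _; rewrite mulr0 expr0n mulr0.
  rewrite EFinM; apply: lee_pmul => //.
    by rewrite lee_fin exprn_ge0// mulr_ge0.
  by rewrite lee_fin lerXn2r ?nnegrE ?mulr_ge0// ?(le_trans e0)// ler_wpM2l.
apply: (@le_trans _ _ (\sum_(0 <= k <oo)
    lebesgue_rV R N (eball 0 1) * (2^-1%:E * ediam (F k)) ^+ N)%E).
  apply: ereal_inf_lbound; exists F => //; split => [x /AQ[j _ Qj]|k].
    by exists (val j) => //; rewrite /F valK.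
  apply: le_trans (FD k) _; rewrite lee_fin; case: ifP => // _.
  exact: le_trans D0 Dd.
have T0 k : (0 <= lebesgue_rV R N (eball 0 1) * (2^-1%:E * ediam (F k)) ^+ N)%E.
  by rewrite mule_ge0// expe_ge0// mule_ge0 ?lee_fin ?invr_ge0 ?ediam_ge0.
apply: lime_le; first by apply: is_cvg_nneseries => k _ _; exact: T0.
apply: nearW => m; apply: (@le_trans _ _ (\sum_(0 <= k < m)
    (if (k < K)%N then 2 ^+ N * (2^-1 * D) ^+ N else 0)%:E)%E).
  by apply: lee_sum => k _; exact: Fk.
rewrite sumEFin lee_fin; apply: sum_if_lt.
by rewrite mulr_ge0 ?exprn_ge0// mulr_ge0// invr_ge0.
Qed.

(** A cube of side 2t around the ball is divided into m^N equal cubes, m large enough for their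
    diameter to be at most [d]. The factors m^N cancel, so that the bound does not depend on [d]. *)
Lemma hausdorff_eball_le : exists2 k : R, 0 < k &
  forall c (t : R), 0 < t -> (hausdorff (eball c t) <= (k * t ^+ N)%:E)%E.
Proof.
exists (2 ^+ N * N%:R ^+ N); first by rewrite mulr_gt0 ?exprn_gt0.
move=> c t t0; apply: ge_ereal_sup => _ [d /= d0 <-].
pose m := (Num.bound (N%:R * (2 * t) / d)).+1.
have m0 : 0 < m%:R :> R by [].
pose D := N%:R * (2 * t / m%:R).
have D0 : 0 <= D by rewrite mulr_ge0// divr_ge0// mulr_ge0// ltW.
have Dd : D <= d.
  rewrite /D mulrA ler_pdivrMr// -ler_pdivrMl// mulrC.
  apply: (@le_trans _ _ (Num.bound (N%:R * (2 * t) / d))%:R); last by rewrite ler_nat.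
  by apply/ltW/archi_boundP; rewrite divr_ge0 ?(ltW d0)// mulr_ge0// mulr_ge0// ltW.
pose T := {ffun 'I_N -> 'I_m}.
pose Q (k : 'I_#|{: T}|) : set 'rV[R]_N := [set y | forall i,
  ((enum_val k : T) i)%:R <= (y ord0 i - c ord0 i + t) * m%:R / (2 * t) <=
  ((enum_val k : T) i)%:R + 1].
have H := @hausdorff_delta_le d (eball c t) _ Q D D0 Dd.
apply: (le_trans (H _ _)).
- move=> y yt.
  pose z i := (y ord0 i - c ord0 i + t) * m%:R / (2 * t).
  have z0 i : 0 <= z i < m%:R.
    have := le_lt_trans (coord_le_enorm (y - c) i) yt; rewrite !mxE ltr_norml => /andP[h1 h2].
    rewrite divr_ge0 ?mulr_ge0 ?(ltW t0)//=; last by lra.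
    rewrite ltr_pdivrMr ?mulr_gt0// mulrC ltr_pM2l//; lra.
  have zm i : (Num.truncn (z i) < m)%N.
    have /andP[h1 h2] := z0 i; rewrite -(ltr_nat R).
    by apply: le_lt_trans h2; have := truncn_itv h1 => /andP[].
  exists (enum_rank [ffun i => Ordinal (zm i)]) => // i /=.
  rewrite enum_rankK ffunE /=; have /andP[h1 h2] := z0 i.
  have := truncn_itv h1; rewrite -natr1 /z => /andP[-> /ltW ->] //.
- move=> k x y Qx Qy; apply: le_trans (enorm_le_sum _) _.
  rewrite /D mulr_natl -[N in X in _ <= X](card_ord N) -sumr_const.
  apply: ler_sum => i _; have /andP[x1 x2] := Qx i; have /andP[y1 y2] := Qy i.
  rewrite !mxE.
  move: x1 x2 y1 y2; set e := _%:R; rewrite -!mulrA.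
  set s := m%:R / (2 * t).
  have s0 : 0 < s by rewrite divr_gt0// mulr_gt0.
  have -> : 2 * (t / m%:R) = s^-1 by rewrite /s invf_div mulrA.
  move=> x1 x2 y1 y2.
  rewrite -[leRHS]mul1r ler_pdivlMr// -[X in _ * X](gtr0_norm s0) -normrM.
  rewrite ler_norml; nra.
rewrite lee_fin card_ffun !card_ord natrX.
rewrite le_eqVlt; apply/orP; left; apply/eqP.
rewrite -!mulrA; congr (_ * _); rewrite -!exprMn; congr (_ ^+ _).
by rewrite /D; field; rewrite gt_eqF.
Qed.

End hausdorff_ball.

(** * Mollification *)

Section uniform_continuity.
Context {R : realType} {n : nat}.
Local Notation V := 'rV[R]_n.
Local Notation cube := (@cube R n).
Implicit Types (G K : set V) (f : V -> R).

Lemma cube_small (d : R) : 0 < d -> exists2 e, 0 < e & cube e `<=` ball (0 : V) d.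
Proof.
move=> d0; exists (d / 2); first by rewrite divr_gt0.
move=> w /cubeP wd; rewrite -ball_normE/= sub0r normrN.
rewrite [ltLHS]/Num.norm/= mx_normrE; apply/bigmax_ltP; split=> // -[i j] _ /=.
by rewrite (ord1 i) (le_lt_trans (wd j))// ltr_pdivrMr// ltr_pMr// ltr1n.
Qed.

(** Continuity is available only at points of [G]; the covering property of the compact [K] makes
    one shift size serve all its points, including that shifted points stay in [G]. *)
Lemma compact_uniform G K f e : open G -> K `<=` G -> compact K ->
  (forall x, G x -> {for x, continuous f}) -> 0 < e ->
  exists2 d, 0 < d & forall x w, K x -> cube d w ->
    G (x + w) /\ `|f (x + w) - f x| < e.
Proof.
move=> oG KG cK cf e0.
have : \forall w \near (0 : V), K `<=` (fun x => G (x + w) /\ `|f (x + w) - f x| < e).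
  move/compact_near_coveringP : cK.
  move=> /(_ _ (nbhs (0 : V)) (fun w x => G (x + w) /\ `|f (x + w) - f x| < e) _).
  apply=> x /KG Gx.
  have addc : (p.1 + p.2 : V) @[p --> (x, 0 : V)] --> x.
    rewrite -[X in _ --> X]addr0.
    by apply: cvgD; [exact: cvg_fst|exact: cvg_snd].
  have h : 0 < e / 2 by rewrite divr_gt0.
  have /cvgrPdist_lt/(_ _ h) c1 : f (p.1 + p.2) @[p --> (x, 0 : V)] --> f x.
    by apply: cvg_comp; [exact: addc|exact: cf].
  have /cvgrPdist_lt/(_ _ h) c2 : f p.1 @[p --> (x, 0 : V)] --> f x.
    by apply: cvg_comp; [exact: cvg_fst|exact: cf].
  have c3 : \forall p \near (x, 0 : V), G (p.1 + p.2).
    by apply: addc; exact: open_nbhs_nbhs.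
  apply: filterS3 c1 c2 c3 => p p1 p2 p3; split; first by [].
  rewrite (_ : f (p.1 + p.2) - f p.1 = (f x - f p.1) - (f x - f (p.1 + p.2))); last by ring.
  by rewrite (le_lt_trans (ler_normB _ _))// [ltRHS]splitr ltrD.
move=> /nbhs_ballP[d /= d0 H]; have [d' d'0 Hd] := cube_small d0.
by exists d' => // x w Kx /Hd wd; exact: H.
Qed.

Lemma supp_cube_uniform f M e : continuous f -> supp_cube M f -> 0 < e ->
  exists2 d, 0 < d & forall x w, cube d w -> `|f (x + w) - f x| < e.
Proof.
move=> cf fM e0.
have [d d0 H] := compact_uniform openT (fun x _ => I) (@compact_cube R n (M + 1))
  (fun x _ => cf x) e0.
exists (Num.min d 1) => [|x w wd]; first by rewrite lt_min d0 ltr01.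
have wd' : cube d w by apply: (cube_le _ wd); rewrite ge_min lexx.
have [xM|xM] := pselect (cube (M + 1) x); first by have [] := H _ _ xM wd'.
have w1 : cube 1 w by apply: (cube_le _ wd); rewrite ge_min lexx orbT.
rewrite !fM ?subrr ?normr0// => /cubeP xM'.
  by apply/xM/cubeP => i; apply: le_trans (xM' i) _; rewrite lerDl.
apply/xM/cubeP => i; move/cubeP: w1 => /(_ i) w1; have := xM' i; rewrite !mxE => h.
rewrite (_ : x ord0 i = x ord0 i + w ord0 i - w ord0 i); last by ring.
by rewrite (le_trans (ler_normB _ _))// lerD.
Qed.

End uniform_continuity.

Section convolution.
Context {R : realType} {n : nat}.
Local Notation V := 'rV[R]_n.
Local Notation mu := (lebesgue_rV R n).
Local Notation cube := (@cube R n).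
Local Notation e i := (delta_mx ord0 i : 'rV[R]_n).
Implicit Types (U k : V -> R).

(** Convolution with the reflected kernel. With this sign the function of y that multiplies U is
    itself the test function put into the definition of a weak derivative. *)
Definition correlation U k (x : V) : R := (\int[mu]_y (U y * k (y - x)))%R.

Lemma measurable_shift k (x : V) : continuous k ->
  measurable_fun setT (fun y : V => k (y - x)).
Proof.
move=> ck; apply: measurableT_comp (measurable_translation (- x)).
exact: continuous_measurable_rV.
Qed.

Lemma supp_cube_bounded k M : continuous k -> supp_cube M k ->
  exists2 C, 0 <= C & forall y, `|k y| <= C.
Proof.
move=> ck kM; have [C C0 HC] := continuous_cube_bounded M ck.
exists C => // y; have [/HC//|yM] := pselect (cube M y).
by rewrite kM ?normr0.
Qed.

Lemma integrable_mul_bounded U k C : mu.-integrable setT (EFin \o U) ->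
  measurable_fun setT k -> (forall y, `|k y| <= C) ->
  mu.-integrable setT (EFin \o (fun y => U y * k y)).
Proof.
move=> iU mk kC.
rewrite (_ : EFin \o _ = (EFin \o U) \* (EFin \o k))%E; last first.
  by apply/funext => y /=; rewrite EFinM.
apply: integrableMl => //.
exists C; split; first by rewrite num_real.
by move=> M CM y _; apply: le_trans (kC y) (ltW CM).
Qed.

Lemma integrable_correlation U k M x : mu.-integrable setT (EFin \o U) ->
  continuous k -> supp_cube M k ->
  mu.-integrable setT (EFin \o (fun y => U y * k (y - x))).
Proof.
move=> iU ck kM; have [C C0 HC] := supp_cube_bounded ck kM.
by apply: (@integrable_mul_bounded _ _ C) => //; exact: measurable_shift.
Qed.

Lemma continuous_correlation U k M : mu.-integrable setT (EFin \o U) ->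
  continuous k -> supp_cube M k -> continuous (correlation U k).
Proof.
move=> iU ck kM x.
apply: (proj2 (@cvgrPdist_le R R^o V (nbhs x) (nbhs_filter x) (correlation U k) _)) => ep ep0.
pose A := (\int[mu]_y `|U y|)%R.
have A0 : 0 <= A by apply: Rintegral_ge0.
have iA : mu.-integrable setT (EFin \o (fun y => `|U y|)) by exact: integrable_norm.
have e0 : 0 < ep / (A + 1) by rewrite divr_gt0// ltr_wpDl.
have [d d0 H] := supp_cube_uniform ck kM e0.
apply: (@filterS _ _ (nbhs_filter x) _ _ _ (nbhsx_ballx x d d0)) => z xz.
have zd : cube d (x - z).
  apply/cubeP => i; rewrite !mxE.
  by rewrite -ball_normE /= in xz; apply/ltW/(le_lt_trans _ xz);
     rewrite [leRHS]/Num.norm/= mx_normrE; apply/bigmax_geP; right;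
     exists (ord0, i); rewrite //= !mxE.
rewrite /correlation -RintegralB//; try exact: (integrable_correlation _ iU ck kM).
have H1 y : `|U y * k (y - x) - U y * k (y - z)| <= ep / (A + 1) * `|U y|.
  rewrite -mulrBr normrM mulrC ler_wpM2r// distrC.
  rewrite (_ : y - z = (y - x) + (x - z)); last by rewrite addrA subrK.
  by rewrite ltW// H.
have iD : mu.-integrable setT (EFin \o (fun y => U y * k (y - x) - U y * k (y - z))).
  rewrite (_ : EFin \o _ = fun y => (U y * k (y - x))%:E - (U y * k (y - z))%:E)%E; last by apply/funext => y /=; rewrite EFinB.
  by apply: integrableB => //; exact: (integrable_correlation _ iU ck kM).
apply: le_trans (le_normr_Rintegral _ iD) _ => //.
apply: (@le_trans _ _ (\int[mu]_y (ep / (A + 1) * `|U y|))%R).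
  apply: le_Rintegral => //; first exact: integrable_norm.
  rewrite (_ : EFin \o _ = (fun y => (ep / (A + 1))%:E * (`|U y|%R)%:E)%E).
    exact: integrableZl.
  by apply/funext => y /=; rewrite EFinM.
rewrite RintegralZl//.
rewrite mulrAC ler_pdivrMr ?ltr_wpDl// ler_pM2l// lerDl//.
Qed.

(** Differentiation under the integral along the line through [x], dominated by a multiple of |U|.
    The minus sign comes from the kernel being evaluated at y - x. *)
Lemma is_derive_correlation U k M i x : mu.-integrable setT (EFin \o U) ->
  continuously_differentiable k -> supp_cube M k ->
  is_derive x (e i) (correlation U k) (- correlation U (partial i k) x).
Proof.
move=> iU [ck dk pk] kM; have pM : supp_cube M (partial i k) by exact: supp_cube_partial.
have [C C0 HC] := supp_cube_bounded (pk i) pM.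
pose f (s : R) y := U y * k (y - (s *: e i + x)).
have df (s : R) y : is_derive s 1 (f^~ y) (- (U y * partial i k (y - (s *: e i + x)))).
  have H : is_derive s 1 (fun t : R => k ((- t) *: e i + (y - x)))
      (- partial i k (y - (s *: e i + x))).
    have E : y - (s *: e i + x) = (- s) *: e i + (y - x).
      by rewrite scaleNr opprD addrCA.
    have h1 : is_derive (- s) 1 (fun t : R => k (t *: e i + (y - x)))
      (partial i k (y - (s *: e i + x))).
      by apply/is_derive_line; rewrite -E; exact: is_partial.
    have h2 : is_derive s 1 (fun t : R => - t) (-1) by exact: is_deriveN.
    have := @is_derive1_comp _ (fun t : R => k (t *: e i + (y - x))) (fun t : R => - t) s _ _ h1 h2.
    by move=> h; apply: (is_derive_eq h); rewrite mulrN1.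
  have -> : f^~ y = (U y \*: (fun t : R => k ((- t) *: e i + (y - x)))).
    apply/funext => t; rewrite /f /=; congr (_ * k _).
    by rewrite scaleNr opprD addrCA.
  by have h := is_deriveZ (U y) H; apply: (is_derive_eq h); rewrite scalerN.
have I0 : `](-1 : R), 1[%classic 0 by rewrite /= in_itv/= ltrN10 ltr01.
have := @cvg_differentiation_under_integral R _ _ mu f setT measurableT 0 (-1) 1 I0.
have h1 (s : R) : `]-1, 1[%classic s -> mu.-integrable setT (EFin \o f s).
  by move=> _; exact: (integrable_correlation _ iU ck kM).
have h2 (s : R) y : `]-1, 1[%classic s -> setT y -> derivable (f^~ y) s 1.
  by move=> _ _; have [] := df s y.
move=> /(_ h1 h2 (fun y => `|U y| * C)) h.
have cv : h^-1 *: (correlation U k (h *: e i + x) - correlation U k x) @[h --> 0^'] -->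
   (\int[mu]_y (- (U y * partial i k (y - x))))%R.
  have -> : (\int[mu]_y (- (U y * partial i k (y - x))))%R = (\int[mu]_y partial1of2 f 0 y)%R.
    congr (fine (integral _ _ _)); apply/funext => y; rewrite partial1of2E.
    by have [_ ->] := df 0 y; rewrite scale0r add0r.
  have -> : (fun h => h^-1 *: (correlation U k (h *: e i + x) - correlation U k x)) =
      (fun h : R => h^-1 *: ((fun s => \int[mu]_y f s y)%R (h + 0) -
        (fun s => \int[mu]_y f s y)%R 0)).
    by apply/funext => s; rewrite /= addr0 /f scale0r add0r.
  apply: h => [y| |s y _ _].
  - by rewrite mulr_ge0.
  - rewrite (_ : EFin \o _ = (fun y => C%:E * (`|U y|%R)%:E)%E).
      by apply: integrableZl => //; exact: integrable_norm.
    by apply/funext => y /=; rewrite EFinM muleC.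
  by rewrite partial1of2E; have [_ ->] := df s y; rewrite normrN normrM ler_wpM2l.
have E : (\int[mu]_y (- (U y * partial i k (y - x))))%R = - correlation U (partial i k) x.
  under eq_Rintegral do rewrite -mulN1r.
  by rewrite RintegralZl ?mulN1r//; exact: (integrable_correlation _ iU (pk i) pM).
rewrite -E; apply: DeriveDef; first by apply/cvg_ex; eexists; exact: cv.
exact: (cvg_lim _ cv).
Qed.

Lemma continuously_differentiable_correlation U k M :
  mu.-integrable setT (EFin \o U) -> continuously_differentiable k ->
  supp_cube M k -> continuously_differentiable (correlation U k).
Proof.
move=> iU ck kM; have [ck0 dk pk] := ck; split=> [|x i|i].
- exact: continuous_correlation kM.
- by have [] := is_derive_correlation i x iU ck kM.
rewrite (_ : partial i _ = fun x => - correlation U (partial i k) x); last first.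
  by apply/funext => x; have [_] := is_derive_correlation i x iU ck kM.
have c := continuous_correlation iU (pk i) (supp_cube_partial i kM).
by move=> x; have := cvgN (c x); apply.
Qed.

End convolution.

Section mollifier.
Context {R : realType} {n : nat}.
Local Notation V := 'rV[R]_n.+1.
Local Notation mu := (lebesgue_rV R n.+1).
Local Notation cube := (@cube R n.+1).
Implicit Types (G : set V) (x : V).

(** Kernels enter analytic estimates as $C^1$ functions; their full smoothness is recorded only
    through the last field, for translates whose supporting cube lies in [G]. *)
Record mollifier (e : R) (k : V -> R) : Prop := {
  mollifier_C1 : continuously_differentiable k ;
  mollifier_ge0 : forall y, 0 <= k y ;
  mollifier_supp : supp_cube e k ;
  mollifierN : forall y, k (- y) = k y ;
  mollifier_integral : (\int[mu]_y (k y)%:E = 1)%E ;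
  mollifier_test : forall G x, (forall w, cube e w -> G (x + w)) ->
    test_function G (fun y => k (y - x)) }.

(** The constant [a] sits in coordinate 0 alone, so that it multiplies the product once; it will
    normalize the integral without leaving the class of products. *)
Let factor (a e c : R) (j : 'I_n.+1) s :=
  (if j == ord0 then a else 1) * smooth_bump (e^-1 * s + - (e^-1 * c)).

Let smooth_factor a e c j : smooth_real (factor a e c j).
Proof.
apply: smooth_realM (smooth_real_cst _) _.
exact: smooth_real_comp smooth_smooth_bump (smooth_real_affine _ _).
Qed.

Let prod_factor a e y : prod_fun (factor a e 0) y =
  a * \prod_j smooth_bump (e^-1 * y ord0 j).
Proof.
rewrite /prod_fun /factor big_split/=; congr (_ * _).
  by rewrite big_ord_recl eqxx big1 ?mulr1.
by apply: eq_bigr => j _; rewrite mulr0 subr0.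
Qed.

Let factor_out a e c j s : 0 < e -> s \notin `[c - e, c + e] -> factor a e c j s = 0.
Proof.
move=> e0 se; rewrite /factor -mulrBr smooth_bump_out ?mulr0//.
rewrite normrM gtr0_norm ?invr_gt0// mulrC ler_pdivlMr// mul1r.
move: se; rewrite in_itv/= -ler_distlC -ltNge distrC; exact: ltW.
Qed.

Lemma mollifier_exists e : 0 < e -> exists k, mollifier e k.
Proof.
move=> e0; pose B : V -> R := prod_fun (factor 1 e 0).
have BE y : B y = \prod_j smooth_bump (e^-1 * y ord0 j) by rewrite /B prod_factor mul1r.
have B0 y : 0 <= B y by rewrite BE; apply: prodr_ge0 => j _; exact: smooth_bump_ge0.
have out a y : ~ cube e y -> prod_fun (factor a e 0) y = 0.
  move=> ye; have [j /negP yj] : exists j, ~ (`|y ord0 j| <= e).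
    by apply/existsNP => H; apply: ye; exact/cubeP.
  rewrite /prod_fun (bigD1 j)//= factor_out ?mul0r// sub0r add0r in_itv/=.
  by rewrite -ler_norml.
have C1 a : continuously_differentiable (prod_fun (factor a e 0)).
  by apply: smooth_continuously_differentiable; exact: smooth_prod_fun.
have cB : continuous B by have [] := C1 1.
have iB : mu.-integrable setT (EFin \o B) by exact: integrable_supp_cube (out 1).
have mB : measurable_fun setT B by exact: continuous_measurable_rV.
have Bfin := integrable_fin_num measurableT iB.
pose I := fine (\int[mu]_y (B y)%:E)%E.
have IE : (\int[mu]_y (B y)%:E = I%:E)%E by rewrite fineK.
have I0 : 0 < I.
  have [||m m0 Hm] := @continuous_itv_lower_bound R smooth_bump (-2^-1) 2^-1 _
      (smooth_real_continuous smooth_smooth_bump).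
  - by lra.
  - move=> s; rewrite in_itv/= -ler_norml => s1; apply: smooth_bump_gt0.
    by apply: le_lt_trans s1 _; lra.
  have : ((m ^+ n.+1)%:E * mu (cube (e / 2)) <= I%:E)%E.
    rewrite -IE -[X in mu X]setIT -integral_indicZl//; last 2 first.
    - exact: measurable_cube.
    - by rewrite exprn_ge0// ltW.
    apply: ge0_le_integral_real => //.
      by apply: measurable_funM => //; apply: measurable_indic; exact: measurable_cube.
    move=> y _; rewrite mulr_ge0 ?exprn_ge0 ?(ltW m0)//= indicE.
    case: (boolP (_ \in _)) => yc; last by rewrite mulr0.
    rewrite mulr1 BE -[n.+1 in leLHS]card_ord -prodr_const.
    move: yc; rewrite inE => /cubeP yc.
    apply: ler_prod => j _; rewrite (ltW m0)/=; apply: Hm.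
    rewrite in_itv/= -ler_norml normrM gtr0_norm ?invr_gt0// mulrC ler_pdivrMr//.
    by rewrite mulrC yc.
  rewrite lebesgue_cube ?divr_ge0 ?(ltW e0)// -EFinM lee_fin; apply: lt_le_trans.
  by rewrite mulr_gt0 ?exprn_gt0// mulr_gt0// divr_gt0.
have kE y : prod_fun (factor I^-1 e 0) y = I^-1 * B y by rewrite prod_factor BE.
exists (prod_fun (factor I^-1 e 0)); split => //.
- by move=> y; rewrite kE mulr_ge0// invr_ge0 ltW.
- exact: out.
- move=> y; rewrite !prod_factor; congr (_ * _); apply: eq_bigr => j _.
  by rewrite mxE mulrN smooth_bumpN.
- under eq_integral do rewrite kE.
  rewrite ge0_integralZl_real// ?invr_ge0 ?(ltW I0)//.
  by rewrite [X in (_ * X)%E]IE -EFinM mulVf// gt_eqF.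
move=> G x xG.
rewrite (_ : (fun y => _) = prod_fun (fun j => factor I^-1 e (x ord0 j) j)); last first.
  apply/funext => y; apply: eq_bigr => j _; rewrite /factor !mxE mulr0 subr0.
  by rewrite mulrBr.
apply: (@prod_fun_test_function _ _ _ (fun j => x ord0 j - e) (fun j => x ord0 j + e)) => //.
- by move=> j s; exact: factor_out.
move=> y yB; rewrite -(subrK x y) addrC; apply: xG; apply/cubeP => j.
by have := yB j; rewrite /= in_itv/= -ler_distlC !mxE distrC.
Qed.

End mollifier.

Section mollification.
Context {R : realType} {n : nat}.
Local Notation V := 'rV[R]_n.+1.
Local Notation mu := (lebesgue_rV R n.+1).
Local Notation cube := (@cube R n.+1).
Implicit Types (G K : set V) (x : V) (u H k : V -> R).

(** On a set of finite measure |u| <= 1 + |u|^q suffices, which is [ler_add_powR] at level 1. *)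
Lemma in_Lq_integrable q G M u : 1 <= q -> measurable G -> G `<=` cube M ->
  in_Lq q G u -> mu.-integrable G (EFin \o u).
Proof.
move=> q1 mG GM [mu_ uq]; apply/integrableP; split; first exact/measurable_EFinP.
have mq : measurable_fun G (fun x => `|u x| `^ q).
  by apply: (measurableT_comp (measurable_powR q)); exact: measurableT_comp.
apply: (@le_lt_trans _ _ (\int[mu]_(x in G) (1 + `|u x| `^ q)%:E)%E).
  apply: ge0_le_integral_real => //.
  - exact: measurableT_comp.
  - by apply: measurable_funD.
  move=> x _; rewrite normr_ge0/=.
  by have := @ler_add_powR R q `|u x| 1 q1 (normr_ge0 _) ltr01; rewrite powR1 mul1r.
rewrite ge0_integralD_real//.
rewrite lte_add_pinfty// integral_cst// mul1e.
by apply: le_lt_trans (lebesgue_cube_lty M); apply: le_measure => //;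
  rewrite inE//; exact: measurable_cube.
Qed.

Lemma correlation_patch u G k x :
  correlation (u \_ G) k x = (\int[mu]_(y in G) (u y * k (y - x)))%R.
Proof.
rewrite /correlation /Rintegral [in RHS]integral_mkcond; congr (fine (integral _ _ _)).
by apply/funext => y; rewrite !patchE; case: ifP => // _; rewrite mul0r.
Qed.

(** The derivative falls on the kernel with a minus sign, and the weak formulation, tested with the
    translated kernel, moves it to [u] with another. That kernel is a test function in [G] because
    the e-cube around [x] lies in [G]. *)
Lemma partial_correlation_weak u g G i e k x : mollifier e k ->
  measurable G -> mu.-integrable G (EFin \o u) -> weak_partial G i u g ->
  (forall w, cube e w -> G (x + w)) ->
  partial i (correlation (u \_ G) k) x = correlation (g \_ G) k x.
Proof.
move=> mk mG iu ug xG; have C1 := mollifier_C1 mk; have ke := mollifier_supp mk.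
have iU : mu.-integrable setT (EFin \o (u \_ G)).
  move/(integrable_mkcond _ mG) : iu; congr (mu.-integrable _ _).
  by apply/funext => y; rewrite /= !patchE; case: ifP.
transitivity (- correlation (u \_ G) (partial i k) x).
  by have [_] := is_derive_correlation i x iU C1 ke.
have := ug _ (mollifier_test mk xG).
rewrite !correlation_patch /Rintegral.
rewrite (_ : partial i (fun y => k (y - x)) = fun y => partial i k (y - x)); last first.
  apply/funext => y; have [_ dk _] := C1; have H := is_partial (dk (y - x) i).
  have : is_derive y (delta_mx ord0 i) (fun y => k (y - x)) (partial i k (y - x)).
    apply/is_derive_line0; move/is_derive_line0: H.
    rewrite (_ : (fun s : R => k (s *: _ + (y - x))) =
      (fun s : R => k (s *: delta_mx ord0 i + y - x)))//.
    by apply/funext => s; rewrite addrA.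
  by case.
by move=> ->; rewrite fineN opprK.
Qed.

Lemma integral_mollifier_shift e k x : mollifier e k ->
  (\int[mu]_y (k (y - x))%:E = 1)%E.
Proof.
move=> mk; rewrite -(mollifier_integral mk).
apply: (@integral_translation _ _ (- x) (EFin \o k)); apply/measurable_EFinP.
by apply: continuous_measurable_rV; have [] := mollifier_C1 mk.
Qed.

Lemma correlation_close u G e k x d : mollifier e k -> measurable G ->
  mu.-integrable G (EFin \o u) ->
  (forall w, cube e w -> G (x + w) /\ `|u (x + w) - u x| <= d) ->
  `|correlation (u \_ G) k x - u x| <= d.
Proof.
move=> mk mG iu Hd; have [ck _ _] := mollifier_C1 mk; have ke := mollifier_supp mk.
have iU : mu.-integrable setT (EFin \o (u \_ G)).
  move/(integrable_mkcond _ mG) : iu; congr (mu.-integrable _ _).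
  by apply/funext => y; rewrite /= !patchE; case: ifP.
have iUk := integrable_correlation x iU ck ke.
have i1 : mu.-integrable setT (EFin \o (fun y => k (y - x))).
  apply/integrableP; split; first by apply/measurable_EFinP; exact: measurable_shift.
  under eq_integral do rewrite gee0_abs ?lee_fin ?(mollifier_ge0 mk)//.
  by rewrite (integral_mollifier_shift x mk) ltry.
have E1 : (\int[mu]_y k (y - x))%R = 1 by rewrite /Rintegral (integral_mollifier_shift _ mk).
have iZ c : mu.-integrable setT (EFin \o (fun y => c * k (y - x))).
  rewrite (_ : EFin \o _ = (fun y => c%:E * (k (y - x))%:E))%E; first exact: integrableZl.
  by apply/funext => y /=; rewrite EFinM.
have -> : u x = (\int[mu]_y (u x * k (y - x)))%R by rewrite RintegralZl// E1 mulr1.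
rewrite -RintegralB//.
have iD : mu.-integrable setT (EFin \o (fun y => (u \_ G) y * k (y - x) - u x * k (y - x))).
  rewrite (_ : EFin \o _ = (fun y => ((u \_ G) y * k (y - x))%:E - (u x * k (y - x))%:E)%E).
    by apply: integrableB => //; exact: (iZ (u x)).
  by apply/funext => y /=; rewrite EFinB.
apply: le_trans (le_normr_Rintegral _ iD) _ => //.
apply: (@le_trans _ _ (\int[mu]_y (d * k (y - x)))%R); last by rewrite RintegralZl// E1 mulr1.
apply: le_Rintegral => //; first exact: integrable_norm.
move=> y _; rewrite -mulrBl normrM (ger0_norm (mollifier_ge0 mk _)).
have [ye|ye] := pselect (cube e (y - x)); last by rewrite ke// !mulr0.
apply: ler_wpM2r; first exact: mollifier_ge0 mk _.
by have := Hd _ ye; rewrite addrC subrK patchE => -[/mem_set ->].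
Qed.

(* Jensen's inequality up to the factor 2^q: integrate |H| <= l + l^(1-q) |H|^q
   against the kernel and choose l to be half of the left-hand side. *)
Lemma correlation_powR_le q H e k x : 1 <= q -> mollifier e k ->
  mu.-integrable setT (EFin \o H) ->
  ((`|correlation H k x| `^ q)%:E <=
   (2 `^ q)%:E * \int[mu]_y (`|H y| `^ q * k (y - x))%:E)%E.
Proof.
move=> q1 mk iH; have [ck _ _] := mollifier_C1 mk; have ke := mollifier_supp mk.
have iHk := integrable_correlation x iH ck ke.
have mH : measurable_fun setT H by apply/measurable_EFinP; case/integrableP: iH.
have mkx : measurable_fun setT (fun y : V => k (y - x)) by exact: measurable_shift.
have mHq : measurable_fun setT (fun y => `|H y| `^ q * k (y - x)).
  apply: measurable_funM => //; apply: (measurableT_comp (measurable_powR q)).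
  exact: measurableT_comp.
have k0 y : 0 <= k (y - x) by exact: mollifier_ge0 mk _.
have p0 y : 0 <= `|H y| `^ q * k (y - x) by rewrite mulr_ge0 ?powR_ge0.
set m := `|correlation H k x|; set J := (\int[mu]_y _)%E.
have q0 : 0 < q := lt_le_trans ltr01 q1.
have [m0|m0] := eqVneq m 0.
  rewrite m0 powR0 ?gt_eqF// mule_ge0 ?lee_fin ?powR_ge0//.
  by apply: integral_ge0 => y _; rewrite lee_fin.
have {}m0 : 0 < m by rewrite lt_neqAle eq_sym m0 normr_ge0.
have l0 : 0 < m / 2 by rewrite divr_gt0.
have key : (m%:E <= (m / 2)%:E + ((m / 2) `^ (1 - q))%:E * J)%E.
  have -> : m%:E = `|\int[mu]_y (H y * k (y - x))%:E|%E.
    by rewrite -[X in `|X|%E]fineK ?(integrable_fin_num measurableT iHk).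
  apply: le_trans (le_abse_integral _ _ _) _ => //.
    by case/integrableP: iHk.
  apply: (@le_trans _ _ (\int[mu]_y (m / 2 * k (y - x) +
      (m / 2) `^ (1 - q) * (`|H y| `^ q * k (y - x)))%:E)%E).
    apply: ge0_le_integral_real => //.
    - by apply: measurableT_comp => //; exact: measurable_funM.
    - by apply: measurable_funD; exact: measurable_funM.
    move=> y _; rewrite normr_ge0/= normrM (ger0_norm (k0 y)) mulrA -mulrDl.
    by apply: ler_wpM2r => //; exact: ler_add_powR.
  rewrite ge0_integralD_real//; last 4 first.
  - exact: measurable_funM.
  - exact: measurable_funM.
  - by move=> y _; rewrite mulr_ge0// ltW.
  - by move=> y _; rewrite mulr_ge0// powR_ge0.
  by rewrite !ge0_integralZl_real ?powR_ge0 ?(ltW l0)// (integral_mollifier_shift _ mk) mule1.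
have J0 : (0 <= J)%E by apply: integral_ge0 => y _; rewrite lee_fin.
move: J J0 key => [J| |]//= J0 key; last by rewrite gt0_muley ?lte_fin ?powR_gt0// leey.
move: key; rewrite -!EFinM -EFinD !lee_fin => key.
have lq : 0 < (m / 2) `^ q by rewrite powR_gt0.
have E : (m / 2) `^ (1 - q) = (m / 2) / (m / 2) `^ q.
  by rewrite powRD ?powRr1 ?powRN ?(ltW l0)//; apply/implyP => _; rewrite gt_eqF.
have h : (m / 2) `^ q <= J.
  have : m / 2 <= (m / 2) / (m / 2) `^ q * J by rewrite -E; lra.
  by rewrite -mulrA -[leLHS]mulr1 ler_pM2l// mulrC ler_pdivlMr// mul1r.
rewrite -{1}(mulfVK (_ : 2 != 0 :> R) m)// mulrC powRM ?(ltW l0)//.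
by rewrite ler_wpM2l// powR_ge0.
Qed.

(** Integrate the pointwise bound and exchange the integrals; evenness of the kernel gives it
    integral 1 in the other variable as well. *)
Lemma integral_correlation_powR_le q H e k : 1 <= q -> mollifier e k ->
  mu.-integrable setT (EFin \o H) ->
  (\int[mu]_x (`|correlation H k x| `^ q)%:E <=
   (2 `^ q)%:E * \int[mu]_y (`|H y| `^ q)%:E)%E.
Proof.
move=> q1 mk iH; have [ck _ _] := mollifier_C1 mk; have ke := mollifier_supp mk.
have mH : measurable_fun setT H by apply/measurable_EFinP; case/integrableP: iH.
have mHq : measurable_fun setT (fun y => `|H y| `^ q).
  by apply: (measurableT_comp (measurable_powR q)); exact: measurableT_comp.
have mk' : measurable_fun setT k by exact: continuous_measurable_rV.
pose f (p : V * V) := (`|H p.2| `^ q * k (p.2 - p.1))%:E.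
have mf : measurable_fun setT f.
  apply/measurable_EFinP; apply: measurable_funM.
    exact: (measurableT_comp mHq measurable_snd).
  apply: (measurableT_comp mk'); apply: measurable_fun_rV => i.
  rewrite (_ : _ \o _ = fun p : V * V => coord_rV i p.2 - coord_rV i p.1); last first.
    by apply/funext => p; rewrite /coord_rV/= !mxE.
  by apply: measurable_funB; apply: measurableT_comp (measurable_coord_rV i) _;
    [exact: measurable_snd|exact: measurable_fst].
have f0 p : (0 <= f p)%E by rewrite lee_fin mulr_ge0 ?powR_ge0 ?(mollifier_ge0 mk).
have mF : measurable_fun setT (fun x => \int[mu]_y f (x, y))%E.
  exact: (measurable_fun_fubini_tonelli_F (m2 := mu) f mf f0).
apply: (@le_trans _ _ (\int[mu]_x ((2 `^ q)%:E * \int[mu]_y f (x, y)))%E).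
  apply: ge0_le_integral_nonmeasurable => x _; first by rewrite lee_fin powR_ge0.
  exact: correlation_powR_le mk iH.
rewrite ge0_integralZl//; last by move=> x _; apply: integral_ge0.
rewrite lee_wpmul2l ?lee_fin ?powR_ge0// fubini_tonelli//.
rewrite le_eqVlt; apply/orP; left; apply/eqP; apply: eq_integral => y _.
rewrite /f /=.
rewrite ge0_integralZl_real//; last 2 first.
- apply: measurableT_comp mk' _; apply: measurable_fun_rV => i.
  rewrite (_ : _ \o _ = fun x : V => y ord0 i - coord_rV i x); last first.
    by apply/funext => p; rewrite /coord_rV/= !mxE.
  by apply: measurable_funB => //; exact: measurable_coord_rV.
- by move=> x _; exact: mollifier_ge0 mk _.
rewrite (_ : (\int[mu]_x _ = 1)%E) ?mule1//.
rewrite -(integral_mollifier_shift y mk); apply: eq_integral => x _.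
by rewrite -(mollifierN mk) opprB.
Qed.

(** One radius, from uniform continuity on [K], serves both purposes: [v] is close to [u] on [K],
    and the e-cubes around points of [K] lie in [G], so that the partial derivatives of [v] there
    are the mollified [g]. *)
Lemma mollification q G K M d u g : 1 <= q -> open G -> G `<=` cube M ->
  compact K -> K `<=` G -> 0 < d -> in_Lq q G u -> weak_gradient q G u g ->
  (forall x, G x -> {for x, continuous u}) ->
  exists v, [/\ continuously_differentiable v,
    forall x, K x -> `|v x - u x| <= d &
    forall i, (\int[mu]_(x in K) (`|partial i v x| `^ q)%:E <=
      (2 `^ q)%:E * \int[mu]_(x in G) (`|g x ord0 i| `^ q)%:E)%E].
Proof.
move=> q1 oG GM cK KG d0 uq ug cu.
have mG : measurable G by exact: open_measurable_rV.
have iu := in_Lq_integrable q1 mG GM uq.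
have patch_int h : mu.-integrable G (EFin \o h) -> mu.-integrable setT (EFin \o (h \_ G)).
  move/(integrable_mkcond _ mG); congr (mu.-integrable _ _).
  by apply/funext => y; rewrite /= !patchE; case: ifP.
have [e e0 He] := compact_uniform oG KG cK cu d0.
have [k mk] := @mollifier_exists R n e e0.
exists (correlation (u \_ G) k); split.
- exact: continuously_differentiable_correlation (patch_int _ iu) (mollifier_C1 mk)
    (mollifier_supp mk).
- move=> x Kx; apply: (correlation_close mk mG iu) => w we.
  by have [Gxw /ltW] := He _ _ Kx we.
move=> i; have [gq wg] := ug i; have ig := in_Lq_integrable q1 mG GM gq.
apply: (@le_trans _ _ (\int[mu]_x (`|correlation ((fun x => g x ord0 i) \_ G) k x| `^ q)%:E)%E).
  rewrite integral_mkcond; apply: ge0_le_integral_nonmeasurable => x _; rewrite patchE.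
    by case: ifP => // _; rewrite lee_fin powR_ge0.
  case: ifPn => [|_]; last by rewrite lee_fin powR_ge0.
  rewrite inE => Kx; rewrite (partial_correlation_weak mk mG iu wg)//.
  by move=> w we; have [] := He _ _ Kx we.
apply: le_trans (integral_correlation_powR_le q1 mk (patch_int _ ig)) _.
apply: lee_wpmul2l; first by rewrite lee_fin powR_ge0.
rewrite [in leRHS]integral_mkcond le_eqVlt; apply/orP; left; apply/eqP; apply: eq_integral => y _.
rewrite !patchE; case: ifP => // _.
by rewrite normr0 powR0// gt_eqF// (lt_le_trans ltr01).
Qed.

End mollification.

(** * Capacitory density implies fatness *)

Section integral_domain.
Context d (T : measurableType d) {R : realType}.
Variable mu : {measure set T -> \bar R}.

Lemma ge0_le_integral_domain (A B : set T) (f g : T -> \bar R) :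
  A `<=` B -> (forall x, A x -> (0 <= f x)%E) -> (forall x, B x -> (0 <= g x)%E) ->
  (forall x, A x -> (f x <= g x)%E) ->
  (\int[mu]_(x in A) f x <= \int[mu]_(x in B) g x)%E.
Proof.
move=> AB f0 g0 fg; rewrite integral_mkcond [leRHS]integral_mkcond.
apply: ge0_le_integral_nonmeasurable => x _; rewrite !patchE.
  by case: ifPn => //; rewrite inE => /f0.
have [Ax|_] := boolP (x \in A).
  by rewrite inE in Ax; rewrite mem_set ?fg//; exact: AB.
by case: ifPn => //; rewrite inE => /g0.
Qed.

End integral_domain.

(** * Truncated competitors and a Poincare inequality *)

Section capacity_transfer.
Context {R : realType} {n : nat}.
Local Notation V := 'rV[R]_n.+1.
Local Notation mu := (lebesgue_rV R n.+1).
Implicit Types (E : set V) (c : V) (z : V -> R).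

Lemma eball_le c (r s : R) : r <= s -> eball c r `<=` eball c s.
Proof. by move=> rs y /lt_le_trans; apply. Qed.

Lemma compact_closed_eball c (r : R) : compact [set y : V | enorm (y - c) <= r].
Proof.
have [M HM] := @eball_sub_cube R n.+1 c (r + 1).
apply: (@subclosed_compact _ _ (@cube R n.+1 M)); last first.
- by move=> y /= yr; apply: HM; rewrite /eball/= (le_lt_trans yr)// ltrDl.
- exact: compact_cube.
rewrite (_ : mkset _ = (fun y : V => enorm (y - c)) @^-1` [set s | s <= r])//.
apply: closed_comp; last exact: closed_le.
by move=> y _; exact: enorm_sub_continuous.
Qed.

(** Sends values up to 1/4 to 0 and values from 3/4 on to 1, so that a uniform error of 1/4 made by
    mollification is erased. *)
Let ramp (s : R) := smooth_step (2 * s + - 2^-1).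

Let smooth_ramp : smooth_real ramp.
Proof. exact: smooth_real_comp smooth_smooth_step (smooth_real_affine _ _). Qed.

Let derive1_ramp_le K s : (forall s : R, `|derive1 smooth_step s| <= K) ->
  `|derive1 ramp s| <= 2 * K.
Proof.
move=> HK; rewrite derive1E.
have /derivableP h1 := @smooth_real_derivable R _ (2 * s + - 2^-1) smooth_smooth_step.
have [_ ->] := @is_derive1_comp _ smooth_step
  (fun s => 2 * s + - 2^-1) s _ _ h1 (is_derive_affine 2 (- 2^-1) s).
by rewrite -derive1E normrM mulrC ler_pM// normr_nat.
Qed.

(** Product and chain rules are at hand for $C^1$ functions, so a nearly optimal [u] is mollified,
    on the closed ball of radius 3t, compact in B(c,4t), and then passed through [ramp], which
    restores the exact values 1 and 0. *)
Lemma truncated_competitor q : 1 <= q -> exists2 C : R, 0 < C &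
  forall E c t D, 0 < t -> (ball_cap q E c t < D%:E)%E ->
  exists z, [/\ continuously_differentiable z, forall y, 0 <= z y <= 1,
    forall y, E y -> eball c t y -> z y = 1,
    forall y, annulus c (2 * t) (3 * t) y -> z y = 0 &
    forall i, (\int[mu]_(y in eball c (3 * t)) (`|partial i z y| `^ q)%:E <= (C * D)%:E)%E].
Proof.
move=> q1; have q0 : 0 < q := lt_le_trans ltr01 q1.
have [K K0 HK] := @derive1_smooth_step_bounded R.
exists ((2 * K) `^ q * 2 `^ q) => [|E c t D t0]; first by rewrite mulr_gt0 ?powR_gt0 ?mulr_gt0.
move=> /ereal_inf_lt[_ [u [g [[[uq _] cu uE uF] ug ->]]] gD].
have [M HM] := @eball_sub_cube R n.+1 c (4 * t).
have oG := @eball_open R n.+1 c (4 * t).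
pose B3 : set V := [set y | enorm (y - c) <= 3 * t].
have KG : B3 `<=` eball c (4 * t).
  by move=> y /= yt; rewrite /eball/= (le_lt_trans yt)// ltr_pM2r// ltr_nat.
have cu' x : eball c (4 * t) x -> {for x, continuous u}.
  move=> xG; suff : {in eball c (4 * t), continuous u} by apply; rewrite inE.
  rewrite -continuous_open_subspace//; apply: continuous_subspaceW cu.
  by move=> y yG; left; left.
have e0 : 0 < 4^-1 :> R by [].
have [v [C1v vu vg]] := mollification q1 oG HM (@compact_closed_eball c (3 * t)) KG e0
  uq ug cu'.
have close y : enorm (y - c) < 3 * t -> `|v y - u y| <= 4^-1 by move=> /ltW /vu.
exists (fun y => ramp (v y)); split.
- exact: continuously_differentiable_comp.
- by move=> y; exact: smooth_step_itv.
- move=> y Ey yt; apply: smooth_step_ge1.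
  have /close : enorm (y - c) < 3 * t by rewrite (lt_trans yt)//; lra.
  have := uE y (conj Ey yt); rewrite ler_norml => u1 /andP[h1 h2]; lra.
- move=> y [y1 y2]; apply: smooth_step_le0.
  have := close _ y1; have := uF y (conj y1 y2); rewrite ler_norml => u1 /andP[h1 h2]; lra.
move=> i; have [cv dv pv] := C1v.
have mg : measurable_fun (eball c (4 * t)) (fun y => g y ord0 i) by case: (ug i) => -[].
have gi : (\int[mu]_(y in eball c (4 * t)) (`|g y ord0 i| `^ q)%:E <= D%:E)%E.
  apply: le_trans (ltW gD); apply: ge0_le_integral_nonmeasurable => y _.
    by rewrite lee_fin powR_ge0.
  by rewrite lee_fin ge0_ler_powR ?nnegrE ?(ltW q0) ?enorm_ge0// coord_le_enorm.
apply: (@le_trans _ _ (((2 * K) `^ q)%:E * \int[mu]_(y in B3)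
    (`|partial i v y| `^ q)%:E)%E).
  have mB := measurable_eball c (3 * t).
  apply: (@le_trans _ _ (((2 * K) `^ q)%:E * \int[mu]_(y in eball c (3 * t))
      (`|partial i v y| `^ q)%:E)%E).
    rewrite -ge0_integralZl_real ?powR_ge0//; last first.
      apply: (measurableT_comp (measurable_powR q)); apply: measurableT_comp => //.
      by apply: measurable_funTS; exact: continuous_measurable_rV.
    apply: ge0_le_integral_nonmeasurable => y _; rewrite lee_fin ?powR_ge0//.
    rewrite partial_comp//; last exact: smooth_real_derivable.
    rewrite normrM [leLHS]powRM// ler_wpM2r ?powR_ge0//.
    apply: ge0_ler_powR; rewrite ?nnegrE; [exact: ltW|exact: normr_ge0| |].
      by rewrite mulr_ge0// ltW.
    exact: derive1_ramp_le.
  rewrite lee_wpmul2l ?lee_fin ?powR_ge0//; apply: ge0_le_integral_domain => //.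
  by move=> y /ltW.
rewrite -mulrA [leRHS]EFinM lee_wpmul2l ?lee_fin ?powR_ge0//.
apply: le_trans (vg i) _; rewrite [leRHS]EFinM lee_wpmul2l ?lee_fin ?powR_ge0//.
Qed.

(* Poincare's inequality for functions vanishing on the annulus: integrate the
   derivative of (y_0 - c_0) z chi, chi a cutoff function, in the first coordinate. *)
Lemma integral_vanishing_annulus_le q c t z l D : 1 <= q -> 0 < t -> 0 < l ->
  continuously_differentiable z -> (forall y, 0 <= z y <= 1) ->
  (forall y, annulus c (2 * t) (3 * t) y -> z y = 0) ->
  (\int[mu]_(y in eball c (3 * t)) (`|partial ord0 z y| `^ q)%:E <= D%:E)%E ->
  (\int[mu]_(y in eball c (2 * t)) (z y)%:E <=
   (3 * t * (l * (6 * t) ^+ n.+1 + l `^ (1 - q) * D))%:E)%E.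
Proof.
move=> q1 t0 l0 C1z z01 zA HD; have [cz dz pz] := C1z.
have a0 : 0 < 2 * t by rewrite mulr_gt0.
have aa : 2 * t < 3 * t by rewrite ltr_pM2r// ltr_nat.
have b0 : 0 < 3 * t by rewrite mulr_gt0.
pose chi : V -> R := cutoff predT c (2 * t) (3 * t).
have C1chi : continuously_differentiable chi by exact: cutoff_C1.
pose x0 (y : V) := coord_rV ord0 y + cst (- c ord0 ord0) y.
have C1x0 : continuously_differentiable x0.
  apply: continuously_differentiableD; first exact: continuously_differentiable_coord.
  exact: continuously_differentiable_cst.
have C1zchi := continuously_differentiableM C1z C1chi.
pose F y := x0 y * (z y * chi y).
have C1F : continuously_differentiable F by exact: continuously_differentiableM.
have px0 y : partial ord0 x0 y = 1.
  have [_ d1 _] := @continuously_differentiable_coord R n.+1 ord0.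
  have [_ d2 _] := @continuously_differentiable_cst R n.+1 (- c ord0 ord0).
  rewrite partialD// partial_coord eqxx /partial derive_cst addr0//.
have out y : ~ eball c (3 * t) y -> chi y = 0.
  move=> /negP; rewrite -leNgt => yt; apply: cutoff0 => //; rewrite ?(ltW a0)//.
  by rewrite sqr_distT ler_sqr ?nnegrE ?enorm_ge0// ltW.
(* The gradient of the cutoff lives in the annulus where [z] vanishes, so cutting off costs nothing
   and only the derivative of [z] remains. *)
have zchi0 y : z y * partial ord0 chi y = 0.
  have [y2|y2] := leP (enorm (y - c)) (2 * t).
    rewrite partial_cutoff0 ?mulr0 ?(ltW a0)// sqr_distT.
    by rewrite ler_sqr ?nnegrE ?enorm_ge0 ?(ltW a0)// y2.
  have [y3|y3] := leP (3 * t) (enorm (y - c)).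
    rewrite partial_cutoff0 ?mulr0 ?(ltW a0)// sqr_distT; apply/orP; right.
    by rewrite ler_sqr ?nnegrE ?enorm_ge0 ?(ltW b0).
  by rewrite zA ?mul0r//; split => //=; apply/negP; rewrite -leNgt ltW.
have pF y : partial ord0 F y = z y * chi y + x0 y * (chi y * partial ord0 z y).
  have [_ dx0 _] := C1x0; have [_ dzc _] := C1zchi; have [_ dc _] := C1chi.
  rewrite partialM// px0 mulr1 partialM// zchi0 add0r; ring.
have chi01 y : 0 <= chi y <= 1 by exact: cutoff_itv.
have [M HM] := @eball_sub_cube R n.+1 c (3 * t).
have outM y : ~ cube M y -> chi y = 0 by move=> yM; apply: out => /HM.
have int0 := @integral_partial_eq0 R n.+1 F M ord0 C1F.
have {}int0 : (\int[mu]_y (partial ord0 F y)%:E = 0)%E.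
  by apply: int0 => y yM; rewrite /F outM// !mulr0.
have [czc _ _] := C1zchi; have [_ _ cpF] := C1F.
pose h y := partial ord0 F y + -1 * (z y * chi y).
have ch : continuous h.
  by apply: continuous_addr => //; apply: continuous_mulr => // y; exact: cst_continuous.
have hE y : h y = x0 y * (chi y * partial ord0 z y) by rewrite /h pF; ring.
have izc : mu.-integrable setT (EFin \o (fun y => z y * chi y)).
  by apply: (integrable_supp_cube (M := M)) => // y yM; rewrite outM// mulr0.
have ih : mu.-integrable setT (EFin \o h).
  by apply: (integrable_supp_cube (M := M)) => // y yM; rewrite hE outM// mul0r mulr0.
have ipF : mu.-integrable setT (EFin \o partial ord0 F).
  apply: (integrable_supp_cube (M := M)) => // y yM; rewrite pF outM//; ring.
have eq1 : (\int[mu]_y (z y * chi y)%:E = - \int[mu]_y (h y)%:E)%E.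
  have -> : (\int[mu]_y (h y)%:E = \int[mu]_y ((partial ord0 F y)%:E - (z y * chi y)%:E))%E.
    by apply: eq_integral => y _; rewrite -EFinB /h mulN1r.
  rewrite integralB// int0 add0e oppeK.
  by [].
have mz : measurable_fun setT (partial ord0 z) by exact: continuous_measurable_rV.
have mB := measurable_eball c (3 * t).
apply: (@le_trans _ _ (\int[mu]_y (z y * chi y)%:E)%E).
  apply: ge0_le_integral_domain => // y; rewrite ?lee_fin.
  - by have /andP[] := z01 y.
  - by move=> _; rewrite mulr_ge0//; [have /andP[] := z01 y|have /andP[] := chi01 y].
  move=> /= y2; rewrite /chi cutoff1 ?mulr1 ?(ltW a0)// sqr_distT.
  by rewrite ler_sqr ?nnegrE ?enorm_ge0 ?(ltW a0)// ltW.
rewrite eq1; apply: (@le_trans _ _ (\int[mu]_(y in eball c (3 * t))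
   (3 * t * (l + l `^ (1 - q) * `|partial ord0 z y| `^ q))%:E)%E).
  apply: le_trans (lee_abs _) _; rewrite abseN.
  apply: le_trans (le_abse_integral _ _ _) _ => //; first by case/integrableP: ih.
  rewrite [leRHS]integral_mkcond; apply: ge0_le_integral_nonmeasurable => y _ //.
  rewrite patchE; case: ifPn => [|/negP]; rewrite inE; last first.
    by move=> /out yt; rewrite /= hE yt mul0r mulr0 normr0.
  move=> yt; rewrite /= lee_fin hE normrM.
  have x0t : `|x0 y| <= 3 * t.
    apply: le_trans (ltW yt); apply: le_trans (coord_le_enorm (y - c) ord0).
    by rewrite !mxE.
  apply: ler_pM => //; apply: le_trans (ler_add_powR q1 (normr_ge0 _) l0).
  rewrite normrM; have /andP[c0 c1] := chi01 y.
  by rewrite (ger0_norm c0) ler_piMl.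
have mq : measurable_fun (eball c (3 * t)) (fun y => `|partial ord0 z y| `^ q).
  apply: (measurableT_comp (measurable_powR q)); apply: measurableT_comp => //.
  exact: measurable_funTS.
have g0 y : 0 <= l `^ (1 - q) * `|partial ord0 z y| `^ q by rewrite mulr_ge0 ?powR_ge0.
have mq' : measurable_fun (eball c (3 * t)) (fun y => l `^ (1 - q) * `|partial ord0 z y| `^ q).
  exact: measurable_funM.
rewrite ge0_integralZl_real ?(ltW b0)//; last 2 first.
- exact: measurable_funD.
- by move=> y _; rewrite addr_ge0// ltW.
rewrite [leRHS]EFinM lee_wpmul2l ?lee_fin ?(ltW b0)//.
rewrite ge0_integralD_real//; last by move=> y _; rewrite ltW.
rewrite EFinD; apply: leeD.
  rewrite integral_cst// [leRHS]EFinM lee_wpmul2l ?lee_fin ?(ltW l0)//.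
  apply: le_trans (lebesgue_eball_le _ _) _; first exact: ltW.
  by rewrite lee_fin mulrA -natrM.
by rewrite ge0_integralZl_real ?powR_ge0// [leRHS]EFinM lee_wpmul2l// lee_fin powR_ge0.
Qed.

End capacity_transfer.

(** * Passing from the radius t to the radius r *)

Section self_capacity_bound.
Context {R : realType} {n : nat}.
Local Notation V := 'rV[R]_n.+1.
Local Notation mu := (lebesgue_rV R n.+1).
Implicit Types (E : set V) (c : V).

Lemma small_coefficients (q A B C e : R) : 0 < A -> 0 < B -> 0 < C -> 0 < e ->
  exists k, exists2 d, 0 < k /\ 0 < d &
    A * d + B * k + C * (k `^ (1 - q) * d) <= e.
Proof.
move=> A0 B0 C0 e0; pose k := e / (2 * B).
have k0 : 0 < k by rewrite divr_gt0// mulr_gt0.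
have kq : 0 < k `^ (1 - q) by rewrite powR_gt0.
have S0 : 0 < A + C * k `^ (1 - q) by rewrite addr_gt0// mulr_gt0.
exists k; exists (e / (2 * (A + C * k `^ (1 - q)))).
  by split=> //; rewrite divr_gt0// mulr_gt0.
move: S0 kq; set Q := k `^ _ => S0 kq.
rewrite le_eqVlt; apply/orP; left; apply/eqP; rewrite /k; field.
by rewrite !gt_eqF.
Qed.

(** The competitor is [z] from radius [t] times a cutoff between r and 2r. As t >= r, [z] is already
    1 on the part of [E] in B(c,r), and the cutoff alone provides the zeros on the annulus at scale
    [r]. *)
Lemma self_cap_le_energy q : 1 <= q -> exists2 C : R, 0 < C &
  forall E c r t D l, 0 < r -> 11 / 10 * r <= t -> t <= 12 / 10 * r -> 0 < l ->
    0 <= D -> (ball_cap q E c t < D%:E)%E ->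
    (self_cap q E c r <= (C * (D + r `^ (- q) *
      (t * (l * t ^+ n.+1 + l `^ (1 - q) * D))))%:E)%E.
Proof.
move=> q1; have q0 : 0 < q := lt_le_trans ltr01 q1.
have [K K0 HK] := @derive1_smooth_step_bounded R.
have [C1 C10 HC1] := @truncated_competitor R n q q1.
pose L := K * (4 / 3).
have L0 : 0 < L by rewrite mulr_gt0.
pose C2 := C1 + L `^ q * (3 * (6 ^+ n.+1 + C1)).
have C20 : 0 < C2 by rewrite addr_gt0// mulr_gt0 ?powR_gt0// mulr_gt0// addr_gt0// exprn_gt0.
exists (n.+1%:R `^ q * (n.+1%:R * (2 `^ q * C2))).
  by rewrite !mulr_gt0 ?powR_gt0.
move=> E c r t D l r0 rt tr l0 D0 HD.
have t0 : 0 < t by lra.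
have [z [C1z z01 zE zA zD]] := HC1 E c t D t0 HD.
have Z := integral_vanishing_annulus_le q1 t0 l0 C1z z01 zA (zD ord0).
have r2 : r < 2 * r by lra.
pose chi : V -> R := cutoff predT c r (2 * r).
have C1chi : continuously_differentiable chi by exact: cutoff_C1.
have chi01 y : 0 <= chi y <= 1 by exact: cutoff_itv.
pose w y := chi y * z y.
have C1w : continuously_differentiable w by exact: continuously_differentiableM.
have chi0 y : ~ eball c (2 * r) y -> chi y = 0 /\ forall i, partial i chi y = 0.
  move=> /negP; rewrite -leNgt => yr.
  have yr' : (2 * r) ^+ 2 <= sqr_dist predT c y.
    by rewrite sqr_distT ler_sqr ?nnegrE ?enorm_ge0// mulr_ge0// ltW.
  split=> [|i]; first by rewrite /chi cutoff0 ?(ltW r0).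
  by rewrite /chi partial_cutoff0 ?(ltW r0)// yr' orbT.
have [M HM] := @eball_sub_cube R n.+1 c (4 * r).
apply: le_trans (Cap_le q0 (@eball_open _ _ c (4 * r)) HM C1w _ _) _.
- move=> y [Ey /ltW yr]; rewrite /w /chi (cutoff1 (ltW r0) r2) ?mul1r.
    by rewrite zE// /eball/= (le_lt_trans yr)//; lra.
  by rewrite sqr_distT lerXn2r ?nnegrE ?enorm_ge0 ?(ltW r0).
- by move=> y [_ [_ y2]]; rewrite /w (chi0 _ y2).1 mul0r.
rewrite -!mulrA [leRHS]EFinM; apply: lee_wpmul2l; first by rewrite lee_fin powR_ge0.
set S := D + _.
have [cz dz pz] := C1z; have [cc dc pc] := C1chi.
have mB := measurable_eball c (2 * t).
have mz : measurable_fun (eball c (2 * t)) z.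
  by apply: measurable_funTS; exact: continuous_measurable_rV.
have mpz i : measurable_fun (eball c (2 * t)) (fun y => `|partial i z y| `^ q).
  apply: (measurableT_comp (measurable_powR q)); apply: measurableT_comp => //.
  by apply: measurable_funTS; exact: continuous_measurable_rV.
have z0 y : 0 <= z y by have /andP[] := z01 y.
have pchi y i : `|partial i chi y| <= L / r.
  apply: le_trans (partial_cutoff_le predT c (ltW r0) r2 y i HK) _.
  have -> : (2 * r) ^+ 2 - r ^+ 2 = 3 * r ^+ 2 by ring.
  rewrite le_eqVlt; apply/orP; left; apply/eqP; rewrite /L; field.
  by rewrite gt_eqF.
(* The zeroth-order term appears with [z] to the first power because 0 <= z <= 1 gives z^q <= z;
   this is why an estimate for the integral of [z] itself is enough. *)
have pw i y : `|partial i w y| `^ q <=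
    2 `^ q * (`|partial i z y| `^ q + (L / r) `^ q * z y).
  have Lr : 0 <= L / r by rewrite divr_ge0 ?(ltW L0) ?(ltW r0).
  have Lz : 0 <= L / r * z y by rewrite mulr_ge0.
  rewrite partialM//; apply: (@le_trans _ _ ((`|partial i z y| + L / r * z y) `^ q)).
    rewrite ge0_ler_powR ?nnegrE ?(ltW q0) ?addr_ge0//.
    apply: le_trans (ler_normD _ _) _; rewrite !normrM; apply: lerD.
      by have /andP[h1 h2] := chi01 y; rewrite (ger0_norm h1) ler_piMl.
    by rewrite (ger0_norm (z0 y)) mulrC ler_wpM2r.
  apply: le_trans (powR_add_le q0 _ _) _ => //.
  rewrite ler_wpM2l ?powR_ge0// lerD2l powRM// ler_wpM2l ?powR_ge0//.
  have /andP[_ z1] := z01 y; have [->|zy] := eqVneq (z y) 0.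
    by rewrite powR0// gt_eqF.
  by rewrite ge1r_powR// lt_neqAle eq_sym zy z0.
have bound i : (\int[mu]_(y in eball c (4 * r)) (`|partial i w y| `^ q)%:E <=
    (2 `^ q * (C2 * S))%:E)%E.
  apply: (@le_trans _ _ (\int[mu]_(y in eball c (2 * t))
     (2 `^ q * (`|partial i z y| `^ q + (L / r) `^ q * z y))%:E)%E).
    rewrite integral_mkcond [leRHS]integral_mkcond.
    apply: ge0_le_integral_nonmeasurable => y _; rewrite !patchE.
      by case: ifP => // _; rewrite lee_fin powR_ge0.
    have [yt|yt] := boolP (y \in eball c (2 * t)).
      case: ifP => _; first by rewrite lee_fin.
      by rewrite lee_fin mulr_ge0 ?powR_ge0// addr_ge0 ?powR_ge0// mulr_ge0 ?powR_ge0.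
    case: ifP => // _; have [|h1 h2] := chi0 y.
      by move=> yr; move/negP: yt; apply; rewrite inE; apply: (eball_le _ yr); lra.
    by rewrite partialM// h1 h2 !mul0r mulr0 addr0 normr0 powR0// gt_eqF.
  rewrite ge0_integralZl_real ?powR_ge0//; last 2 first.
  - by apply: measurable_funD => //; exact: measurable_funM.
  - by move=> y _; rewrite addr_ge0 ?powR_ge0// mulr_ge0 ?powR_ge0.
  rewrite [leRHS]EFinM lee_wpmul2l ?lee_fin ?powR_ge0//.
  rewrite ge0_integralD_real//; last 2 first.
  - exact: measurable_funM.
  - by move=> y _; rewrite mulr_ge0 ?powR_ge0.
  rewrite ge0_integralZl_real ?powR_ge0//.
  have h1 : (\int[mu]_(y in eball c (2 * t)) (`|partial i z y| `^ q)%:E <= (C1 * D)%:E)%E.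
    apply: le_trans (zD i); apply: ge0_le_integral_domain => // y; rewrite ?lee_fin ?powR_ge0//.
    by apply: eball_le; rewrite ler_pM2r// ler_nat.
  apply: (@le_trans _ _ ((C1 * D)%:E + ((L / r) `^ q)%:E *
    (3 * t * (l * (6 * t) ^+ n.+1 + l `^ (1 - q) * (C1 * D)))%:E)%E).
    by apply: leeD => //; rewrite lee_wpmul2l// lee_fin powR_ge0.
  rewrite -EFinM -EFinD lee_fin.
  have -> : (L / r) `^ q = L `^ q * r `^ (- q).
    by rewrite powRM ?invr_ge0 ?(ltW L0) ?(ltW r0)//; congr (_ * _);
      rewrite -powR_inv1 ?(ltW r0)// -powRrM mulN1r.
  rewrite exprMn /C2 /S.
  have tn : 0 <= t ^+ n.+1 by rewrite exprn_ge0// ltW.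
  have lq : 0 <= l `^ (1 - q) by exact: powR_ge0.
  have rq : 0 <= r `^ (- q) by exact: powR_ge0.
  have Lq : 0 <= L `^ q by exact: powR_ge0.
  have sx : 0 <= 6 ^+ n.+1 :> R by rewrite exprn_ge0.
  move: tn lq rq Lq sx; set T := t ^+ n.+1; set lQ := l `^ _; set rQ := r `^ _.
  set LQ := L `^ _; set X := 6 ^+ n.+1 => tn lq rq Lq sx.
  have a1 : 0 <= C1 * (rQ * (t * (l * T + lQ * D))).
    by rewrite !mulr_ge0 ?addr_ge0 ?mulr_ge0 ?(ltW l0) ?(ltW t0) ?(ltW C10).
  have a2 : 0 <= LQ * (3 * (X + C1)) * D.
    by rewrite !mulr_ge0 ?addr_ge0 ?(ltW C10).
  have a3 : 0 <= LQ * rQ * 3 * t * (C1 * (l * T)).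
    by rewrite !mulr_ge0 ?(ltW l0) ?(ltW t0) ?(ltW C10).
  have a4 : 0 <= LQ * rQ * 3 * t * (X * (lQ * D)).
    by rewrite !mulr_ge0 ?(ltW t0).
  rewrite -subr_ge0; rewrite (_ : _ - _ = C1 * (rQ * (t * (l * T + lQ * D))) +
    LQ * (3 * (X + C1)) * D + LQ * rQ * 3 * t * (C1 * (l * T)) +
    LQ * rQ * 3 * t * (X * (lQ * D))); last by ring.
  by rewrite !addr_ge0.
apply: (@le_trans _ _ (\sum_(i < n.+1) (2 `^ q * (C2 * S))%:E)%E).
  by apply: lee_sum => i _; exact: bound.
by rewrite sumEFin lee_fin sumr_const card_ord -[leLHS]mulr_natl.
Qed.

(** With the level l = k / t and r comparable to t, all three terms scale like r^(n+1-q), with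
    coefficients d, k and k^(1-q) d: first k is taken small, then d depending on k. *)
Lemma self_cap_le q e : 1 <= q -> 0 < e -> exists2 d : R, 0 < d &
  forall E c r t, 0 < r -> 11 / 10 * r <= t -> t <= 12 / 10 * r ->
    (ball_cap q E c t < (d * t `^ (n.+1%:R - q))%:E)%E ->
    (self_cap q E c r <= (e * r `^ (n.+1%:R - q))%:E)%E.
Proof.
move=> q1 e0; have q0 : 0 < q := lt_le_trans ltr01 q1.
have [C C0 HC] := self_cap_le_energy q1.
have P0 : 0 < 2 ^+ n.+1 :> R by rewrite exprn_gt0.
have Q0 : 0 < 2 `^ q :> R by rewrite powR_gt0.
have [||||k [d [k0 d0] H]] := @small_coefficients q (C * 2 ^+ n.+1) (C * 2 ^+ n.+1)
    (C * (2 `^ q * 2 ^+ n.+1)) e => //; try by rewrite !mulr_gt0.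
exists d => // E c r t r0 rt tr HD.
have t0 : 0 < t by clear H HD; lra.
have rt' : r <= t by clear H HD; lra.
have tr2 : t <= 2 * r by clear H HD; lra.
have tq : 0 < t `^ (n.+1%:R - q) by rewrite powR_gt0.
have D0 : 0 <= d * t `^ (n.+1%:R - q) by rewrite mulr_ge0 ?(ltW d0) ?(ltW tq).
apply: le_trans (HC E c r t _ (k / t) r0 rt tr (divr_gt0 k0 t0) D0 HD) _.
rewrite lee_fin.
have tE : t `^ (n.+1%:R - q) = t ^+ n.+1 * t `^ (- q).
  by rewrite powRD ?powR_mulrn ?(ltW t0)//; apply/implyP => _; rewrite gt_eqF.
have rE : r `^ (n.+1%:R - q) = r ^+ n.+1 * r `^ (- q).
  by rewrite powRD ?powR_mulrn ?(ltW r0)//; apply/implyP => _; rewrite gt_eqF.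
have lE : (k / t) `^ (1 - q) = k `^ (1 - q) * (t `^ q / t).
  rewrite powRM ?invr_ge0 ?(ltW k0) ?(ltW t0)//; congr (_ * _).
  rewrite -powR_inv1 ?(ltW t0)// -powRrM mulN1r opprB powRD//.
  by apply/implyP => _; rewrite gt_eqF.
have tqK : t `^ q * t `^ (- q) = 1 by rewrite powRN mulfV// gt_eqF// powR_gt0.
have T2 : t ^+ n.+1 <= 2 ^+ n.+1 * r ^+ n.+1.
  by rewrite -exprMn lerXn2r ?nnegrE ?(ltW t0) ?mulr_ge0 ?(ltW r0).
have Tq : t `^ (- q) <= r `^ (- q).
  rewrite !powRN lef_pV2 ?posrE ?powR_gt0//.
  by apply: ge0_ler_powR; rewrite ?nnegrE ?(ltW q0) ?(ltW r0) ?(ltW t0).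
rewrite rE lE tE.
have tn : 0 < t ^+ n.+1 by rewrite exprn_gt0.
have rn : 0 < r ^+ n.+1 by rewrite exprn_gt0.
have rq : 0 < r `^ (- q) by rewrite powR_gt0.
have tq' : 0 < t `^ (- q) by rewrite powR_gt0.
have kq : 0 < k `^ (1 - q) by rewrite powR_gt0.
move: tqK T2 Tq tn rn rq tq' H kq.
set T := t ^+ n.+1; set Tm := t `^ (- q); set Tp := t `^ q.
set S := r ^+ n.+1; set Sm := r `^ (- q); set P := 2 ^+ n.+1; set kQ := k `^ _.
move=> tqK T2 Tq tn rn rq tq' H kq.
rewrite (_ : C * _ = C * (d * (T * Tm) + k * (Sm * T) + kQ * d * (Sm * T) * (Tp * Tm))); last first.
  by field; rewrite gt_eqF.
rewrite tqK mulr1.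
have h1 : T * Tm <= P * (S * Sm).
  by rewrite mulrA; apply: ler_pM => //; exact: ltW.
have h2 : Sm * T <= P * (S * Sm).
  by rewrite mulrA [leRHS]mulrC; apply: ler_pM => //; exact: ltW.
apply: (@le_trans _ _ (C * (d * (P * (S * Sm)) + k * (P * (S * Sm)) + kQ * d * (P * (S * Sm))))).
  rewrite ler_pM2l//; apply: lerD; first apply: lerD; apply: ler_wpM2l => //; rewrite ?ltW//.
  by rewrite mulr_gt0.
have Q1 : 1 <= 2 `^ q :> R by rewrite -[leLHS](powRr0 2) ler_powR ?ler1n// ltW.
rewrite (_ : C * _ = (C * P * d + C * P * k + C * P * (kQ * d)) * (S * Sm)); last by ring.
apply: ler_wpM2r; first by rewrite mulr_ge0 ?ltW.
apply: le_trans H; rewrite lerD2l -!mulrA ler_pM2l// mulrA -[leLHS]mul1r.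
by apply: ler_wpM2r => //; rewrite !mulr_ge0// ltW.
Qed.

End self_capacity_bound.

(** * Thin sets have small capacity at suitable radii *)

Section dense_fat.
Context {R : realType} {n : nat}.
Local Notation V := 'rV[R]_n.+1.
Implicit Types (E : set V) (x : V).

Lemma thin_small_ball_cap q E x d : 1 < q -> thin q E x -> 0 < d ->
  exists2 rho : R, 0 < rho & forall r, 0 < r -> r < rho ->
    exists t, [/\ 11 / 10 * r <= t, t <= 12 / 10 * r &
      (ball_cap q E x t < (d * t `^ (n.+1%:R - q))%:E)%E].
Proof.
move=> q1 + d0; rewrite /thin gt_eqF//.
pose f (t : R) := ((ball_cap q E x t /
  Cap q (eball x t) (annulus x (2 * t) (3 * t)) (eball x (4 * t))) `^ (q - 1)^-1 *
  (t^-1)%:E)%E.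
move=> fin; have {}fin : (\int[lebesgue_measure]_(t in `]0%R, 1%R[) f t < +oo)%E by exact: fin.
have q0 : 0 < q := lt_trans ltr01 q1.
have [k k0 Hk] := @Cap_ball_le R n q q0.
apply: contrapT => H.
pose bad r := 0 < r /\ forall t, 11 / 10 * r <= t -> t <= 12 / 10 * r ->
  ((d * t `^ (n.+1%:R - q))%:E <= ball_cap q E x t)%E.
(* The positivity of rho stands inside the existential so that choice yields a total function
   [pick]. *)
have Hbad rho : exists r, 0 < rho -> r < rho /\ bad r.
  have [rho0|rho0] := pselect (0 < rho); last by exists 0.
  apply: contrapT => Hr; apply: H; exists rho => // r r0 rr.
  apply: contrapT => Ht; apply: Hr; exists r => _; split=> //; split=> // t t1 t2.
  by rewrite leNgt; apply/negP => Hlt; apply: Ht; exists t.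
have [pick Hpick] := choice Hbad.
(* Each radius is less than half the preceding one, so 12/10 s_(j+1) < 6/10 s_j < 11/10 s_j and the
   intervals are disjoint; starting below 1/2 keeps them in ]0, 1[. *)
pose s j := iter j (fun r => pick (r / 2)) (pick (1 / 2)).
have sbad j : bad (s j) /\ s j < 1 / 2.
  elim: j => [|j [[sj0 _] sj1]] /=.
    by have [] := Hpick (1 / 2) _; first lra.
  by have [] := Hpick (s j / 2) _; [lra|split => //; lra].
have sS j : s j.+1 < s j / 2.
  by have [[sj0 _] _] := sbad j; have [] := Hpick (s j / 2) _; first lra.
have smono j m : s (j + m).+1 < s j / 2.
  elim: m => [|m IH]; first by rewrite addn0.
  rewrite addnS; have := sS (j + m).+1; have [[h _] _] := sbad (j + m).+1; lra.
pose C : R := (d / k) `^ (q - 1)^-1.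
have C0 : 0 < C by rewrite powR_gt0// divr_gt0.
have If : (0 <= \int[lebesgue_measure]_(t in `]0%R, 1%R[) f t)%E.
  apply: integral_ge0 => t; rewrite /= in_itv/= => /andP[t0 _].
  by rewrite mule_ge0 ?poweR_ge0// lee_fin invr_ge0 ltW.
have If' := ge0_fin_numE If; rewrite fin in If'.
set B := fine (\int[lebesgue_measure]_(t in `]0%R, 1%R[) f t)%E.
(* Each bad radius s contributes C / (12/10 s) over a length s/10, that is C/12, whatever its scale;
   the number of intervals is chosen so that their total exceeds the integral B. *)
have : C / 12 * (Num.bound (B / (C / 12)))%:R <= B.
  rewrite -lee_fin [leRHS]fineK//.
  have H1 := @integral_ge_disjoint_itv R f (fun j => 11 / 10 * s j) (fun j => 12 / 10 * s j)
    (fun j => C * (12 / 10 * s j)^-1) (Num.bound (B / (C / 12))).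
  apply: le_trans (H1 _ _ _ _ _ _) => {H1}.
  - rewrite lee_fin (eq_bigr (fun=> C / 12)) => [|j _].
      by rewrite sumr_const card_ord -[leRHS]mulr_natr.
    have [[sj _] _] := sbad j; field; by rewrite gt_eqF.
  - move=> t /andP[t0 _]; apply: mule_ge0; first exact: poweR_ge0.
    by rewrite lee_fin invr_ge0 ltW.
  - by move=> j; have [[sj _] _] := sbad j; lra.
  - by move=> j; have [[sj _] sj'] := sbad j; lra.
  - by move=> j; have [[sj _] _] := sbad j; rewrite mulr_ge0 ?invr_ge0 ?(ltW C0)//; lra.
  - move=> j m jm; have := smono j (m - j).-1.
    rewrite -addnS prednK ?subn_gt0// subnKC ?(ltnW jm)//.
    by have [[sj _] _] := sbad j; lra.
  move=> j t /andP[t1 t2]; have [[sj Hsj] _] := sbad j.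
  have t0 : 0 < t by apply: lt_trans t1; rewrite mulr_gt0.
  rewrite EFinM /f; apply: lee_pmul.
  - by rewrite lee_fin ltW.
  - by rewrite lee_fin invr_ge0 mulr_ge0// ltW.
  - have tq : 0 < t `^ (n.+1%:R - q) by rewrite powR_gt0.
    rewrite /C -poweR_EFin; apply: gt0_ler_poweR.
    + by rewrite invr_ge0 subr_ge0 ltW.
    + by rewrite in_itv/= leey andbT lee_fin divr_ge0// ltW.
    + rewrite in_itv/= leey andbT; apply: mule_ge0; first exact: Cap_ge0.
      by rewrite inve_ge0 Cap_ge0.
    rewrite (_ : d / k = (d * t `^ (n.+1%:R - q)) / (k * t `^ (n.+1%:R - q))); last first.
      by move: tq; move: (t `^ _) => Q Q0; field; rewrite !gt_eqF.
    apply: lee_pdiv; rewrite ?Cap_ge0//.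
    + by rewrite mulr_ge0// ltW.
    + by rewrite mulr_gt0.
    + by apply: Hsj; exact: ltW.
    + exact: Hk.
  by rewrite lee_fin lef_pV2 ?posrE ?mulr_gt0// ltW.
have C12 : 0 < C / 12 by rewrite divr_gt0.
rewrite mulrC -ler_pdivlMr// leNgt archi_boundP//.
by rewrite divr_ge0 ?fine_ge0// ltW.
Qed.

Lemma hausdorff_ge0 (A : set V) : (0 <= hausdorff A)%E.
Proof.
apply: le_trans (ereal_sup_ubound _); last by exists 1; [exact: ltr01|reflexivity].
apply: le_ereal_inf_tmp => _ [F _ <-]; apply: nneseries_ge0 => k _ _.
by rewrite mule_ge0// expe_ge0// mule_ge0 ?lee_fin ?invr_ge0 ?ediam_ge0.
Qed.

Lemma self_cap_le_ball_cap q E x t : (self_cap q E x t <= ball_cap q E x t)%E.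
Proof.
apply: le_ereal_inf_tmp => _ [u [g [[su cu uE uF] ug ->]]].
apply: ereal_inf_lbound; exists u, g; split=> //; split=> //; last by move=> y [_ /uF].
apply: continuous_subspaceW cu => y [yG|[_ yF]]; first by left.
by right.
Qed.

(** If the capacity exceeded e t^n, the bound k t^(n+1) on the measure of the ball would force the
    quantity whose limit is 0 to be at least e / k. *)
Lemma thin1_small_ball_cap E x e : thin 1 E x -> 0 < e ->
  exists2 d : R, 0 < d & forall t, 0 < t -> t < d ->
    (ball_cap 1 E x t <= (e * t `^ (n.+1%:R - 1))%:E)%E.
Proof.
rewrite /thin eqxx => thE e0; have [k k0 Hk] := @hausdorff_eball_le R n.
have ek : (0 < (e / k)%:E)%E by rewrite lte_fin divr_gt0.
have := thE [set y | (y < (e / k)%:E)%E] _.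
case; first by apply: open_nbhs_nbhs; split => //; exact: open_ereal_lt_ereal.
move=> d /= d0 Hd; exists d => // t t0 td.
have := Hd t; rewrite /= sub0r normrN gtr0_norm// => /(_ td t0).
apply: contraPP => /negP; rewrite -ltNge => Hlt; apply/negP; rewrite -leNgt.
have tq : 0 < t `^ (n.+1%:R - 1) by rewrite powR_gt0.
have tE : t ^+ n.+1 = t * t `^ (n.+1%:R - 1).
  rewrite -[t in t * _]powRr1 ?(ltW t0)// -powRD; last by apply/implyP => _; rewrite gt_eqF.
  by rewrite addrC subrK powR_mulrn// ltW.
rewrite (_ : e / k = t * ((e * t `^ (n.+1%:R - 1)) / (k * t ^+ n.+1))); last first.
  by rewrite tE; move: tq; move: (t `^ _) => Q Q0; field; rewrite !gt_eqF.
rewrite EFinM lee_wpmul2l ?lee_fin ?(ltW t0)//; apply: lee_pdiv.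
- by rewrite mulr_ge0// ltW.
- by rewrite mulr_gt0// exprn_gt0.
- exact: ltW.
- exact: hausdorff_ge0.
- exact: Hk.
Qed.

Lemma capacitory_dense_fat q E x : 1 <= q -> capacitory_dense q E x -> fat q E x.
Proof.
move=> q1 dE thE; apply: not_capacitory_dense dE => // e e0.
move: q1; rewrite le_eqVlt => /predU1P[q1|q1].
  rewrite -q1 in thE *; have [d d0 Hd] := thin1_small_ball_cap thE e0.
  exists d => // t t0 td; exact: le_trans (self_cap_le_ball_cap _ _ _ _) (Hd t t0 td).
have [d d0 Hd] := @self_cap_le R n q e (ltW q1) e0.
have [rho rho0 Hrho] := thin_small_ball_cap q1 thE d0.
exists rho => // r r0 rr; have [t [t1 t2 Ht]] := Hrho r r0 rr.
exact: (Hd E x r t).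
Qed.

End dense_fat.

Theorem proposition1p1 (R : realType) (n : nat) (hn : (3 <= n.+1)%N) :
  (forall (Omega : set 'rV[R]_n.+1) (x : 'rV[R]_n.+1) (q : R),
     domain Omega -> 1 <= q -> capacitory_dense q Omega x -> fat q Omega x) /\
  (forall q : R, 1 < q -> q <= n.+1%:R - 1 ->
     exists w : R -> R, [/\ doubling_cusp_function w,
       fat q (outward_cusp n w) 0 &
       ~ capacitory_dense q (outward_cusp n w) 0]).
Proof.
split=> [A x q _ q1|q q1 qn]; first exact: capacitory_dense_fat.
have n2 : (1 < n)%N by rewrite -ltnS.
have q1' : 0 < q - 1 by rewrite subr_gt0.
have g0 : 0 < (q - 1) / n%:R by rewrite divr_gt0// ltr0n ltnW.
exists (cusp ((q - 1) / n%:R)); split.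
- exact: doubling_cusp_function_cusp.
- exact: cusp_fat.
apply: cusp_not_dense => //; first exact: ltnW.
by move: qn; rewrite -natr1 addrK.
Qed.
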